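(* Let $0<\Delta<\frac16$ and suppose there is a constant $A(\Delta)>0$ such that for all sufficiently large $t$ and all real $a,b$ with $0<a\le b\le 2a$ and $b\le\sqrt{t/(2\pi)}$, $$\Big|\sum_{a\le n<b} n^{it}\Big|<A(\Delta)\sqrt{a}\,t^{\Delta}.$$ Let $\psi(T)$ be any positive function with $\psi(T)\to\infty$ as $T\to\infty$. Then for all sufficiently large $T$, the interval $(T,T+T^{\Delta}\psi(T))$ contains a root of odd order of the equation $Z'(t)=0$ (equivalently, a point of local maximum or local minimum of $Z(t)$).
   Context: $\zeta$ is the Riemann zeta-function. For real $t>0$, $\vartheta(t)=-\frac t2\ln\pi+\operatorname{Im}\ln\Gamma\left(\frac14+\frac12 it\right)$ (so $\vartheta(t)=\frac t2\ln\frac t{2\pi}-\frac t2-\frac\pi8+O(1/t)$), and $Z(t)=e^{i\vartheta(t)}\zeta\left(\frac12+it\right)$, which is a real-valued real-analytic function of real $t$. The sums over $n$ run over positive integers. A root of odd order of $Z'(t)=0$ is a real zero of $Z'$ of odd multiplicity. *)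

(* Defs.v *)
From Stdlib Require Import Reals Lra ZArith Arith ClassicalEpsilon.
Open Scope R_scope.

Definition lim_seq (u : nat -> R) : R :=
  epsilon (inhabits 0) (fun l => Un_cv u l).

(** Im ln Gamma(1/4 + i t/2), continuous branch (real on the real axis),
    via Gauss' product Gamma(z) = lim n! n^z / (z (z+1) ... (z+n)):
    Im ln Gamma(z) = lim_n [ (t/2) ln n - sum_{k=0}^n arg(z+k) ],
    arg(1/4 + k + i t/2) = atan (2t/(4k+1)). *)
Definition im_lngamma (t : R) : R :=
  lim_seq (fun n => t / 2 * ln (INR n)
                    - sum_f_R0 (fun k => atan (2 * t / (4 * INR k + 1))) n).

Definition vartheta (t : R) : R := - (t / 2) * ln PI + im_lngamma t.

(** Dirichlet eta function at s = 1/2 + i t: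
    eta(s) = sum_{n>=1} (-1)^(n-1) n^(-s), n^(-s) = n^(-1/2)(cos(t ln n) - i sin(t ln n)). *)
Definition eta_re (t : R) : R :=
  lim_seq (fun N => sum_f_R0 (fun k =>
     (-1) ^ k / sqrt (INR (S k)) * cos (t * ln (INR (S k)))) N).
Definition eta_im (t : R) : R :=
  lim_seq (fun N => sum_f_R0 (fun k =>
     - ((-1) ^ k / sqrt (INR (S k)) * sin (t * ln (INR (S k))))) N).

(** zeta(s) = eta(s) / (1 - 2^(1-s)), valid for Re s > 0; on s = 1/2 + it,
    1 - 2^(1-s) = (1 - sqrt2 cos(t ln 2)) + i sqrt2 sin(t ln 2), never 0. *)
Definition den_re (t : R) : R := 1 - sqrt 2 * cos (t * ln 2).
Definition den_im (t : R) : R := sqrt 2 * sin (t * ln 2).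

Definition zeta_re (t : R) : R :=
  (eta_re t * den_re t + eta_im t * den_im t) / (den_re t ^ 2 + den_im t ^ 2).
Definition zeta_im (t : R) : R :=
  (eta_im t * den_re t - eta_re t * den_im t) / (den_re t ^ 2 + den_im t ^ 2).

(** Z(t) = e^{i vartheta(t)} zeta(1/2 + it)  (a real number; we take its real part). *)
Definition Zfun (t : R) : R :=
  cos (vartheta t) * zeta_re t - sin (vartheta t) * zeta_im t.

Definition deriv_seq (f : R -> R) (D : nat -> R -> R) : Prop :=
  D O = f /\ forall (n : nat) (x : R), derivable_pt_lim (D n) x (D (S n) x).

Definition odd_order_root_of_deriv (f : R -> R) (t0 : R) : Prop :=
  exists D : nat -> R -> R, deriv_seq f D /\
    exists m : nat, Nat.odd m = true /\
      (forall j : nat, (j < m)%nat -> D (S j) t0 = 0) /\ D (S m) t0 <> 0.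

Definition expsum_re (t a b : R) : R :=
  sum_f_R0 (fun n => if Rle_dec a (INR n) then
                       if Rlt_dec (INR n) b then
                         (if Nat.eq_dec n 0 then 0 else cos (t * ln (INR n)))
                       else 0 else 0) (Z.to_nat (up b)).
Definition expsum_im (t a b : R) : R :=
  sum_f_R0 (fun n => if Rle_dec a (INR n) then
                       if Rlt_dec (INR n) b then
                         (if Nat.eq_dec n 0 then 0 else sin (t * ln (INR n)))
                       else 0 else 0) (Z.to_nat (up b)).

(* Main.v *)
(** Idea. Let Xi(t) be pi^(-s/2) Gamma(s/2) zeta(s) / 2 at s = 1/2 + it, written as the cosine transform
    of an even kernel built from the theta function; theta inversion (Poisson summation, through the
    Fejer kernel) makes it real. Gauss' product identifies vartheta as the phase of the Gamma factor,
    so Z = Xi / |gamma| is real and smooth, and since Xi and |gamma|^2 have factorially bounded derivatives, Z' has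
    a zero of odd order wherever it changes sign.

    As Z is real, its value is controlled by the nonnegative frequencies vartheta'(T) - ln n of the
    Dirichlet polynomial alone, that is by n up to about sqrt(T/(2 pi)); the projection is done by a smooth
    kernel. Partial summation and the hypothesis on dyadic blocks give |Z(t)| <= C t^Delta ln t.

    If Z' had no zero of odd order in (T, T + M T^Delta), then Z would be monotone there and its total
    variation at most 2 C T^Delta ln T. But averaging its increments over steps h0 = 1/(8 L), L = vartheta'(T)
    up to O(1/T), against the phase of the term n = 1 shows that they are bounded below on average, so the
    variation is at least a constant times M T^Delta ln T: a contradiction for large M. *)

Require Import Defs.
From Stdlib Require Import Reals Lra Lia ZArith List ClassicalEpsilon FunctionalExtensionality Classical.
From Coquelicot Require Import Coquelicot.
Import ListNotations.
Open Scope R_scope.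

(* Coquelicot states equalities of integrals in the carrier of a canonical structure, where [ring] and [field] fail. *)
Ltac toR := match goal with |- @eq _ ?a ?b => change (@eq R a b) end.

(** * Integrals of exponentially decaying functions *)

(** No approximate functional equation is used. Near T, Z is replaced by a Dirichlet polynomial of
    length about T^3 with linearised phases: Z(T + h) is a sum of b_n e^(i h (Lam T - ln n)) up to
    O((1 + h^2) / sqrt T). The range sqrt(T / (2 pi)) < n <= T^3 is far too long to estimate
    directly; its frequencies are negative, and the reality of Z disposes of them. The kernel of the
    projection uses shifts up to about 2^m = T^(1/4): more would spoil the error h^2 / sqrt T, fewer
    would leave a transition zone around sqrt(T / (2 pi)) contributing more than ln T. In the lower
    bound one average over J steps damps the terms n >= 2 by about T^(- Delta) only, while their
    coefficients sum to O(T^2); so k + 1 averages are iterated, with (k + 1) Delta >= 4. Delta < 1/6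
    keeps h^2 / sqrt T small for h up to M T^Delta. Finally, the quotient Xi / |gamma| does not
    visibly inherit factorial derivative bounds; that Z' has only zeros of finite order is read off
    from Xi^2 - K^2 |gamma|^2. *)

Definition cont (f : R -> R) : Prop := forall x, continuous f x.

Lemma cont_ex_RInt f a b : cont f -> ex_RInt f a b.
Proof. intros H; apply (ex_RInt_continuous (V := R_CompleteNormedModule)); intros; apply H. Qed.

Lemma cont_derivable f : (forall x, ex_derive f x) -> cont f.
Proof. intros H x; apply (ex_derive_continuous f x); apply H. Qed.

Lemma cont_plus f g : cont f -> cont g -> cont (fun x => f x + g x).
Proof. intros Hf Hg x; apply (continuous_plus f g); auto. Qed.

Lemma cont_mult f g : cont f -> cont g -> cont (fun x => f x * g x).
Proof. intros Hf Hg x; apply (continuous_mult f g); auto. Qed.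

Lemma cont_const k : cont (fun _ => k).
Proof. intros x; apply continuous_const. Qed.

Lemma cont_scal k f : cont f -> cont (fun x => k * f x).
Proof. intros Hf; apply (cont_mult (fun _ => k)); auto using cont_const. Qed.

Lemma cont_abs f : cont f -> cont (fun x => Rabs (f x)).
Proof. intros Hf x; apply (continuous_comp f Rabs); [apply Hf | apply continuous_Rabs]. Qed.

Lemma cont_comp f g : cont f -> cont g -> cont (fun x => f (g x)).
Proof. intros Hf Hg x; apply (continuous_comp g f); auto. Qed.

Lemma RInt_plus_R f g a b : cont f -> cont g ->
  RInt (fun x => f x + g x) a b = RInt f a b + RInt g a b.
Proof. intros; apply (RInt_plus f g); apply cont_ex_RInt; auto. Qed.

Lemma RInt_scal_R k f a b : cont f -> RInt (fun x => k * f x) a b = k * RInt f a b.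
Proof. intros; apply (RInt_scal f a b k); apply cont_ex_RInt; auto. Qed.

Lemma RInt_const_R k a b : RInt (fun _ => k) a b = (b - a) * k.
Proof. rewrite RInt_const. reflexivity. Qed.

Lemma RInt_Chasles_R f a b c : cont f -> RInt f a b + RInt f b c = RInt f a c.
Proof. intros; apply (RInt_Chasles f a b c); apply cont_ex_RInt; auto. Qed.

Lemma RInt_FTC F f a b : (forall x, is_derive F x (f x)) -> cont f ->
  RInt f a b = F b - F a.
Proof.
intros HF Hf. apply is_RInt_unique.
apply (is_RInt_derive F f a b); intros; auto.
Qed.

Lemma RInt_le_abs f g a b : a <= b -> cont f -> cont g ->
  (forall x, a <= x <= b -> Rabs (f x) <= g x) -> Rabs (RInt f a b) <= RInt g a b.
Proof.
intros Hab Hf Hg H.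
eapply Rle_trans; [apply abs_RInt_le; [auto | apply cont_ex_RInt; auto]|].
apply RInt_le; auto; try (apply cont_ex_RInt; auto using cont_abs).
intros; apply H; lra.
Qed.

Lemma RInt_comp_opp_R f a b : cont f -> RInt (fun x => f (- x)) a b = RInt f (- b) (- a).
Proof.
intros Hf.
rewrite <- (opp_RInt_swap f); [|apply cont_ex_RInt; auto].
assert (H := RInt_comp_lin f (-1) 0 a b).
replace (-1 * a + 0) with (- a) in H by ring.
replace (-1 * b + 0) with (- b) in H by ring.
rewrite <- H by (apply cont_ex_RInt; auto).
assert (Hc : cont (fun x => f (-x))).
{ apply (cont_comp f (fun x => - x)); auto. apply cont_derivable; intros; auto_derive; auto. }
rewrite (RInt_ext (fun y => scal (-1) (f (-1 * y + 0))) (fun x => -1 * f (- x))).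
- rewrite RInt_scal_R; auto.
  assert (G : forall r : R, r = - (-1 * r)) by (intros; ring). apply G.
- intros x _; unfold scal; simpl; unfold mult; simpl. assert (E : (-1 * x + 0 = - x :> R)) by ring. rewrite E. reflexivity.
Qed.

Lemma RInt_shift f c a b : cont f -> RInt (fun x => f (x + c)) a b = RInt f (a + c) (b + c).
Proof.
intros Hf.
assert (H := RInt_comp_lin f 1 c a b).
replace (1 * a + c) with (a + c) in H by ring.
replace (1 * b + c) with (b + c) in H by ring.
rewrite <- H by (apply cont_ex_RInt; auto).
apply RInt_ext; intros; unfold scal; simpl; unfold mult; simpl.
rewrite !Rmult_1_l; reflexivity.
Qed.

(** The two endpoints go to infinity independently, so that a translate of the integrand has the
    same integral. *)
Definition is_IR (f : R -> R) (l : R) : Prop :=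
  forall eps, 0 < eps -> exists X, forall a b, a <= - X -> X <= b -> Rabs (RInt f a b - l) < eps.

Definition IR (f : R -> R) : R := epsilon (inhabits 0) (is_IR f).

(** Exponential decay survives translation, bounded factors and multiplication by powers of u, which
    is what differentiation under the integral sign requires. *)
Definition dec (f : R -> R) : Prop :=
  cont f /\ exists C b, 0 < b /\ forall u, Rabs (f u) <= C * exp (- b * Rabs u).

Lemma dec_cont f : dec f -> cont f.
Proof. intros [H _]; exact H. Qed.

Lemma dec_const_nonneg f C b : (forall u, Rabs (f u) <= C * exp (- b * Rabs u)) -> 0 <= C.
Proof.
intros H. specialize (H 0). rewrite Rabs_R0, Rmult_0_r, exp_0 in H. generalize (Rabs_pos (f 0)); lra.
Qed.

Lemma dec_dom f g K : cont f -> dec g -> (forall u, Rabs (f u) <= K * Rabs (g u)) -> 0 <= K -> dec f.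
Proof.
intros Hf [Hg [C [b [Hb H]]]] H2 HK; split; auto.
exists (K * C), b; split; auto. intros u.
eapply Rle_trans; [apply H2|]. rewrite Rmult_assoc.
apply Rmult_le_compat_l; auto.
Qed.

Lemma dec_plus f g : dec f -> dec g -> dec (fun u => f u + g u).
Proof.
intros [Hf [C1 [b1 [Hb1 H1]]]] [Hg [C2 [b2 [Hb2 H2]]]]. split; [apply cont_plus; auto|].
assert (0 <= C1) by exact (dec_const_nonneg _ _ _ H1).
assert (0 <= C2) by exact (dec_const_nonneg _ _ _ H2).
exists (C1 + C2), (Rmin b1 b2); split; [apply Rmin_glb_lt; auto|]. intros u.
assert (Hm : forall b, Rmin b1 b2 <= b -> exp (- b * Rabs u) <= exp (- Rmin b1 b2 * Rabs u)).
{ intros b Hb. destruct (Req_dec (Rmin b1 b2) b) as [->|]; [lra|].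
  destruct (Req_dec (Rabs u) 0) as [->|]; [rewrite !Rmult_0_r; lra|].
  left; apply exp_increasing. generalize (Rabs_pos u); nra. }
eapply Rle_trans; [apply Rabs_triang|].
specialize (H1 u); specialize (H2 u).
assert (A1 := Hm b1 (Rmin_l _ _)). assert (A2 := Hm b2 (Rmin_r _ _)). nra.
Qed.

Lemma dec_minus f g : dec f -> dec g -> dec (fun u => f u - g u).
Proof.
intros Hf Hg. apply dec_plus; auto.
apply dec_dom with (g := g) (K := 1); auto; try lra.
- replace (fun u => - g u) with (fun u => -1 * g u).
  + apply cont_scal, dec_cont; auto.
  + apply functional_extensionality; intros; ring.
- intros u; rewrite Rabs_Ropp; lra.
Qed.

Lemma dec_mulb f g K : dec f -> cont g -> (forall u, Rabs (g u) <= K) -> dec (fun u => f u * g u).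
Proof.
intros Hf Hg H. apply dec_dom with (g := f) (K := K); auto.
- apply cont_mult; auto using dec_cont.
- intros u; rewrite Rabs_mult, Rmult_comm. apply Rmult_le_compat_r; auto using Rabs_pos.
- eapply Rle_trans; [apply (Rabs_pos (g 0)) | apply H].
Qed.

Lemma dec_scal k f : dec f -> dec (fun u => k * f u).
Proof.
intros Hf. apply dec_dom with (g := f) (K := Rabs k); auto using Rabs_pos.
- apply cont_scal, dec_cont; auto.
- intros u; rewrite Rabs_mult; lra.
Qed.

Lemma dec_abs f : dec f -> dec (fun u => Rabs (f u)).
Proof.
intros Hf. apply dec_dom with (g := f) (K := 1); auto; try lra.
- apply cont_abs, dec_cont; auto.
- intros; rewrite Rabs_Rabsolu; lra.
Qed.

Lemma exp_le x y : x <= y -> exp x <= exp y.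
Proof. intros [H| ->]; [left; apply exp_increasing; auto | lra]. Qed.

Lemma dec_shift f c : dec f -> dec (fun u => f (u + c)).
Proof.
intros [Hf [C [b [Hb H]]]]. split.
- apply (cont_comp f (fun u => u + c)); auto. apply cont_derivable; intros; auto_derive; auto.
- assert (0 <= C) by exact (dec_const_nonneg _ _ _ H).
  exists (C * exp (b * Rabs c)), b; split; auto. intros u.
  eapply Rle_trans; [apply H|]. rewrite Rmult_assoc, <- exp_plus.
  apply Rmult_le_compat_l; auto. apply exp_le.
  assert (Rabs u <= Rabs (u + c) + Rabs c).
  { replace u with ((u + c) + - c) at 1 by ring. rewrite <- (Rabs_Ropp c). apply Rabs_triang. }
  nra.
Qed.

(** One term of the exponential series is at most the whole series; the proof compares derivatives.
    The factorial is the source of the bounds C n! / r^n that stand for analyticity below. *)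
Lemma pow_exp_bound n x b : 0 < b -> 0 <= x -> x ^ n <= INR (fact n) / b ^ n * exp (b * x).
Proof.
intros Hb Hx. induction n as [|n IH] in x, Hx |- *.
- simpl. rewrite Rdiv_1_r, Rmult_1_l. rewrite <- exp_0. apply exp_le; nra.
- assert (Hk : exists k, k = INR (fact (S n)) / b ^ S n) by (eexists; reflexivity).
  destruct Hk as [k Hk]. rewrite <- Hk.
  assert (Hn : 0 < k).
  { rewrite Hk. apply Rdiv_lt_0_compat; [apply INR_fact_lt_0 | apply pow_lt; auto]. }
  assert (Hkb : k * b = INR (S n) * (INR (fact n) / b ^ n)).
  { rewrite Hk, fact_simpl, mult_INR. simpl pow. field. split; [apply pow_nonzero|]; lra. }
  set (h := fun x => k * exp (b * x) - x ^ S n).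
  destruct (MVT_gen h 0 x (fun x => INR (S n) * (INR (fact n) / b ^ n * exp (b * x) - x ^ n))) as [c [Hc E]].
  + intros y Hy. unfold h.
    replace (INR (S n) * (INR (fact n) / b ^ n * exp (b * y) - y ^ n))
      with (k * b * exp (b * y) - INR (S n) * y ^ n) by (rewrite Hkb; ring).
    auto_derive; auto. change (match n with 0%nat => 1 | S _ => INR n + 1 end) with (INR (S n)). ring.
  + intros y Hy. apply derivable_continuous_pt. unfold h. apply ex_derive_Reals_0. auto_derive; auto.
  + rewrite Rmin_left, Rmax_right in Hc by auto.
    assert (h 0 >= 0). { unfold h. rewrite Rmult_0_r, exp_0, pow_i by lia. lra. }
    assert (0 <= h x - h 0).
    { rewrite E. apply Rmult_le_pos; [|lra]. apply Rmult_le_pos; [apply pos_INR|].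
      specialize (IH c (proj1 Hc)). lra. }
    unfold h in *. lra.
Qed.

Lemma dec_pow f n : dec f -> dec (fun u => u ^ n * f u).
Proof.
intros [Hf [C [b [Hb H]]]]. split.
- apply (cont_mult (fun u => u ^ n)); auto. apply cont_derivable; intros; auto_derive; auto.
- assert (0 <= C) by exact (dec_const_nonneg _ _ _ H).
  exists (INR (fact n) / (b / 2) ^ n * C), (b / 2). split; [lra|]. intros u.
  rewrite Rabs_mult, <- RPow_abs.
  assert (A := pow_exp_bound n (Rabs u) (b / 2) ltac:(lra) (Rabs_pos u)).
  eapply Rle_trans; [apply Rmult_le_compat; [apply pow_le, Rabs_pos | apply Rabs_pos | apply A | apply H]|].
  right. replace (exp (- (b / 2) * Rabs u)) with (exp (b / 2 * Rabs u) * exp (- b * Rabs u)). { ring. }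
  rewrite <- exp_plus. f_equal. field.
Qed.

Lemma dec_tail f : dec f -> exists B b, 0 < b /\ 0 <= B /\ forall X x y, 0 <= X ->
  x <= - X -> X <= y -> Rabs (RInt f x y - RInt f (- X) X) <= B * exp (- b * X).
Proof.
intros [Hf [C [b [Hb H]]]].
assert (HC : 0 <= C) by exact (dec_const_nonneg _ _ _ H).
assert (HCb : 0 <= C / b) by (apply Rdiv_le_0_compat; lra).
exists (2 * (C / b)), b. split; auto. split; [lra|]. intros X x y HX Hx Hy.
rewrite <- (RInt_Chasles_R f x (- X) y), <- (RInt_Chasles_R f (- X) X y); auto.
assert (cm : forall k, cont (fun u => C * exp (k * u))).
{ intros k; apply cont_derivable; intros; auto_derive; auto. }
assert (A1 : Rabs (RInt f X y) <= C / b * exp (- b * X)).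
{ eapply Rle_trans; [apply (RInt_le_abs f (fun u => C * exp (- b * u))); auto|].
  - intros u Hu. specialize (H u). rewrite (Rabs_pos_eq u) in H by lra. auto.
  - rewrite (RInt_FTC (fun u => - (C / b) * exp (- b * u))); auto.
    + generalize (exp_pos (- b * y)); nra.
    + intros u. auto_derive; auto. field; lra. }
assert (A2 : Rabs (RInt f x (- X)) <= C / b * exp (- b * X)).
{ eapply Rle_trans; [apply (RInt_le_abs f (fun u => C * exp (b * u))); auto|].
  - intros u Hu. specialize (H u). rewrite (Rabs_left1 u) in H by lra.
    replace (b * u) with (- b * - u) by ring. auto.
  - rewrite (RInt_FTC (fun u => (C / b) * exp (b * u))); auto.
    + replace (b * - X) with (- b * X) by ring. generalize (exp_pos (b * x)); nra.
    + intros u. auto_derive; auto. field; lra. }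
replace (RInt f x (- X) + (RInt f (- X) X + RInt f X y) - RInt f (- X) X)
  with (RInt f x (- X) + RInt f X y) by ring.
eapply Rle_trans; [apply Rabs_triang|]. lra.
Qed.

Lemma exp_neg_lim b B eps : 0 < b -> 0 <= B -> 0 < eps -> exists X, 0 <= X /\ B * exp (- b * X) < eps.
Proof.
intros Hb HB He.
exists ((B + 1) / eps / b).
assert (0 < (B + 1) / eps) by (apply Rdiv_lt_0_compat; lra).
split; [apply Rdiv_le_0_compat; lra|].
replace (- b * ((B + 1) / eps / b)) with (- ((B + 1) / eps)) by (field; lra).
rewrite exp_Ropp.
assert (E := exp_ineq1_le ((B + 1) / eps)).
apply Rmult_lt_reg_r with (exp ((B + 1) / eps)); [apply exp_pos|].
rewrite Rmult_assoc, Rinv_l, Rmult_1_r by (apply Rgt_not_eq, exp_pos).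
apply Rlt_le_trans with (eps * ((B + 1) / eps)); [field_simplify; lra|].
apply Rmult_le_compat_l; lra.
Qed.

Lemma IR_correct f : dec f -> is_IR f (IR f).
Proof.
intros Hd. unfold IR. apply epsilon_spec.
destruct (dec_tail f Hd) as [B [b [Hb [HB H]]]].
set (u := fun n => RInt f (- INR n) (INR n)).
assert (Cu : ex_finite_lim_seq u).
{ apply ex_lim_seq_cauchy_corr. intros eps.
  destruct (exp_neg_lim b (2 * B) eps Hb ltac:(lra) (cond_pos eps)) as [X [HX HE]].
  destruct (nfloor_ex X HX) as [N [_ HN]].
  exists (S N). intros n m Hn Hm.
  assert (X <= INR n /\ X <= INR m).
  { rewrite <- S_INR in HN. split; eapply Rle_trans; try (apply Rlt_le, HN); apply le_INR; auto. }
  assert (E1 := H X (- INR n) (INR n) HX ltac:(lra) ltac:(lra)).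
  assert (E2 := H X (- INR m) (INR m) HX ltac:(lra) ltac:(lra)).
  unfold u. replace (RInt f (- INR n) (INR n) - RInt f (- INR m) (INR m)) with
   ((RInt f (- INR n) (INR n) - RInt f (- X) X) - (RInt f (- INR m) (INR m) - RInt f (- X) X)) by ring.
  eapply Rle_lt_trans; [apply Rabs_triang|]. rewrite Rabs_Ropp. lra. }
destruct Cu as [l Hl]. exists l. intros eps He.
destruct (exp_neg_lim b (2 * B) (eps / 2) Hb ltac:(lra) ltac:(lra)) as [X [HX HE]].
exists X. intros x y Hx Hy.
apply is_lim_seq_spec in Hl. destruct (Hl (mkposreal (eps / 2) ltac:(lra))) as [N HN]. simpl in HN.
destruct (nfloor_ex X HX) as [N2 [_ HN2]].
set (n := max N (S N2)).
assert (X <= INR n). { rewrite <- S_INR in HN2. apply Rlt_le. eapply Rlt_le_trans; [apply HN2|].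
  apply le_INR. unfold n; lia. }
assert (E1 := H X (- INR n) (INR n) HX ltac:(lra) ltac:(lra)).
assert (E2 := H X x y HX Hx Hy).
specialize (HN n ltac:(unfold n; lia)). fold (u n) in E1.
replace (RInt f x y - l) with ((RInt f x y - RInt f (- X) X) - (u n - RInt f (- X) X) + (u n - l)) by ring.
eapply Rle_lt_trans; [apply Rabs_triang|].
eapply Rle_lt_trans; [apply Rplus_le_compat_r, Rabs_triang|]. rewrite Rabs_Ropp. lra.
Qed.

Lemma is_IR_lim f (l : R) c d : is_IR f l ->
  is_lim_seq (fun n => RInt f (- INR n + c) (INR n + d)) l.
Proof.
intros H. apply is_lim_seq_spec. intros eps.
destruct (H eps (cond_pos eps)) as [X HX].
destruct (nfloor_ex (Rabs X + Rabs c + Rabs d)) as [N [_ HN]].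
{ generalize (Rabs_pos X), (Rabs_pos c), (Rabs_pos d); lra. }
exists (S N). intros n Hn. rewrite <- S_INR in HN. apply le_INR in Hn.
generalize (Rle_abs X), (Rle_abs c), (Rle_abs (- d)), (Rabs_pos c), (Rabs_pos d), (Rabs_Ropp d); intros.
apply HX; lra.
Qed.

Lemma is_IR_lim0 f (l : R) : is_IR f l -> is_lim_seq (fun n => RInt f (- INR n) (INR n)) l.
Proof.
intros H. apply is_IR_lim with (c := 0) (d := 0) in H.
eapply is_lim_seq_ext; [|apply H]. intros n; cbv beta. rewrite !Rplus_0_r. reflexivity.
Qed.

Lemma IR_eq f (l : R) : dec f -> is_lim_seq (fun n => RInt f (- INR n) (INR n)) l -> IR f = l.
Proof.
intros Hd Hl. assert (A := is_IR_lim0 _ _ (IR_correct f Hd)).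
apply is_lim_seq_unique in A. apply is_lim_seq_unique in Hl.
assert (E : Finite (IR f) = Finite l) by (rewrite <- A; exact Hl). injection E; auto.
Qed.

Lemma IR_lim f : dec f -> is_lim_seq (fun n => RInt f (- INR n) (INR n)) (IR f).
Proof. intros; apply is_IR_lim0, IR_correct; auto. Qed.

Lemma IR_ext f g : (forall u, f u = g u) -> IR f = IR g.
Proof. intros H. f_equal. apply functional_extensionality; auto. Qed.

Lemma IR_plus f g : dec f -> dec g -> IR (fun u => f u + g u) = IR f + IR g.
Proof.
intros Hf Hg. apply IR_eq; [apply dec_plus; auto|].
eapply is_lim_seq_ext; [|apply (is_lim_seq_plus' _ _ _ _ (IR_lim f Hf) (IR_lim g Hg))].
intros n; simpl. rewrite RInt_plus_R; auto using dec_cont.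
Qed.

Lemma IR_scal k f : dec f -> IR (fun u => k * f u) = k * IR f.
Proof.
intros Hf. apply IR_eq; [apply dec_scal; auto|].
eapply is_lim_seq_ext; [|apply (is_lim_seq_scal_l _ k _ (IR_lim f Hf))].
intros n; simpl. rewrite RInt_scal_R; auto using dec_cont.
Qed.

Lemma IR_minus f g : dec f -> dec g -> IR (fun u => f u - g u) = IR f - IR g.
Proof.
intros Hf Hg. rewrite (IR_ext _ (fun u => f u + -1 * g u)) by (intros; ring).
rewrite IR_plus, IR_scal; auto using dec_scal. ring.
Qed.

Lemma IR_le f g : dec f -> dec g -> (forall u, f u <= g u) -> IR f <= IR g.
Proof.
intros Hf Hg H.
change (Rbar_le (IR f) (IR g)).
refine (is_lim_seq_le _ _ _ _ _ (IR_lim f Hf) (IR_lim g Hg)). intros n.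
apply RInt_le; try apply cont_ex_RInt; auto using dec_cont.
generalize (pos_INR n); lra.
Qed.

Lemma IR_abs f g : dec f -> dec g -> (forall u, Rabs (f u) <= g u) -> Rabs (IR f) <= IR g.
Proof.
intros Hf Hg H. apply Rabs_le. split.
- assert (IR (fun u => -1 * g u) <= IR f).
  { apply IR_le; auto using dec_scal. intros u. specialize (H u). revert H. unfold Rabs; destruct (Rcase_abs (f u)); lra. }
  rewrite IR_scal in H0 by auto. lra.
- apply IR_le; auto. intros u; specialize (H u). generalize (Rle_abs (f u)); lra.
Qed.

Lemma IR_shift f c : dec f -> IR (fun u => f (u + c)) = IR f.
Proof.
intros Hf. apply IR_eq; [apply dec_shift; auto|].
eapply is_lim_seq_ext; [|apply (is_IR_lim f _ c c (IR_correct f Hf))].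
intros n; simpl. rewrite RInt_shift; auto using dec_cont.
Qed.

(** Every integration by parts over the line is this statement applied to a product with a cosine or
    a sine; no boundary term arises. *)
Lemma IR_FTC F f : (forall u, is_derive F u (f u)) -> dec F -> dec f -> IR f = 0.
Proof.
intros HF [_ [C [b [Hb H]]]] Hf. apply IR_eq; auto.
apply is_lim_seq_ext with (fun n => F (INR n) - F (- INR n)).
{ intros n. rewrite (RInt_FTC F); auto using dec_cont. }
assert (HC : 0 <= C) by exact (dec_const_nonneg _ _ _ H).
apply is_lim_seq_spec. intros eps.
destruct (exp_neg_lim b (2 * C) eps Hb ltac:(lra) (cond_pos eps)) as [X [HX HE]].
destruct (nfloor_ex X HX) as [N [_ HN]].
exists (S N). intros n Hn. rewrite <- S_INR in HN. apply le_INR in Hn.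
assert (H1 := H (INR n)). assert (H2 := H (- INR n)). rewrite Rabs_Ropp in H2.
rewrite (Rabs_pos_eq (INR n)) in H1, H2 by apply pos_INR.
assert (exp (- b * INR n) <= exp (- b * X)) by (apply exp_le; nra).
rewrite Rminus_0_r. eapply Rle_lt_trans; [apply Rabs_triang|]. rewrite Rabs_Ropp. nra.
Qed.

Lemma IR_odd f : dec f -> (forall u, f (- u) = - f u) -> IR f = 0.
Proof.
intros Hf H. assert (H' : forall u, f (- u) = -1 * f u) by (intros; rewrite H; ring).
apply IR_eq; auto.
apply is_lim_seq_ext with (fun _ => 0); [|apply is_lim_seq_const].
intros n. assert (E := RInt_comp_opp_R f (- INR n) (INR n) (dec_cont _ Hf)).
rewrite Ropp_involutive in E.
rewrite (RInt_ext (fun x => f (- x)) (fun x => -1 * f x)) in E by (intros; apply H').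
rewrite RInt_scal_R in E by auto using dec_cont. lra.
Qed.

Lemma IR_pos f : dec f -> (forall u, 0 < f u) -> 0 < IR f.
Proof.
intros Hf H.
assert (Hc := dec_cont _ Hf).
assert (P : 0 < RInt f (-1) 1).
{ apply RInt_gt_0; auto; lra. }
apply Rlt_le_trans with (RInt f (-1) 1); auto.
assert (A := is_lim_seq_le_loc (fun _ => RInt f (-1) 1) (fun n => RInt f (- INR n) (INR n)) (RInt f (-1) 1) (IR f)).
simpl in A. apply A; [|apply is_lim_seq_const|apply IR_lim; auto].
exists 1%nat. intros n Hn. apply le_INR in Hn. simpl in Hn.
rewrite <- (RInt_Chasles_R f (- INR n) (-1)), <- (RInt_Chasles_R f (-1) 1 (INR n)); auto.
assert (G : forall a b, a <= b -> 0 <= RInt f a b).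
{ intros a b Hab. apply RInt_ge_0; auto. apply cont_ex_RInt; auto. intros; left; auto. }
generalize (G (- INR n) (-1) ltac:(lra)), (G 1 (INR n) ltac:(lra)); lra.
Qed.

Lemma dec_cos f t : dec f -> dec (fun u => f u * cos (t * u)).
Proof.
intros Hf. apply dec_mulb with 1; auto.
- apply cont_derivable; intros; auto_derive; auto.
- intros u. apply Rabs_le. generalize (COS_bound (t * u)); lra.
Qed.

Lemma dec_sin f t : dec f -> dec (fun u => f u * sin (t * u)).
Proof.
intros Hf. apply dec_mulb with 1; auto.
- apply cont_derivable; intros; auto_derive; auto.
- intros u. apply Rabs_le. generalize (SIN_bound (t * u)); lra.
Qed.

Ltac dec_lin := repeat match goal with
  | |- dec (fun u => @?f u - @?g u) => apply (dec_minus f g)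
  | |- dec (fun u => @?f u + @?g u) => apply (dec_plus f g)
  | |- dec (fun u => ?k * @?f u) => apply (dec_scal k f)
  end; cbv beta; auto.

Lemma sin_lipschitz x y : Rabs (sin x - sin y) <= Rabs (x - y).
Proof.
destruct (MVT_gen sin y x cos) as [c [_ E]].
- intros z _. apply is_derive_Reals. apply derivable_pt_lim_sin.
- intros z _. apply continuity_sin.
- rewrite E, Rabs_mult. assert (Rabs (cos c) <= 1) by (apply Rabs_le; generalize (COS_bound c); lra).
  generalize (Rabs_pos (x - y)); nra.
Qed.

Lemma cos_lipschitz x y : Rabs (cos x - cos y) <= Rabs (x - y).
Proof.
rewrite !cos_sin. eapply Rle_trans; [apply sin_lipschitz|]. right; f_equal; ring.
Qed.

Lemma cos_taylor1 x d : Rabs (cos (x + d) - cos x + d * sin x) <= d ^ 2.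
Proof.
destruct (MVT_gen cos x (x + d) (fun y => - sin y)) as [c [Hc E]].
- intros z _. apply is_derive_Reals. apply derivable_pt_lim_cos.
- intros z _. apply continuity_cos.
- rewrite E. replace (- sin c * (x + d - x) + d * sin x) with (d * (sin x - sin c)) by ring.
  rewrite Rabs_mult, <- Rsqr_pow2, Rsqr_abs. unfold Rsqr.
  apply Rmult_le_compat_l; [apply Rabs_pos|].
  eapply Rle_trans; [apply sin_lipschitz|].
  revert Hc. unfold Rmin, Rmax, Rabs.
  destruct (Rle_dec x (x + d)); destruct (Rcase_abs (x - c)); destruct (Rcase_abs d); lra.
Qed.

(** A second-order Taylor bound valid for all h can be integrated against a kernel, so
    differentiation under the integral sign needs no dominated convergence. *)
Lemma is_derive_of_quadratic F t l K :
  (forall h, Rabs (F (t + h) - F t - h * l) <= K * h ^ 2) -> is_derive F t l.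
Proof.
intros H. apply is_derive_Reals. intros eps He.
assert (HK : 0 <= K). { specialize (H 1). generalize (Rabs_pos (F (t + 1) - F t - 1 * l)); lra. }
assert (Hd : 0 < eps / (K + 1)) by (apply Rdiv_lt_0_compat; lra).
exists (mkposreal _ Hd). simpl. intros h Hh Hlt.
replace ((F (t + h) - F t) / h - l) with ((F (t + h) - F t - h * l) / h) by (field; auto).
unfold Rdiv. rewrite Rabs_mult, Rabs_inv.
assert (0 < Rabs h) by (apply Rabs_pos_lt; auto).
apply Rle_lt_trans with (K * Rabs h).
- apply Rmult_le_reg_r with (Rabs h); auto. rewrite Rmult_assoc, Rinv_l, Rmult_1_r by lra.
  eapply Rle_trans; [apply H|]. rewrite <- Rsqr_pow2, Rsqr_abs. unfold Rsqr. lra.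
- apply Rle_lt_trans with ((K + 1) * Rabs h); [nra|].
  apply Rmult_lt_reg_r with (/ (K + 1)); [apply Rinv_0_lt_compat; lra|].
  replace ((K + 1) * Rabs h * / (K + 1)) with (Rabs h) by (field; lra). exact Hlt.
Qed.

(** * Cosine transforms *)

(** The phase p closes the family under differentiation: a derivative in t multiplies G by u and
    adds pi/2 to p. Cosine and sine transforms are p = 0 and p = - pi/2. *)
Definition FT (G : R -> R) (p t : R) : R := IR (fun u => G u * cos (t * u + p)).

Lemma dec_FT G p t : dec G -> dec (fun u => G u * cos (t * u + p)).
Proof.
intros Hf. apply dec_mulb with 1; auto.
- apply cont_derivable; intros; auto_derive; auto.
- intros u. apply Rabs_le. generalize (COS_bound (t * u + p)); lra.
Qed.

Lemma dec_id_mult G : dec G -> dec (fun u => u * G u).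
Proof.
intros H. assert (A := dec_pow G 1 H). replace (fun u => u * G u) with (fun u => u ^ 1 * G u); auto.
apply functional_extensionality; intros; ring.
Qed.

Lemma FT_derive G p t : dec G ->
  is_derive (FT G p) t (FT (fun u => u * G u) (p + PI / 2) t).
Proof.
intros HG. apply is_derive_of_quadratic with (IR (fun u => u ^ 2 * Rabs (G u))). intros h.
assert (H2 : dec (fun u => u ^ 2 * Rabs (G u))) by auto using dec_pow, dec_abs.
assert (D1 := fun t => dec_FT G p t HG).
assert (D2 := dec_FT (fun u => u * G u) (p + PI / 2) t (dec_id_mult G HG)). simpl in D2.
unfold FT. rewrite <- IR_minus, <- (IR_scal h), <- IR_minus; auto using dec_minus, dec_scal.
rewrite Rmult_comm, <- IR_scal by auto.
apply IR_abs.
- auto using dec_minus, dec_scal.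
- auto using dec_scal.
- intros u. assert (A := cos_taylor1 (t * u + p) (h * u)).
  replace (t * u + (p + PI / 2)) with (PI / 2 + (t * u + p)) by ring.
  rewrite (cos_sin (PI / 2 + _)). replace (PI / 2 + (PI / 2 + (t * u + p))) with (PI + (t * u + p)) by field.
  rewrite (Rplus_comm PI), neg_sin.
  replace ((t + h) * u + p) with (t * u + p + h * u) by ring.
  replace (G u * cos (t * u + p + h * u) - G u * cos (t * u + p) - h * (u * G u * - sin (t * u + p)))
   with (G u * (cos (t * u + p + h * u) - cos (t * u + p) + h * u * sin (t * u + p))) by ring.
  rewrite Rabs_mult. rewrite Rpow_mult_distr in A. generalize (Rabs_pos (G u)); nra.
Qed.

Lemma FT_bound G p t b C : dec G -> (forall u, Rabs (G u) <= C * exp (- b * Rabs u)) -> 0 < b ->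
  Rabs (FT G p t) <= IR (fun u => C * exp (- b * Rabs u)).
Proof.
intros HG H Hb. apply IR_abs; auto using dec_FT.
- split; [|exists (Rabs C), b; split; auto].
  + apply cont_scal. apply (cont_comp exp (fun u => - b * Rabs u)).
    * apply cont_derivable; intros; auto_derive; auto.
    * apply cont_scal. intros u; apply continuous_Rabs.
  + intros u. rewrite Rabs_mult, (Rabs_pos_eq (exp _)) by (left; apply exp_pos). lra.
- intros u. rewrite Rabs_mult. eapply Rle_trans; [|apply H].
  assert (Rabs (cos (t * u + p)) <= 1) by (apply Rabs_le; generalize (COS_bound (t * u + p)); lra).
  generalize (Rabs_pos (G u)); nra.
Qed.

Definition FTD (G : R -> R) (p : R) (n : nat) (t : R) : R :=
  FT (fun u => u ^ n * G u) (p + INR n * (PI / 2)) t.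

Lemma FTD_deriv_seq G p : dec G -> deriv_seq (FT G p) (FTD G p).
Proof.
intros HG. split.
- apply functional_extensionality; intros t. unfold FTD, FT. apply IR_ext; intros u.
  simpl. rewrite Rmult_0_l, Rplus_0_r, Rmult_1_l. reflexivity.
- intros n t. apply is_derive_Reals. unfold FTD.
  replace (FT (fun u => u ^ S n * G u) (p + INR (S n) * (PI / 2)) t)
    with (FT (fun u => u * (u ^ n * G u)) (p + INR n * (PI / 2) + PI / 2) t).
  apply FT_derive, dec_pow; auto.
  unfold FT. apply IR_ext; intros u. rewrite S_INR.
  replace (t * u + (p + (INR n + 1) * (PI / 2))) with (t * u + (p + INR n * (PI / 2) + PI / 2)) by ring.
  simpl. ring.
Qed.

(** Half of the decay rate b pays for u^n at the cost n! / (b/2)^n, the other half keeps the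
    integral finite. The bound does not depend on t, so one radius serves the whole line. *)
Lemma FTD_bound G p : dec G -> exists C r, 0 < r /\ forall n t, Rabs (FTD G p n t) <= C * INR (fact n) / r ^ n.
Proof.
intros HG. assert (HG' := HG). destruct HG' as [Hc [C [b [Hb H]]]].
assert (HC : 0 <= C) by exact (dec_const_nonneg _ _ _ H).
exists (IR (fun u => C * exp (- (b / 2) * Rabs u))), (b / 2). split; [lra|]. intros n t.
assert (Hd : dec (fun u => C * exp (- (b / 2) * Rabs u))).
{ split; [|exists (Rabs C), (b / 2); split; [lra|]].
  + apply cont_scal. apply (cont_comp exp (fun u => - (b / 2) * Rabs u)).
    * apply cont_derivable; intros; auto_derive; auto.
    * apply cont_scal. intros u; apply continuous_Rabs.
  + intros u. rewrite Rabs_mult, (Rabs_pos_eq (exp _)) by (left; apply exp_pos). lra. }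
unfold FTD.
eapply Rle_trans; [apply (FT_bound _ _ _ (b / 2) (INR (fact n) / (b / 2) ^ n * C)); auto using dec_pow; [|lra]|].
- intros u. rewrite Rabs_mult, <- RPow_abs.
  assert (A := pow_exp_bound n (Rabs u) (b / 2) ltac:(lra) (Rabs_pos u)).
  eapply Rle_trans; [apply Rmult_le_compat; [apply pow_le, Rabs_pos | apply Rabs_pos | apply A | apply H]|].
  right. replace (exp (- (b / 2) * Rabs u)) with (exp (b / 2 * Rabs u) * exp (- b * Rabs u)). { ring. }
  rewrite <- exp_plus. f_equal. field.
- right. rewrite (IR_ext _ (fun u => INR (fact n) / (b / 2) ^ n * (C * exp (- (b / 2) * Rabs u)))) by (intros; ring).
  rewrite IR_scal by auto. unfold Rdiv; ring.
Qed.

(** * Fejer kernel, Poisson summation and theta inversion *)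

Lemma sin_ge_chord x : 0 <= x <= PI / 2 -> 2 / PI * x <= sin x.
Proof.
intros Hx. assert (HP := PI_RGT_0).
destruct (Rle_dec (2 / PI * x) (sin x)) as [|H]; auto. exfalso. apply Rnot_le_lt in H.
destruct (Req_dec x 0) as [->|H0]. { rewrite sin_0 in H; lra. }
destruct (Req_dec x (PI / 2)) as [->|H1].
{ rewrite sin_PI2 in H. replace (2 / PI * (PI / 2)) with 1 in H by (field; lra). lra. }
assert (D : forall z, derivable_pt_lim sin z (cos z)) by apply derivable_pt_lim_sin.
destruct (MVT_gen sin 0 x cos) as [c1 [Hc1 E1]].
{ intros; apply is_derive_Reals, D. } { intros; apply continuity_sin. }
destruct (MVT_gen sin x (PI / 2) cos) as [c2 [Hc2 E2]].
{ intros; apply is_derive_Reals, D. } { intros; apply continuity_sin. }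
rewrite Rmin_left, Rmax_right in Hc1, Hc2 by lra.
rewrite sin_0 in E1. rewrite sin_PI2 in E2.
assert (cos c1 < 2 / PI). { apply Rmult_lt_reg_r with x; lra. }
assert (2 / PI < cos c2).
{ apply Rmult_lt_reg_r with (PI / 2 - x); [lra|]. rewrite <- E2.
  replace (2 / PI * (PI / 2 - x)) with (1 - 2 / PI * x) by (field; lra). lra. }
assert (cos c2 <= cos c1) by (apply cos_decr_1; lra). lra.
Qed.

Lemma sin_abs_ge x : - (PI / 2) <= x <= PI / 2 -> 2 / PI * Rabs x <= Rabs (sin x).
Proof.
intros Hx. destruct (Rle_dec 0 x) as [H|H].
- rewrite (Rabs_pos_eq x) by auto. eapply Rle_trans; [apply sin_ge_chord; lra|]. apply Rle_abs.
- rewrite (Rabs_left x) by lra. eapply Rle_trans; [apply sin_ge_chord; lra|].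
  rewrite sin_neg, <- Rabs_Ropp. apply Rle_abs.
Qed.

(** Meant for even g: the terms k and - k are merged, so this is a sum over |k| <= n. *)
Fixpoint esum (g : R -> R) (n : nat) : R :=
  match n with O => g 0 | S m => esum g m + 2 * g (INR (S m)) end.

Definition dirichlet (n : nat) (y : R) : R := esum (fun k => cos (2 * PI * k * y)) n.

Fixpoint fejer (K : nat) (y : R) : R :=
  match K with O => 0 | S n => fejer n y + dirichlet n y end.

Lemma dirichlet_S n y : dirichlet (S n) y = dirichlet n y + 2 * cos (2 * PI * INR (S n) * y).
Proof. reflexivity. Qed.

Lemma dirichlet_sin n y : sin (PI * y) * dirichlet n y = sin ((2 * INR n + 1) * (PI * y)).
Proof.
induction n.
- unfold dirichlet; simpl. rewrite Rmult_0_r, Rmult_0_l, cos_0. rewrite Rmult_1_r. f_equal; ring.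
- rewrite dirichlet_S, Rmult_plus_distr_l, IHn, S_INR.
  replace (2 * PI * (INR n + 1) * y) with ((2 * INR n + 2) * (PI * y)) by ring.
  replace ((2 * INR n + 1) * (PI * y)) with ((2 * INR n + 2) * (PI * y) - PI * y) by ring.
  replace ((2 * (INR n + 1) + 1) * (PI * y)) with ((2 * INR n + 2) * (PI * y) + PI * y) by ring.
  rewrite sin_minus, sin_plus. ring.
Qed.

(** Telescoping, through sin^2((K + 1) x) - sin^2(K x) = sin((2 K + 1) x) sin x at x = pi y. *)
Lemma fejer_sin K y : sin (PI * y) ^ 2 * fejer K y = sin (INR K * (PI * y)) ^ 2.
Proof.
induction K.
- simpl. rewrite Rmult_0_l, sin_0. ring.
- simpl fejer. rewrite Rmult_plus_distr_l, IHK, S_INR.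
  replace (sin (PI * y) ^ 2 * dirichlet K y) with (sin (PI * y) * (sin (PI * y) * dirichlet K y)) by ring.
  rewrite dirichlet_sin.
  replace ((2 * INR K + 1) * (PI * y)) with (INR K * (PI * y) + (INR K + 1) * (PI * y)) by ring.
  replace (PI * y) with ((INR K + 1) * (PI * y) - INR K * (PI * y)) at 2 by ring.
  rewrite sin_minus, sin_plus.
  set (a := INR K * (PI * y)); set (b := (INR K + 1) * (PI * y)).
  assert (Ha := sin2_cos2 a). assert (Hb := sin2_cos2 b). unfold Rsqr in *.
  replace ((sin b * cos a - cos b * sin a) * (sin a * cos b + cos a * sin b))
    with (sin b * sin b * (cos a * cos a) - sin a * sin a * (cos b * cos b)) by ring.
  replace (cos a * cos a) with (1 - sin a * sin a) by lra.
  replace (cos b * cos b) with (1 - sin b * sin b) by lra. ring.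
Qed.

Lemma dirichlet_0 n : 1 <= dirichlet n 0.
Proof.
induction n; [unfold dirichlet; simpl; rewrite Rmult_0_r, cos_0; lra|].
rewrite dirichlet_S, Rmult_0_r, cos_0; lra.
Qed.

Lemma fejer_bounds K y : -1/2 <= y <= 1/2 -> 0 <= fejer K y /\ 4 * y ^ 2 * fejer K y <= 1.
Proof.
intros Hy. assert (HP := PI_RGT_0).
destruct (Req_dec y 0) as [->|H0].
- split; [|simpl; lra]. induction K; simpl; [lra|]. generalize (dirichlet_0 K); lra.
- assert (Hs : 2 * Rabs y <= Rabs (sin (PI * y))).
  { assert (A := sin_abs_ge (PI * y) ltac:(nra)). rewrite Rabs_mult, (Rabs_pos_eq PI) in A by lra.
    replace (2 / PI * (PI * Rabs y)) with (2 * Rabs y) in A by (field; lra). auto. }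
  assert (Hs2 : 4 * y ^ 2 <= sin (PI * y) ^ 2).
  { rewrite <- (pow2_abs y), <- (pow2_abs (sin (PI * y))). generalize (Rabs_pos y); nra. }
  assert (0 < y ^ 2) by (apply pow2_gt_0; auto).
  assert (E := fejer_sin K y). assert (B := SIN_bound (INR K * (PI * y))).
  set (s := sin (INR K * (PI * y))) in *. assert (0 <= s ^ 2 <= 1) by nra.
  assert (0 <= fejer K y). { apply Rmult_le_reg_l with (sin (PI * y) ^ 2); nra. }
  split; nra.
Qed.

Lemma dirichlet_periodic n y m : dirichlet n (y + INR m) = dirichlet n y.
Proof.
induction n; [unfold dirichlet; simpl; rewrite !Rmult_0_r, !Rmult_0_l; reflexivity|].
rewrite !dirichlet_S, IHn. do 2 f_equal.
replace (2 * PI * INR (S n) * (y + INR m)) with (2 * PI * INR (S n) * y + 2 * INR (S n * m) * PI)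
  by (rewrite mult_INR; ring).
apply cos_period.
Qed.

Lemma fejer_periodic K y m : fejer K (y + INR m) = fejer K y.
Proof. induction K; simpl; auto. rewrite IHK, dirichlet_periodic; auto. Qed.

Lemma fejer_periodic_opp K y m : fejer K (y + - INR m) = fejer K y.
Proof. rewrite <- (fejer_periodic K _ m). f_equal; ring. Qed.

Lemma dirichlet_cont n : cont (dirichlet n).
Proof.
induction n.
- apply cont_derivable; intros; unfold dirichlet; simpl; auto_derive; auto.
- apply (cont_plus (dirichlet n)); auto. apply cont_derivable; intros; auto_derive; auto.
Qed.

Lemma fejer_cont K : cont (fejer K).
Proof.
induction K; simpl; [apply cont_const | apply (cont_plus (fejer K)); auto using dirichlet_cont].
Qed.

Lemma RInt_fejer K : RInt (fejer K) (-1/2) (1/2) = INR K.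
Proof.
assert (HP := PI_RGT_0).
assert (Hd : forall n, RInt (dirichlet n) (-1/2) (1/2) = 1).
{ induction n.
  - unfold dirichlet; simpl. rewrite (RInt_FTC (fun y => y)).
    + field.
    + intros x. rewrite Rmult_0_r, Rmult_0_l, cos_0. auto_derive; auto.
    + apply cont_derivable; intros; auto_derive; auto.
  - change (dirichlet (S n)) with (fun y => dirichlet n y + 2 * cos (2 * PI * INR (S n) * y)).
    assert (HN : INR (S n) <> 0) by (apply not_0_INR; lia).
    assert (E : sin (INR (S n) * PI) = 0).
    { apply sin_eq_0_1. exists (Z.of_nat (S n)). rewrite <- INR_IZR_INZ. reflexivity. }
    revert HN E. generalize (INR (S n)). intros N HN E.
    assert (C : cont (fun y => 2 * cos (2 * PI * N * y))) by (apply cont_derivable; intros; auto_derive; auto).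
    rewrite (RInt_plus_R (dirichlet n)), IHn by auto using dirichlet_cont.
    rewrite (RInt_FTC (fun y => sin (2 * PI * N * y) / (PI * N))); auto.
    + replace (2 * PI * N * (1 / 2)) with (0 + N * PI) by field.
      replace (2 * PI * N * (-1 / 2)) with (- (N * PI)) by field.
      rewrite sin_neg, Rplus_0_l, E. toR. field. split; lra.
    + intros x. auto_derive; auto. field. split; lra. }
induction K.
- simpl. rewrite RInt_const_R. apply Rmult_0_r.
- rewrite S_INR, <- IHK. simpl. rewrite (RInt_plus_R (fejer K) (dirichlet K)), Hd; auto using fejer_cont, dirichlet_cont.
Qed.

(** Over one period the kernel has mass K. Where |y| <= d the Lipschitz error is at most L d times
    the kernel; elsewhere |y| times the kernel is at most 1 / (4 |y|) <= 1 / (4 d). The free d is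
    made small only after K has gone to infinity. *)
Lemma fejer_local g K s L d : cont g -> (forall y, fejer K (y + s) = fejer K y) -> 0 < d -> 0 <= L ->
  (forall y, -1/2 <= y <= 1/2 -> Rabs (g (y + s) - g s) <= L * Rabs y) ->
  Rabs (RInt (fun y => g y * fejer K y) (-1/2 + s) (1/2 + s) - INR K * g s) <= L * (INR K * d + / (4 * d)).
Proof.
intros Hg Hp Hd HL H.
assert (Hf := fejer_cont K).
assert (Hsh : cont (fun y => g (y + s))).
{ apply (cont_comp g (fun y => y + s)); auto. apply cont_derivable; intros; auto_derive; auto. }
rewrite <- RInt_shift by (apply cont_mult; auto).
rewrite (RInt_ext _ (fun y => g (y + s) * fejer K y)) by (intros; rewrite Hp; reflexivity).
replace (INR K * g s) with (g s * RInt (fejer K) (-1/2) (1/2)) by (rewrite RInt_fejer; ring).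
rewrite <- RInt_scal_R by auto.
replace (RInt (fun y => g (y + s) * fejer K y) (-1 / 2) (1 / 2) - RInt (fun y => g s * fejer K y) (-1 / 2) (1 / 2))
 with (RInt (fun y => g (y + s) * fejer K y) (-1 / 2) (1 / 2) + -1 * RInt (fun y => g s * fejer K y) (-1 / 2) (1 / 2)) by ring.
assert (C1 : cont (fun y => g s * fejer K y)) by (apply cont_scal; auto).
assert (C2 : cont (fun y => g (y + s) * fejer K y)) by (apply (cont_mult (fun y => g (y + s))); auto).
rewrite <- RInt_scal_R, <- RInt_plus_R by auto using cont_scal.
assert (C3 : cont (fun _ : R => L * / (4 * d))) by apply cont_const.
eapply Rle_trans; [apply (RInt_le_abs _ (fun y => L * d * fejer K y + L * / (4 * d))); try lra|].
- apply cont_plus; auto using cont_scal.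
- apply cont_plus; auto using cont_scal.
- intros y Hy. destruct (fejer_bounds K y Hy) as [F1 F2].
  replace (g (y + s) * fejer K y + -1 * (g s * fejer K y)) with ((g (y + s) - g s) * fejer K y) by ring.
  rewrite Rabs_mult, (Rabs_pos_eq (fejer K y)) by auto.
  apply Rle_trans with (L * (Rabs y * fejer K y)).
  { rewrite <- Rmult_assoc. apply Rmult_le_compat_r; auto. }
  rewrite Rmult_assoc, <- Rmult_plus_distr_l. apply Rmult_le_compat_l; auto.
  assert (Hi : 0 < / (4 * d)) by (apply Rinv_0_lt_compat; lra).
  destruct (Rle_dec (Rabs y) d) as [Hyd|Hyd].
  + assert (Rabs y * fejer K y <= d * fejer K y) by (apply Rmult_le_compat_r; auto). lra.
  + apply Rnot_le_lt in Hyd.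
    assert (Rabs y * fejer K y <= / (4 * d)); [|nra].
    apply Rmult_le_reg_r with (4 * d); [lra|]. rewrite Rinv_l by lra.
    rewrite <- (pow2_abs y) in F2. assert (0 <= Rabs y * fejer K y) by (apply Rmult_le_pos; auto using Rabs_pos). nra.
- rewrite RInt_plus_R, RInt_scal_R, RInt_fejer by auto using cont_scal.
  rewrite RInt_const_R. right; field; lra.
Qed.

(** Adds the local estimates over the cells around the integers from - M to M; the factors (1/2)^n
    keep the total error bounded in M. *)
Lemma fejer_sum g K D d M : cont g -> 0 < d -> 0 <= D -> (forall y, g (- y) = g y) ->
  (forall n y, -1/2 <= y <= 1/2 -> Rabs (g (y + INR n) - g (INR n)) <= D * (1/2) ^ n * Rabs y) ->
  Rabs (RInt (fun y => g y * fejer K y) (- INR M + -1/2) (INR M + 1/2) - INR K * esum g M)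
    <= D * (3 - 2 * (1/2) ^ M) * (INR K * d + / (4 * d)).
Proof.
intros Hg Hd HD Hev H.
assert (cg : cont (fun y => g y * fejer K y)) by (apply cont_mult; auto using fejer_cont).
assert (Hev' : forall n y, -1/2 <= y <= 1/2 -> Rabs (g (y + - INR n) - g (- INR n)) <= D * (1/2) ^ n * Rabs y).
{ intros n y Hy. rewrite <- (Hev (y + - INR n)), (Hev (INR n)). replace (- (y + - INR n)) with (- y + INR n) by ring.
  rewrite <- (Rabs_Ropp y). apply H; lra. }
assert (HE : 0 < INR K * d + / (4 * d)).
{ apply Rplus_le_lt_0_compat; [apply Rmult_le_pos; [apply pos_INR|lra] | apply Rinv_0_lt_compat; lra]. }
induction M.
- simpl esum. simpl pow.
  assert (A := fejer_local g K 0 (D * (1 / 2) ^ 0) d Hg ltac:(intros; f_equal; ring) Hd ltac:(simpl; lra)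
    ltac:(intros; apply (H 0%nat); auto)).
  simpl INR. replace (- 0 + -1 / 2) with (-1 / 2 + 0) by ring. rewrite (Rplus_comm 0).
  simpl in A. eapply Rle_trans; [apply A|]. right; ring.
- assert (HM : 0 <= (1 / 2) ^ S M) by (apply pow_le; lra).
  assert (HL : 0 <= D * (1 / 2) ^ S M) by nra.
  assert (A1 := fejer_local g K (INR (S M)) _ d Hg (fun y => fejer_periodic K y (S M)) Hd HL (H (S M))).
  assert (A2 := fejer_local g K (- INR (S M)) _ d Hg (fun y => fejer_periodic_opp K y (S M)) Hd HL (Hev' (S M))).
  rewrite Hev in A2. change (esum g (S M)) with (esum g M + 2 * g (INR (S M))).
  rewrite S_INR in *.
  replace (-1 / 2 + (INR M + 1)) with (INR M + 1 / 2) in A1 by field.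
  replace (1 / 2 + - (INR M + 1)) with (- INR M + -1 / 2) in A2 by field.
  rewrite (Rplus_comm (1 / 2)) in A1. rewrite (Rplus_comm (-1 / 2)) in A2.
  rewrite <- (RInt_Chasles_R _ _ (- INR M + -1 / 2)), <- (RInt_Chasles_R _ (- INR M + -1 / 2) (INR M + 1 / 2) (INR M + 1 + 1
    / 2)) by auto.
  set (r1 := RInt _ (- (INR M + 1) + -1 / 2) _) in *. set (r2 := RInt _ (- INR M + -1 / 2) _) in *.
  set (r3 := RInt _ (INR M + 1 / 2) _) in *.
  assert (T : forall r1 r2 r3 k1 k2 e1 e2 e : R, Rabs (r1 - k1) <= e1 -> Rabs (r2 - k2) <= e2 ->
     Rabs (r3 - k1) <= e1 -> e2 + 2 * e1 = e -> Rabs (r1 + (r2 + r3) - (k2 + 2 * k1)) <= e).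
  { intros. replace (r0 + (r4 + r5) - (k2 + 2 * k1)) with ((r0 - k1) + ((r4 - k2) + (r5 - k1))) by ring.
    eapply Rle_trans; [apply Rabs_triang|].
    eapply Rle_trans; [apply Rplus_le_compat_l, Rabs_triang|]. lra. }
  replace (INR K * (esum g M + 2 * g (INR M + 1))) with (INR K * esum g M + 2 * (INR K * g (INR M + 1))) by ring.
  apply (T r1 r2 r3 _ _ _ _ _ A2 IHM A1). simpl. field. lra.
Qed.

(** Domination by the decrements of a null sequence b makes u Cauchy, with b n as an explicit
    remainder. The theta series, Gauss' product and the approximations to [phi] and to zeta are all
    handled this way. *)
Lemma lim_seq_telescoping (u b : nat -> R) n0 :
  (forall n, (n0 <= n)%nat -> Rabs (u (S n) - u n) <= b n - b (S n)) -> is_lim_seq b 0 ->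
  exists l : R, is_lim_seq u l /\ forall n, (n0 <= n)%nat -> Rabs (u n - l) <= b n.
Proof.
intros H Hb.
assert (H1 : forall n k, (n0 <= n)%nat -> Rabs (u (n + k)%nat - u n) <= b n - b (n + k)%nat).
{ intros n k Hn. induction k.
  - rewrite Nat.add_0_r, !Rminus_diag, Rabs_R0; lra.
  - replace (n + S k)%nat with (S (n + k)) by lia. specialize (H (n + k)%nat ltac:(lia)).
    replace (u (S (n + k)) - u n) with ((u (S (n + k)) - u (n + k)%nat) + (u (n + k)%nat - u n)) by ring.
    eapply Rle_trans; [apply Rabs_triang|]. lra. }
assert (Hc : ex_finite_lim_seq u).
{ apply ex_lim_seq_cauchy_corr. intros eps.
  apply is_lim_seq_spec in Hb. destruct (Hb (mkposreal (eps / 2) ltac:(generalize (cond_pos eps); lra))) as [N HN].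
  simpl in HN.
  assert (G : forall n m, (max n0 N <= n <= m)%nat -> Rabs (u m - u n) < eps).
  { intros n m Hnm. replace m with (n + (m - n))%nat by lia.
    eapply Rle_lt_trans; [apply H1; lia|].
    assert (A := HN n ltac:(lia)). assert (B := HN (n + (m - n))%nat ltac:(lia)).
    rewrite Rminus_0_r in A, B. apply Rabs_def2 in A, B. lra. }
  exists (max n0 N). intros n m Hn Hm. destruct (Nat.le_ge_cases n m).
  - rewrite Rabs_minus_sym. apply G; lia.
  - apply G; lia. }
destruct Hc as [l Hl]. exists l. split; auto. intros n Hn.
assert (L1 : is_lim_seq (fun k => Rabs (u (k + n)%nat - u n)) (Rabs (l - u n))).
{ apply (is_lim_seq_abs (fun k => u (k + n)%nat - u n) (l - u n)).
  apply is_lim_seq_minus'; [apply is_lim_seq_incr_n; auto | apply is_lim_seq_const]. }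
assert (L2 : is_lim_seq (fun k => b n - b (k + n)%nat) (b n - 0)).
{ apply is_lim_seq_minus'; [apply is_lim_seq_const | apply is_lim_seq_incr_n; auto]. }
rewrite Rminus_0_r in L2. rewrite Rabs_minus_sym.
change (Rbar_le (Rabs (l - u n)) (b n)). refine (is_lim_seq_le _ _ _ _ _ L1 L2).
intros k. rewrite Nat.add_comm. apply H1; auto.
Qed.

Section Poisson.

Variable g : R -> R.
Hypothesis Hg : dec g.

Let gh (k : R) := FT g 0 (2 * PI * k).

Lemma IR_dirichlet n : dec (fun y => g y * dirichlet n y) /\ IR (fun y => g y * dirichlet n y) = esum gh n.
Proof.
induction n.
- assert (E : forall u, g u * dirichlet 0 u = g u * cos (2 * PI * 0 * u + 0)).
  { intros u. unfold dirichlet; simpl. rewrite !Rmult_0_r, !Rmult_0_l, Rplus_0_r. reflexivity. }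
  split.
  + replace (fun y => g y * dirichlet 0 y) with (fun u => g u * cos (2 * PI * 0 * u + 0)).
    apply dec_FT; auto. apply functional_extensionality; intros; symmetry; apply E.
  + apply IR_ext, E.
- destruct IHn as [D E].
  assert (E2 : forall u, g u * dirichlet (S n) u = g u * dirichlet n u + 2 * (g u * cos (2 * PI * INR (S n) * u + 0))).
  { intros u. rewrite dirichlet_S, Rplus_0_r. ring. }
  assert (D2 := dec_FT g 0 (2 * PI * INR (S n)) Hg).
  rewrite (IR_ext _ _ E2), IR_plus, IR_scal, E by auto using dec_scal. split; [|reflexivity].
  rewrite (functional_extensionality _ _ E2). apply dec_plus; auto using dec_scal.
Qed.

Lemma IR_fejer n : dec (fun y => g y * fejer (S n) y) /\
  IR (fun y => g y * fejer (S n) y) = sum_f_R0 (esum gh) n.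
Proof.
induction n.
- assert (E : forall u, g u * fejer 1 u = g u * dirichlet 0 u) by (intros; simpl; ring).
  rewrite (IR_ext _ _ E), (functional_extensionality _ _ E). apply IR_dirichlet.
- destruct IHn as [D E]. destruct (IR_dirichlet (S n)) as [D2 EE2].
  assert (E2 : forall u, g u * fejer (S (S n)) u = g u * fejer (S n) u + g u * dirichlet (S n) u).
  { intros u. change (fejer (S (S n)) u) with (fejer (S n) u + dirichlet (S n) u). ring. }
  rewrite (IR_ext _ _ E2), IR_plus, E, EE2 by auto. split; [|reflexivity].
  rewrite (functional_extensionality _ _ E2). apply dec_plus; auto.
Qed.

(** The integral of g against the Fejer kernel is computed twice. Expanded in cosines it is a sum of
    K partial sums of the transforms, so divided by K it is a Cesaro mean and tends to th'.
    Evaluated cell by cell it is K th up to 3 D (K d + 1 / (4 d)). No pointwise convergence of a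
    Fourier series enters. *)
Lemma poisson_summation D (th th' : R) : 0 <= D -> (forall y, g (- y) = g y) ->
  (forall n y, -1/2 <= y <= 1/2 -> Rabs (g (y + INR n) - g (INR n)) <= D * (1/2) ^ n * Rabs y) ->
  is_lim_seq (esum g) th -> is_lim_seq (esum gh) th' -> th = th'.
Proof.
intros HD Hev H Hth Hth'.
assert (B1 : forall n d, 0 < d -> Rabs (sum_f_R0 (esum gh) n - INR (S n) * th) <= 3 * D * (INR (S n) * d + / (4 * d))).
{ intros n d Hd. destruct (IR_fejer n) as [Df <-].
  assert (L := is_IR_lim _ _ (-1/2) (1/2) (IR_correct _ Df)).
  assert (L2 := is_lim_seq_scal_l _ (INR (S n)) _ Hth).
  assert (L3 := is_lim_seq_abs _ _ (is_lim_seq_minus' _ _ _ _ L L2)).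
  change (Rbar_le (Rabs (IR (fun y : R => g y * fejer (S n) y) - INR (S n) * th)) (3 * D * (INR (S n) * d + / (4 * d)))).
  refine (is_lim_seq_le _ _ _ _ _ L3 (is_lim_seq_const _)). intros M.
  eapply Rle_trans; [apply fejer_sum with (d := d); eauto using dec_cont|].
  assert (0 < (1/2) ^ M) by (apply pow_lt; lra).
  assert (HE : 0 < INR (S n) * d + / (4 * d)).
  { apply Rplus_le_lt_0_compat; [apply Rmult_le_pos; [apply pos_INR|lra] | apply Rinv_0_lt_compat; lra]. }
  apply Rmult_le_compat_r; [lra|]. nra. }
assert (C := Cesaro_1 _ _ (proj1 (is_lim_seq_Reals _ _) Hth')). apply is_lim_seq_Reals in C.
apply is_lim_seq_incr_1 in C. simpl Nat.pred in C.
(* Letting n go to infinity at fixed d removes the term 1 / (4 d); afterwards d is arbitrary. *)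
assert (B2 : forall d, 0 < d -> Rabs (th' - th) <= 3 * D * d).
{ intros d Hd.
  assert (L3 := is_lim_seq_abs _ _ (is_lim_seq_minus' _ _ _ _ C (is_lim_seq_const th))).
  change (Rbar_le (Rabs (th' - th)) (3 * D * d)).
  assert (L4 : is_lim_seq (fun n => 3 * D * (d + / (4 * d) * / INR (S n))) (3 * D * (d + / (4 * d) * 0))).
  { apply (is_lim_seq_scal_l (fun n => d + / (4 * d) * / INR (S n)) (3 * D) (d + / (4 * d) * 0)).
    apply is_lim_seq_plus'; [apply is_lim_seq_const|].
    apply (is_lim_seq_scal_l (fun n => / INR (S n)) (/ (4 * d)) 0).
    apply (is_lim_seq_incr_1 (fun n => / INR n)).
    apply (is_lim_seq_inv INR p_infty). apply is_lim_seq_INR. discriminate. }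
  rewrite Rmult_0_r, Rplus_0_r in L4.
  refine (is_lim_seq_le _ _ _ _ _ L3 L4). intros n.
  assert (HS : 0 < INR (S n)) by (apply lt_0_INR; lia).
  replace (sum_f_R0 (esum gh) n / INR (S n) - th) with ((sum_f_R0 (esum gh) n - INR (S n) * th) / INR (S n)) by (field; lra).
  unfold Rdiv. rewrite Rabs_mult, (Rabs_pos_eq (/ INR (S n))) by (left; apply Rinv_0_lt_compat; auto).
  apply Rmult_le_reg_r with (INR (S n)); auto. rewrite Rmult_assoc, Rinv_l, Rmult_1_r by lra.
  eapply Rle_trans; [apply (B1 n d Hd)|]. right; field. lra. }
assert (Rabs (th' - th) <= 0).
{ apply le_epsilon. intros e He. rewrite Rplus_0_l.
  eapply Rle_trans; [apply (B2 (e / (3 * D + 1)))|].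
  - apply Rdiv_lt_0_compat; lra.
  - apply Rmult_le_reg_r with (3 * D + 1); [lra|].
    replace (3 * D * (e / (3 * D + 1)) * (3 * D + 1)) with (3 * D * e) by (field; lra). nra. }
assert (A := Rabs_pos (th' - th)). assert (E : Rabs (th' - th) = 0) by lra.
destruct (Req_dec (th' - th) 0) as [Z|Z]; [lra|]. apply Rabs_no_R0 in Z. lra.
Qed.

End Poisson.

(** * Gaussians, their transforms, and theta inversion *)

Definition gs (a u : R) : R := exp (- (PI * a ^ 2 * u ^ 2)).

Lemma gs_bound a : 0 < a -> exists K, 0 < K /\ forall u, gs a u <= K * exp (- 2 * Rabs u).
Proof.
intros Ha. assert (HP := PI_RGT_0). assert (0 < PI * a ^ 2) by (apply Rmult_lt_0_compat; [lra|apply pow_lt; auto]).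
exists (exp (/ (PI * a ^ 2))). split; [apply exp_pos|]. intros u.
unfold gs. rewrite <- exp_plus. apply exp_le. rewrite <- (pow2_abs u).
set (c := PI * a ^ 2) in *. set (v := Rabs u).
assert (E : - (c * v ^ 2) = / c + - 2 * v - c * (v - / c) ^ 2) by (field; lra).
rewrite E. assert (0 <= (v - / c) ^ 2) by apply pow2_ge_0. nra.
Qed.

Lemma gs_dec a : 0 < a -> dec (gs a).
Proof.
intros Ha. split.
- apply cont_derivable; intros; unfold gs; auto_derive; auto.
- destruct (gs_bound a Ha) as [K [HK H]]. exists K, 2; split; [lra|]. intros u.
  rewrite Rabs_pos_eq by (left; apply exp_pos). apply H.
Qed.

Lemma gs_derive a u : is_derive (gs a) u (- (2 * PI * a ^ 2) * (u * gs a u)).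
Proof. unfold gs. auto_derive; auto. simpl. ring. Qed.

Lemma exp_m1_le : exp (-1) <= 1 / 2.
Proof.
replace (-1) with (- (1)) by ring. rewrite exp_Ropp.
assert (A := exp_ineq1 1 ltac:(lra)). apply Rmult_le_reg_r with (exp 1); [apply exp_pos|].
rewrite Rinv_l by (apply Rgt_not_eq, exp_pos). lra.
Qed.

Lemma exp_INR_le n : exp (- INR n) <= (1 / 2) ^ n.
Proof.
induction n; [simpl; rewrite Ropp_0, exp_0; lra|].
rewrite S_INR. replace (- (INR n + 1)) with (-1 + - INR n) by ring. rewrite exp_plus. simpl.
apply Rmult_le_compat; auto using exp_m1_le; left; apply exp_pos.
Qed.

(** The derivative of the Gaussian is O(e^(- |u|)), which on the cell around n is traded for
    (1/2)^n, the form that [poisson_summation] can sum. *)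
Lemma gs_lipschitz a : 0 < a -> exists D, 0 <= D /\
  forall n y, -1/2 <= y <= 1/2 -> Rabs (gs a (y + INR n) - gs a (INR n)) <= D * (1/2) ^ n * Rabs y.
Proof.
intros Ha. destruct (gs_bound a Ha) as [K [HK H]]. assert (HP := PI_RGT_0).
set (k := 2 * PI * a ^ 2). assert (Hk : 0 < k) by (unfold k; assert (0 < a ^ 2) by (apply pow_lt; auto); nra).
assert (0 < k * K * exp (1 / 2)) by (apply Rmult_lt_0_compat; [apply Rmult_lt_0_compat; auto | apply exp_pos]).
exists (k * K * exp (1/2)). split; [lra|].
intros n y Hy.
destruct (MVT_gen (gs a) (INR n) (y + INR n) (fun u => - k * (u * gs a u))) as [c [Hc E]].
- intros u _. apply gs_derive.
- intros u _. apply derivable_continuous_pt, ex_derive_Reals_0. eexists; apply gs_derive.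
- rewrite E, Rabs_mult. replace (y + INR n - INR n) with y by ring.
  apply Rmult_le_compat_r; [apply Rabs_pos|].
  rewrite Rabs_mult, Rabs_Ropp, (Rabs_pos_eq k), Rabs_mult, (Rabs_pos_eq (gs a c)) by (try (left; apply exp_pos); lra).
  assert (B1 : Rabs c * gs a c <= K * exp (- Rabs c)).
  { apply Rle_trans with (exp (Rabs c) * (K * exp (- 2 * Rabs c))).
    - apply Rmult_le_compat; auto using Rabs_pos; [left; apply exp_pos|].
      generalize (exp_ineq1_le (Rabs c)); lra.
    - right. replace (- Rabs c) with (Rabs c + - 2 * Rabs c) by ring. rewrite exp_plus. ring. }
  assert (B2 : exp (- Rabs c) <= exp (1 / 2) * (1 / 2) ^ n).
  { apply Rle_trans with (exp (1 / 2) * exp (- INR n)).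
    - rewrite <- exp_plus. apply exp_le.
      assert (Rabs (INR n - c) <= 1 / 2).
      { apply Rabs_le. revert Hc. unfold Rmin, Rmax. destruct (Rle_dec (INR n) (y + INR n)); lra. }
      generalize (Rle_abs (INR n - c)), (Rle_abs c); lra.
    - apply Rmult_le_compat_l; [left; apply exp_pos | apply exp_INR_le]. }
  assert (Rabs c * gs a c <= K * (exp (1 / 2) * (1 / 2) ^ n)).
  { eapply Rle_trans; [apply B1|]. apply Rmult_le_compat_l; lra. }
  replace (k * K * exp (1 / 2) * (1 / 2) ^ n) with (k * (K * (exp (1 / 2) * (1 / 2) ^ n))) by ring.
  apply Rmult_le_compat_l; lra.
Qed.

Definition theta (a : R) : R := real (Lim_seq (esum (gs a))).

Lemma theta_lim a : 0 < a -> is_lim_seq (esum (gs a)) (theta a).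
Proof.
intros Ha. destruct (gs_bound a Ha) as [K [HK H]].
destruct (lim_seq_telescoping (esum (gs a)) (fun n => 2 * K * (1 / 2) ^ n) 0) as [l [Hl _]].
- intros n _. change (esum (gs a) (S n)) with (esum (gs a) n + 2 * gs a (INR (S n))). replace (esum (gs a) n + 2 * gs a (INR
    (S n)) - esum (gs a) n) with (2 * gs a (INR (S n))) by ring.
  rewrite Rabs_pos_eq by (left; apply Rmult_lt_0_compat; [lra | apply exp_pos]).
  specialize (H (INR (S n))). rewrite Rabs_pos_eq in H by apply pos_INR.
  assert (A : exp (- 2 * INR (S n)) <= (1 / 2) ^ S n).
  { eapply Rle_trans; [|apply exp_INR_le]. apply exp_le. generalize (pos_INR (S n)); lra. }
  assert (K * exp (- 2 * INR (S n)) <= K * (1 / 2) ^ S n) by (apply Rmult_le_compat_l; lra).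
  simpl pow in *. lra.
- replace (Finite 0) with (Rbar_mult (2 * K) 0) by (simpl; f_equal; ring).
  apply is_lim_seq_scal_l. apply is_lim_seq_geom. rewrite Rabs_pos_eq; lra.
- unfold theta. rewrite (is_lim_seq_unique _ _ Hl). exact Hl.
Qed.

(** Integration by parts gives F' = - t / (2 pi a^2) F, so F times the inverse Gaussian has zero
    derivative. The Gaussian integral F(0) stays unevaluated at this point. *)
Lemma gs_FT a t : 0 < a -> FT (gs a) 0 t = IR (gs a) * exp (- (t ^ 2 / (4 * PI * a ^ 2))).
Proof.
intros Ha. assert (HP := PI_RGT_0). assert (Hd := gs_dec a Ha).
assert (Hd1 := dec_id_mult _ Hd).
assert (Ha2 : 0 < a ^ 2) by (apply pow_lt; auto).
set (F := FT (gs a) 0).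
assert (DF : forall t, is_derive F t (- (t / (2 * PI * a ^ 2)) * F t)).
{ intros s. unfold F.
  replace (- (s / (2 * PI * a ^ 2)) * FT (gs a) 0 s) with (FT (fun u => u * gs a u) (0 + PI / 2) s).
  apply FT_derive; auto.
  assert (D1 := dec_FT _ (0 + PI / 2) s Hd1). assert (D2 := dec_FT _ 0 s Hd). simpl in D1.
  assert (Z : IR (fun u => 2 * PI * a ^ 2 * (u * gs a u * cos (s * u + (0 + PI / 2))) + s * (gs a u * cos (s * u + 0))) = 0).
  { apply IR_FTC with (fun u => gs a u * sin (s * u)).
    - intros u. replace (s * u + (0 + PI / 2)) with (PI / 2 + s * u) by ring.
      assert (E : cos (PI / 2 + s * u) = - sin (s * u)) by (rewrite (sin_cos (s * u)); ring).
      rewrite E. unfold gs. auto_derive; auto. rewrite Rplus_0_r. simpl. ring.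
    - apply dec_sin; auto.
    - apply dec_plus; apply dec_scal; auto. }
  rewrite IR_plus, !IR_scal in Z by auto using dec_scal.
  unfold FT. apply Rmult_eq_reg_l with (2 * PI * a ^ 2); [|nra].
  replace (2 * PI * a ^ 2 * (- (s / (2 * PI * a ^ 2)) * IR (fun u : R => gs a u * cos (s * u + 0))))
    with (- (s * IR (fun u : R => gs a u * cos (s * u + 0)))) by (field; split; nra). lra. }
assert (F0 : F 0 = IR (gs a)).
{ unfold F, FT. apply IR_ext; intros. rewrite Rmult_0_l, Rplus_0_r, cos_0. ring. }
set (H := fun t => F t * exp (t ^ 2 / (4 * PI * a ^ 2))).
assert (DH : forall t, is_derive H t 0).
{ intros s. unfold H.
  replace 0 with ((- (s / (2 * PI * a ^ 2)) * F s) * exp (s ^ 2 / (4 * PI * a ^ 2))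
     + F s * (exp (s ^ 2 / (4 * PI * a ^ 2)) * (2 * s / (4 * PI * a ^ 2)))).
  - apply (is_derive_mult F (fun s => exp (s ^ 2 / (4 * PI * a ^ 2)))); auto.
    + auto_derive; auto. simpl. unfold Rdiv. toR. ring.
    + intros; apply Rmult_comm.
  - field. split; nra. }
assert (HC : forall t, H t = H 0).
{ intros s. destruct (Rtotal_order s 0) as [L|[->|L]]; auto.
  - apply (eq_is_derive H s 0); [intros; apply DH | auto].
  - symmetry; apply (eq_is_derive H 0 s); [intros; apply DH | auto]. }
specialize (HC t). unfold H in HC. rewrite F0 in HC.
replace (0 ^ 2 / (4 * PI * a ^ 2)) with 0 in HC by (field; split; nra).
rewrite exp_0, Rmult_1_r in HC. rewrite <- HC, Rmult_assoc, <- exp_plus.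
replace (t ^ 2 / (4 * PI * a ^ 2) + - (t ^ 2 / (4 * PI * a ^ 2))) with 0 by ring. rewrite exp_0. ring.
Qed.

Lemma theta_fe0 a : 0 < a -> theta a = IR (gs a) * theta (/ a).
Proof.
intros Ha. destruct (gs_lipschitz a Ha) as [D [HD H]]. assert (HP := PI_RGT_0).
apply (poisson_summation (gs a) (gs_dec a Ha) D); auto.
- intros y; unfold gs. do 2 f_equal. ring.
- apply theta_lim; auto.
- eapply is_lim_seq_ext; [|apply (is_lim_seq_scal_l _ (IR (gs a)) _ (theta_lim (/ a) (Rinv_0_lt_compat _ Ha)))].
  assert (E : forall k, FT (gs a) 0 (2 * PI * k) = IR (gs a) * gs (/ a) k).
  { intros k. rewrite gs_FT by auto. unfold gs at 3. do 3 f_equal. field. split; lra. }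
  intros n. induction n; simpl; rewrite E; auto. simpl in IHn. rewrite <- IHn. ring.
Qed.

Lemma IR_gs_scale a : 0 < a -> IR (gs a) = IR (gs 1) / a.
Proof.
intros Ha. apply IR_eq; [apply gs_dec; auto|].
apply is_lim_seq_spec. intros eps.
assert (He : 0 < eps * a) by (apply Rmult_lt_0_compat; [apply cond_pos|auto]).
destruct (IR_correct (gs 1) (gs_dec 1 ltac:(lra)) _ He) as [X HX].
destruct (nfloor_ex (Rabs X / a)) as [N [_ HN]].
{ apply Rdiv_le_0_compat; auto using Rabs_pos. }
exists (S N). intros n Hn. apply le_INR in Hn. rewrite S_INR in Hn.
assert (HXn : X <= a * INR n).
{ apply Rle_trans with (a * (Rabs X / a)).
  - generalize (Rle_abs X); intros. field_simplify; lra.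
  - apply Rmult_le_compat_l; lra. }
specialize (HX (a * - INR n + 0) (a * INR n + 0) ltac:(lra) ltac:(lra)).
assert (C1 : cont (gs 1)) by (apply dec_cont, gs_dec; lra).
rewrite <- (RInt_comp_lin (gs 1)) in HX by (apply cont_ex_RInt; auto).
rewrite (RInt_ext _ (fun u => a * gs a u)) in HX.
2:{ intros u _. unfold gs, scal; simpl; unfold mult; simpl. toR. do 3 f_equal. ring. }
rewrite RInt_scal_R in HX by (apply dec_cont, gs_dec; auto).
set (r := RInt (gs a) (- INR n) (INR n)) in *.
apply Rmult_lt_reg_l with a; auto.
rewrite <- (Rabs_pos_eq a) at 1 by lra. rewrite <- Rabs_mult.
replace (a * (r - IR (gs 1) / a)) with (a * r - IR (gs 1)) by (field; lra). rewrite (Rmult_comm a eps). exact HX.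
Qed.

Lemma theta_pos a : 0 < a -> 1 <= theta a.
Proof.
intros Ha. change (Rbar_le 1 (theta a)).
refine (is_lim_seq_le _ _ _ _ _ (is_lim_seq_const 1) (theta_lim a Ha)).
intros n; cbv beta. induction n.
- change (1 <= gs a 0). unfold gs. replace (- (PI * a ^ 2 * 0 ^ 2)) with 0 by ring. rewrite exp_0; apply Rle_refl.
- change (esum (gs a) (S n)) with (esum (gs a) n + 2 * gs a (INR (S n))).
  assert (0 < gs a (INR (S n))) by apply exp_pos. lra.
Qed.

(* At a = 1 the inversion formula reads theta 1 = IR (gs 1) * theta 1, so it computes the Gaussian integral. *)
Lemma IR_gs a : 0 < a -> IR (gs a) = / a.
Proof.
intros Ha. rewrite IR_gs_scale by auto.
assert (A := theta_fe0 1 ltac:(lra)). assert (B := theta_pos 1 ltac:(lra)). rewrite Rinv_1 in A.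
assert (IR (gs 1) = 1) by nra. rewrite H. field; lra.
Qed.

Lemma theta_fe a : 0 < a -> theta a = / a * theta (/ a).
Proof. intros Ha. rewrite theta_fe0, IR_gs by auto. reflexivity. Qed.

(** * Gauss' product and the phase of Gamma(1/4 + it/2) *)

(* [Gk k] is the integrand of pi^(-k/2) Gamma(k/2) / 2 after the substitution x = pi e^(2u). *)
Definition Gk (k u : R) : R := exp (k * u - PI * exp (2 * u)).

Lemma Gk_pos k u : 0 < Gk k u.
Proof. apply exp_pos. Qed.

Lemma Gk_cont k : cont (Gk k).
Proof. apply cont_derivable; intros; unfold Gk; auto_derive; auto. Qed.

Lemma Gk_bound k u : 0 < k -> Gk k u <= exp (k ^ 2) * exp (- k * Rabs u).
Proof.
intros Hk. unfold Gk. rewrite <- exp_plus. apply exp_le.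
assert (HP := PI2_3_2). assert (E := exp_pos (2 * u)).
destruct (Rle_dec 0 u) as [H|H].
- rewrite Rabs_pos_eq by auto. replace (2 * u) with (u + u) in * by ring. rewrite exp_plus in *.
  assert (E1 := exp_ineq1_le u). assert (u * u <= exp u * exp u) by nra.
  assert (exp u * exp u <= PI * (exp u * exp u)) by nra.
  assert (0 <= (k - u) ^ 2) by apply pow2_ge_0. nra.
- rewrite Rabs_left by lra. assert (0 <= k ^ 2) by apply pow2_ge_0. nra.
Qed.

Lemma Gk_dec k : 0 < k -> dec (Gk k).
Proof.
intros Hk. split; [apply Gk_cont|]. exists (exp (k ^ 2)), k. split; auto. intros u.
rewrite Rabs_pos_eq by (left; apply Gk_pos). apply Gk_bound; auto.
Qed.

Lemma Gk_exp k u : exp (2 * u) * Gk k u = Gk (k + 2) u.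
Proof. unfold Gk. rewrite <- exp_plus. f_equal; ring. Qed.

(** [gc k t] and [gsn k t] are the real and imaginary parts of pi^(-s/2) Gamma(s/2) / 2 at s = k +
    it. *)
Definition gc (k t : R) : R := IR (fun u => Gk k u * cos (t * u)).
Definition gsn (k t : R) : R := IR (fun u => Gk k u * sin (t * u)).

(** The functional equation Gamma(s/2 + 1) = (s/2) Gamma(s/2) in real and imaginary parts: the
    derivative of [Gk k] is k [Gk k] - 2 pi [Gk (k + 2)], and its products with cosine and sine are
    integrated. *)
Lemma gamma_rec k t : 0 < k ->
  2 * PI * gc (k + 2) t = k * gc k t - t * gsn k t /\
  2 * PI * gsn (k + 2) t = k * gsn k t + t * gc k t.
Proof.
intros Hk.
assert (D := Gk_dec k Hk). assert (D2 := Gk_dec (k + 2) ltac:(lra)).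
assert (Dc := dec_cos _ t D). assert (Ds := dec_sin _ t D).
assert (Dc2 := dec_cos _ t D2). assert (Ds2 := dec_sin _ t D2).
split.
- assert (Z : IR (fun u => (k * (Gk k u * cos (t * u)) - 2 * PI * (Gk (k + 2) u * cos (t * u))) - t * (Gk k u * sin (t *
    u))) = 0).
  { apply IR_FTC with (fun u => Gk k u * cos (t * u)); dec_lin.
    intros u. rewrite <- Gk_exp. unfold Gk, Rminus. auto_derive; auto. toR. ring. }
  rewrite !IR_minus, !IR_scal in Z by dec_lin. unfold gc, gsn. lra.
- assert (Z : IR (fun u => (k * (Gk k u * sin (t * u)) - 2 * PI * (Gk (k + 2) u * sin (t * u))) + t * (Gk k u * cos (t *
    u))) = 0).
  { apply IR_FTC with (fun u => Gk k u * sin (t * u)); dec_lin.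
    intros u. rewrite <- Gk_exp. unfold Gk, Rminus. auto_derive; auto. toR. ring. }
  rewrite IR_plus, !IR_minus, !IR_scal in Z by dec_lin. unfold gc, gsn. lra.
Qed.

Definition argsum (t : R) (n : nat) : R := sum_f_R0 (fun k => atan (2 * t / (4 * INR k + 1))) n.

Lemma polar_factor k t : 0 < k -> exists r, 0 < r /\ k = r * cos (atan (t / k)) /\ t = r * sin (atan (t / k)).
Proof.
intros Hk. assert (0 < sqrt (1 + (t / k) ^ 2)).
{ apply sqrt_lt_R0. generalize (pow2_ge_0 (t / k)); lra. }
exists (k * sqrt (1 + (t / k) ^ 2)). rewrite cos_atan, sin_atan. unfold Rsqr.
replace (t / k * (t / k)) with ((t / k) ^ 2) by ring.
split; [apply Rmult_lt_0_compat; auto|]. split; field; lra.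
Qed.

(** Each use of the recurrence multiplies by k + it, whose argument atan(t / k) at k = 1/2 + 2 j is
    the j-th term of [argsum]. The moduli are lumped into r, since only the phase is wanted. *)
Lemma gamma_product t n : exists r, 0 < r /\
  (2 * PI) ^ S n * gc (1 / 2 + 2 * INR (S n)) t = r * (cos (argsum t n) * gc (1 / 2) t - sin (argsum t n) * gsn (1 / 2) t) /\
  (2 * PI) ^ S n * gsn (1 / 2 + 2 * INR (S n)) t = r * (sin (argsum t n) * gc (1 / 2) t + cos (argsum t n) * gsn (1 / 2) t).
Proof.
induction n as [|n [r [Hr [E1 E2]]]].
- destruct (gamma_rec (1 / 2) t ltac:(lra)) as [A B].
  destruct (polar_factor (1 / 2) t ltac:(lra)) as [r [Hr [C S]]].
  exists r. split; auto. unfold argsum. simpl sum_f_R0. simpl INR. simpl pow.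
  replace (2 * t / (4 * 0 + 1)) with (t / (1 / 2)) by field.
  replace (1 / 2 + 2 * 1) with (1 / 2 + 2) by ring. rewrite Rmult_1_r, A, B.
  set (w := atan (t / (1 / 2))) in *. set (g := gc (1 / 2) t). set (h := gsn (1 / 2) t).
  replace (r * (cos w * g - sin w * h)) with ((r * cos w) * g - (r * sin w) * h) by ring.
  replace (r * (sin w * g + cos w * h)) with ((r * cos w) * h + (r * sin w) * g) by ring.
  rewrite <- C, <- S. split; ring.
- set (k := 1 / 2 + 2 * INR (S n)) in *.
  assert (Hk : 0 < k) by (unfold k; generalize (pos_INR (S n)); lra).
  destruct (gamma_rec k t Hk) as [A B].
  destruct (polar_factor k t Hk) as [r2 [Hr2 [C S]]].
  exists (r * r2). split; [apply Rmult_lt_0_compat; auto|].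
  unfold argsum in *. rewrite tech5. set (s := sum_f_R0 _ n) in *.
  replace (2 * t / (4 * INR (Datatypes.S n) + 1)) with (t / k).
  2:{ unfold k. field. generalize (pos_INR (Datatypes.S n)). lra. }
  rewrite (S_INR (Datatypes.S n)). replace (1 / 2 + 2 * (INR (Datatypes.S n) + 1)) with (k + 2) by (unfold k; ring).
  set (w := atan (t / k)) in *.
  rewrite cos_plus, sin_plus.
  change ((2 * PI) ^ Datatypes.S (Datatypes.S n)) with (2 * PI * (2 * PI) ^ Datatypes.S n).
  set (q := (2 * PI) ^ Datatypes.S n) in *.
  split.
  + replace (2 * PI * q * gc (k + 2) t) with (q * (2 * PI * gc (k + 2) t)) by ring. rewrite A.
    replace (q * (k * gc k t - t * gsn k t)) with (k * (q * gc k t) - t * (q * gsn k t)) by ring.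
    rewrite E1, E2. set (g := gc (1 / 2) t). set (h := gsn (1 / 2) t).
    transitivity ((r2 * cos w) * (r * (cos s * g - sin s * h)) - (r2 * sin w) * (r * (sin s * g + cos s * h))).
    * rewrite <- C, <- S. reflexivity.
    * ring.
  + replace (2 * PI * q * gsn (k + 2) t) with (q * (2 * PI * gsn (k + 2) t)) by ring. rewrite B.
    replace (q * (k * gsn k t + t * gc k t)) with (k * (q * gsn k t) + t * (q * gc k t)) by ring.
    rewrite E1, E2. set (g := gc (1 / 2) t). set (h := gsn (1 / 2) t).
    transitivity ((r2 * cos w) * (r * (sin s * g + cos s * h)) + (r2 * sin w) * (r * (cos s * g - sin s * h))).
    * rewrite <- C, <- S. reflexivity.
    * ring.
Qed.

Lemma gc_0_pos k : 0 < k -> 0 < gc k 0.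
Proof.
intros Hk. apply IR_pos; [apply dec_cos, Gk_dec; auto|].
intros u. rewrite Rmult_0_l, cos_0, Rmult_1_r. apply Gk_pos.
Qed.

Lemma gc_0 k : gc k 0 = IR (Gk k).
Proof. apply IR_ext. intros u. rewrite Rmult_0_l, cos_0. ring. Qed.

Lemma IR_Gk_rec k : 0 < k -> IR (Gk (k + 2)) = k / (2 * PI) * IR (Gk k).
Proof.
intros Hk. destruct (gamma_rec k 0 Hk) as [A _]. rewrite !gc_0 in A.
assert (HP := PI_RGT_0). apply Rmult_eq_reg_l with (2 * PI); [|lra]. rewrite A. field. lra.
Qed.

(** A first moment is bounded by moments of e^v and e^(- v) because multiplication by e^(2u) shifts
    k by 2: such moments of [Gk k] are masses of neighbouring kernels, known exactly from the
    recurrence. The parameter e comes from a <= e + a^2 / (4 e). *)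
Lemma abs_le_exp_moments v e : 0 < e ->
  Rabs v <= 2 * e + ((exp v - 1) ^ 2 + (exp (- v) - 1) ^ 2) / (4 * e).
Proof.
intros He.
assert (A : forall a, 0 <= a -> a <= e + a ^ 2 / (4 * e)).
{ intros a Ha. apply Rmult_le_reg_r with (4 * e); [lra|].
  replace ((e + a ^ 2 / (4 * e)) * (4 * e)) with (4 * e ^ 2 + a ^ 2) by (field; lra).
  assert (0 <= (2 * e - a) ^ 2) by apply pow2_ge_0. nra. }
assert (B1 := A _ (Rabs_pos (exp v - 1))). assert (B2 := A _ (Rabs_pos (exp (- v) - 1))).
rewrite pow2_abs in B1, B2.
assert (Rabs v <= Rabs (exp v - 1) + Rabs (exp (- v) - 1)).
{ assert (E1 := exp_ineq1_le v). assert (E2 := exp_ineq1_le (- v)).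
  assert (P1 := Rabs_pos (exp v - 1)). assert (P2 := Rabs_pos (exp (- v) - 1)).
  generalize (Rle_abs (exp v - 1)), (Rle_abs (exp (- v) - 1)). unfold Rabs at 3; destruct (Rcase_abs v); lra. }
unfold Rdiv in *. rewrite Rmult_plus_distr_r. lra.
Qed.

Lemma Gk_scale k u0 u : Gk k u * exp (2 * (u - u0)) = exp (- (2 * u0)) * Gk (k + 2) u.
Proof. rewrite <- Gk_exp. replace (2 * (u - u0)) with (- (2 * u0) + 2 * u) by ring. rewrite exp_plus. ring. Qed.

Lemma Gk_scale_inv k u0 u : Gk k u * exp (- (2 * (u - u0))) = exp (2 * u0) * Gk (k - 2) u.
Proof.
replace k with (k - 2 + 2) at 1 by ring. rewrite <- Gk_exp.
replace (- (2 * (u - u0))) with (2 * u0 + - (2 * u)) by ring. rewrite exp_plus.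
replace (exp (2 * u) * Gk (k - 2) u * (exp (2 * u0) * exp (- (2 * u)))) with
 (exp (2 * u) * exp (- (2 * u)) * (exp (2 * u0) * Gk (k - 2) u)) by ring.
rewrite <- exp_plus, Rplus_opp_r, exp_0. ring.
Qed.

(* The mass of [Gk k] concentrates at the point u0 with pi e^(2 u0) = n when k is close to 2n: both second moments are O(1/n) relative to the mass. *)
Lemma Gk_concentration n (k := 1 / 2 + 2 * INR (S n)) (u0 := ln (INR n / PI) / 2) : (1 <= n)%nat ->
  dec (fun u => Gk k u * Rabs (2 * (u - u0))) /\
  IR (fun u => Gk k u * Rabs (2 * (u - u0))) <= 4 / sqrt (INR n) * IR (Gk k).
Proof.
intros Hn. assert (HP := PI_RGT_0). assert (HN : 1 <= INR n) by (apply (le_INR 1); auto).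
assert (Hk : k = 2 * INR n + 5 / 2) by (unfold k; rewrite S_INR; field).
assert (D := Gk_dec k ltac:(lra)). assert (D2 := Gk_dec (k + 2) ltac:(lra)).
assert (D4 := Gk_dec (k + 2 + 2) ltac:(lra)).
assert (Dm2 := Gk_dec (k - 2) ltac:(lra)). assert (Dm4 := Gk_dec (k - 2 - 2) ltac:(lra)).
assert (Hu0 : exp (2 * u0) = INR n / PI).
{ unfold u0. replace (2 * (ln (INR n / PI) / 2)) with (ln (INR n / PI)) by field. apply exp_ln.
  apply Rdiv_lt_0_compat; lra. }
assert (Hu0' : exp (- (2 * u0)) = PI / INR n) by (rewrite exp_Ropp, Hu0; field; lra).
(* This e balances the term 2 e against second moments O(1/n) divided by 4 e. *)
set (e := / sqrt (INR n)).
assert (Hs : 0 < sqrt (INR n)) by (apply sqrt_lt_R0; lra).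
assert (He : 0 < e) by (apply Rinv_0_lt_compat; auto).
assert (Dl : dec (fun u => Gk k u * Rabs (2 * (u - u0)))).
{ apply dec_dom with (fun u => (2 * u) * Gk k u - (2 * u0) * Gk k u) 1; try lra.
  - apply cont_mult; [apply Gk_cont|]. apply cont_abs, cont_derivable. intros; auto_derive; auto.
  - apply dec_minus; [|apply dec_scal; auto].
    replace (fun u => 2 * u * Gk k u) with (fun u => 2 * (u * Gk k u)).
    apply dec_scal, dec_id_mult; auto. apply functional_extensionality; intros; ring.
  - intros u. rewrite Rabs_mult, Rabs_Rabsolu, <- Rabs_mult, Rmult_1_l. right; f_equal; ring. }
split; auto.
set (F := fun u => (2 * e + / (2 * e)) * Gk k u
  + / (4 * e) * ((PI / INR n) ^ 2 * Gk (k + 2 + 2) u - 2 * (PI / INR n) * Gk (k + 2) u)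
  + / (4 * e) * ((INR n / PI) ^ 2 * Gk (k - 2 - 2) u - 2 * (INR n / PI) * Gk (k - 2) u)).
assert (DF : dec F).
{ unfold F. dec_lin. }
apply Rle_trans with (IR F).
- apply IR_le; auto. intros u. unfold F.
  assert (A := abs_le_exp_moments (2 * (u - u0)) e He).
  assert (P := Gk_pos k u).
  apply Rle_trans with (Gk k u * (2 * e + ((exp (2 * (u - u0)) - 1) ^ 2 + (exp (- (2 * (u - u0))) - 1) ^ 2) / (4 * e))).
  { apply Rmult_le_compat_l; lra. }
  assert (S1 := Gk_scale k u0 u). assert (S2 := Gk_scale (k + 2) u0 u).
  assert (S3 := Gk_scale_inv k u0 u). assert (S4 := Gk_scale_inv (k - 2) u0 u).
  rewrite Hu0 in S3, S4. rewrite Hu0' in S1, S2.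
  set (y := exp (2 * (u - u0))) in *. set (y' := exp (- (2 * (u - u0)))) in *.
  replace ((PI / INR n) ^ 2 * Gk (k + 2 + 2) u) with (Gk k u * y * y).
  2:{ rewrite S1. replace (PI / INR n * Gk (k + 2) u * y) with (PI / INR n * (Gk (k + 2) u * y)) by ring. rewrite S2. ring. }
  replace ((INR n / PI) ^ 2 * Gk (k - 2 - 2) u) with (Gk k u * y' * y').
  2:{ rewrite S3. replace (INR n / PI * Gk (k - 2) u * y') with (INR n / PI * (Gk (k - 2) u * y')) by ring. rewrite S4. ring. }
  replace (2 * (PI / INR n) * Gk (k + 2) u) with (2 * (PI / INR n * Gk (k + 2) u)) by ring. rewrite <- S1.
  replace (2 * (INR n / PI) * Gk (k - 2) u) with (2 * (INR n / PI * Gk (k - 2) u)) by ring. rewrite <- S3.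
  right. field. lra.
- unfold F. rewrite !IR_plus, !IR_scal, !IR_minus, !IR_scal by (dec_lin).
  assert (I1 := IR_Gk_rec k ltac:(lra)). assert (I2 := IR_Gk_rec (k + 2) ltac:(lra)).
  assert (I3 := IR_Gk_rec (k - 2) ltac:(lra)). assert (I4 := IR_Gk_rec (k - 2 - 2) ltac:(lra)).
  replace (k - 2 + 2) with k in I3 by ring. replace (k - 2 - 2 + 2) with (k - 2) in I4 by ring.
  rewrite I2, I1. set (g := IR (Gk k)) in *.
  assert (J3 : IR (Gk (k - 2)) = 2 * PI / (k - 2) * g).
  { rewrite I3. field. split; lra. }
  assert (J4 : IR (Gk (k - 2 - 2)) = 2 * PI / (k - 4) * (2 * PI / (k - 2) * g)).
  { rewrite <- J3, I4. field. split; lra. }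
  rewrite J3, J4.
  assert (Hg : 0 < g) by (unfold g; rewrite <- gc_0; apply gc_0_pos; lra).
  set (N := INR n) in *.
  assert (HeN : e * e = / N). { unfold e. rewrite <- Rinv_mult, sqrt_sqrt by lra. reflexivity. }
  replace (4 / sqrt N) with (4 * e) by (unfold e; field; lra).
  apply Rle_trans with (g * (2 * e + / (4 * e) * (((4 * N + 45 / 4) / (4 * N ^ 2)) + (4 * N - 3 / 4) / ((2 * N + 1 / 2) * (2
    * N - 3 / 2))))).
  { right. rewrite Hk. field. repeat split; lra. }
  rewrite (Rmult_comm (4 * e)). apply Rmult_le_compat_l; [lra|].
  assert (B1 : (4 * N + 45 / 4) / (4 * N ^ 2) <= 4 / N).
  { apply Rmult_le_reg_r with (4 * N ^ 2); [nra|].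
    replace ((4 * N + 45 / 4) / (4 * N ^ 2) * (4 * N ^ 2)) with (4 * N + 45 / 4) by (field; lra).
    replace (4 / N * (4 * N ^ 2)) with (16 * N) by (field; lra). lra. }
  assert (B2 : (4 * N - 3 / 4) / ((2 * N + 1 / 2) * (2 * N - 3 / 2)) <= 4 / N).
  { assert (0 < (2 * N + 1 / 2) * (2 * N - 3 / 2)) by (apply Rmult_lt_0_compat; lra).
    apply Rmult_le_reg_r with (((2 * N + 1 / 2) * (2 * N - 3 / 2)) * N); [nra|].
    replace ((4 * N - 3 / 4) / ((2 * N + 1 / 2) * (2 * N - 3 / 2)) * (((2 * N + 1 / 2) * (2 * N - 3 / 2)) * N)) with ((4 * N
      - 3 / 4) * N) by (field; split; lra).
    replace (4 / N * (((2 * N + 1 / 2) * (2 * N - 3 / 2)) * N)) with (4 * ((2 * N + 1 / 2) * (2 * N - 3 / 2))) by (field;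
      lra). nra. }
  apply Rle_trans with (2 * e + / (4 * e) * (8 / N)).
  { apply Rplus_le_compat_l, Rmult_le_compat_l; [left; apply Rinv_0_lt_compat; lra | lra]. }
  unfold Rdiv. rewrite <- HeN. right. field. lra.
Qed.

Definition vn (t : R) (n : nat) : R := t / 2 * ln (INR n) - argsum t n.

Lemma lim_seq_eq u (l : R) : is_lim_seq u l -> lim_seq u = l.
Proof.
intros H. assert (A : Un_cv u (lim_seq u)).
{ unfold lim_seq. apply epsilon_spec. exists l. apply is_lim_seq_Reals; auto. }
eapply UL_sequence; eauto. apply is_lim_seq_Reals; auto.
Qed.

Lemma atan_diff_le x : Rabs (x - atan x) <= x ^ 2.
Proof.
destruct (MVT_gen (fun x => x - atan x) 0 x (fun x => 1 - / (1 + x ^ 2))) as [c [Hc E]].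
- intros z _. auto_derive; auto. field. nra.
- intros z _. apply derivable_continuous_pt, ex_derive_Reals_0. auto_derive; auto.
- cbv beta in E. rewrite atan_0, !Rminus_0_r in E. rewrite E, Rabs_mult.
  assert (Hc2 : 0 <= c ^ 2) by apply pow2_ge_0.
  replace (1 - / (1 + c ^ 2)) with (c ^ 2 / (1 + c ^ 2)) by (field; lra).
  rewrite Rabs_pos_eq by (apply Rdiv_le_0_compat; lra).
  rewrite <- (pow2_abs x). replace (Rabs x ^ 2) with (Rabs x * Rabs x) by ring. apply Rmult_le_compat_r; [apply Rabs_pos|].
  apply Rle_trans with (Rabs c).
  + apply Rmult_le_reg_r with (1 + c ^ 2); [lra|]. unfold Rdiv. rewrite Rmult_assoc, Rinv_l, Rmult_1_r by lra.
    rewrite <- (pow2_abs c). assert (0 <= (Rabs c - 1) ^ 2) by apply pow2_ge_0.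
    assert (0 <= Rabs c) by apply Rabs_pos. nra.
  + revert Hc. unfold Rmin, Rmax, Rabs. destruct (Rle_dec 0 x); destruct (Rcase_abs c); destruct (Rcase_abs x); lra.
Qed.

Lemma ln_bounds x : 0 < x -> 1 - / x <= ln x <= x - 1.
Proof.
intros Hx. split.
- assert (A := exp_ineq1_le (- ln x)). rewrite exp_Ropp, exp_ln in A by auto. lra.
- assert (A := exp_ineq1_le (ln x)). rewrite exp_ln in A by auto. lra.
Qed.

Lemma ln_succ_bounds y : 0 < y -> / (y + 1) <= ln (y + 1) - ln y <= / y.
Proof.
intros Hy. rewrite <- ln_div by lra.
destruct (ln_bounds ((y + 1) / y)) as [A B]; [apply Rdiv_lt_0_compat; lra|].
split.
- eapply Rle_trans; [|apply A]. right. field. lra.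
- eapply Rle_trans; [apply B|]. right. field. lra.
Qed.

Lemma is_lim_seq_const_div c : is_lim_seq (fun n => c / INR n) 0.
Proof.
replace (Finite 0) with (Rbar_mult c 0) by (simpl; f_equal; ring).
apply is_lim_seq_scal_l. apply (is_lim_seq_inv INR p_infty). apply is_lim_seq_INR. discriminate.
Qed.

(** The increment is t/2 times ln(1 + 1/n) - 1 / (n + 5/4), plus x - atan x at x = t / (2 (n +
    5/4)). Both are O(1/n^2) and are dominated by a multiple of 1/n - 1/(n + 1). *)
Lemma vn_lim t : is_lim_seq (vn t) (im_lngamma t).
Proof.
destruct (lim_seq_telescoping (vn t) (fun n => (2 * Rabs t + t ^ 2) / INR n) 1) as [l [Hl _]].
- intros n Hn. assert (HN : 1 <= INR n) by (apply (le_INR 1); auto).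
  unfold vn, argsum. rewrite tech5, S_INR. set (N := INR n) in *. set (s := sum_f_R0 _ n).
  replace (2 * t / (4 * (N + 1) + 1)) with (t / 2 * / (N + 5 / 4)) by (field; lra).
  set (x := t / 2 * / (N + 5 / 4)).
  replace (t / 2 * ln (N + 1) - (s + atan x) - (t / 2 * ln N - s))
   with (t / 2 * (ln (N + 1) - ln N - / (N + 5 / 4)) + (x - atan x)) by (unfold x; ring).
  eapply Rle_trans; [apply Rabs_triang|].
  assert (A := ln_succ_bounds N ltac:(lra)).
  assert (I1 : / (N + 2) <= / (N + 5 / 4)) by (apply Rinv_le_contravar; lra).
  assert (I2 : / (N + 5 / 4) <= / (N + 1)) by (apply Rinv_le_contravar; lra).
  assert (I3 : / N - / (N + 2) <= 2 * (/ N - / (N + 1))).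
  { apply Rmult_le_reg_r with (N * (N + 1) * (N + 2)); [repeat apply Rmult_lt_0_compat; lra|].
    replace ((/ N - / (N + 2)) * (N * (N + 1) * (N + 2))) with (2 * (N + 1)) by (field; lra).
    replace (2 * (/ N - / (N + 1)) * (N * (N + 1) * (N + 2))) with (2 * (N + 2)) by (field; lra). lra. }
  assert (I0 : / (N + 1) <= / N) by (apply Rinv_le_contravar; lra).
  assert (B1 : Rabs (ln (N + 1) - ln N - / (N + 5 / 4)) <= 2 * (/ N - / (N + 1))) by (apply Rabs_le; lra).
  assert (B2 : x ^ 2 <= t ^ 2 * (/ N - / (N + 1))).
  { unfold x. replace (/ N - / (N + 1)) with (/ (N * (N + 1))) by (field; lra).
    assert (/ (N + 5 / 4) ^ 2 <= / (N * (N + 1))).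
    { apply Rinv_le_contravar; [apply Rmult_lt_0_compat; lra | nra]. }
    assert (0 <= / (N + 5 / 4) ^ 2) by (left; apply Rinv_0_lt_compat, pow_lt; lra).
    assert (0 <= t ^ 2) by apply pow2_ge_0.
    replace ((t / 2 * / (N + 5 / 4)) ^ 2) with (t ^ 2 / 4 * / (N + 5 / 4) ^ 2) by (field; lra). nra. }
  assert (B3 := atan_diff_le x). rewrite Rabs_mult.
  assert (E : Rabs (t / 2) = Rabs t / 2) by (unfold Rdiv; rewrite Rabs_mult, (Rabs_pos_eq (/ 2)) by lra; reflexivity).
  rewrite E. assert (0 <= Rabs t) by apply Rabs_pos. set (d := / N - / (N + 1)) in *.
  replace ((2 * Rabs t + t ^ 2) / N - (2 * Rabs t + t ^ 2) / (N + 1)) with ((2 * Rabs t + t ^ 2) * d) by (unfold d, Rdiv; ring).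
  assert (0 <= d) by (unfold d; lra).
  assert (Rabs t / 2 * Rabs (ln (N + 1) - ln N - / (N + 5 / 4)) <= Rabs t / 2 * (2 * d)) by (apply Rmult_le_compat_l; lra).
  nra.
- apply is_lim_seq_const_div.
- unfold im_lngamma. replace (lim_seq _) with l; auto. symmetry. apply lim_seq_eq. exact Hl.
Qed.

Lemma abs_IR_le_concentration n t f (k := 1 / 2 + 2 * INR (S n)) (u0 := ln (INR n / PI) / 2) : (1 <= n)%nat ->
  dec f -> (forall u, Rabs (f u) <= Gk k u * Rabs (t * (u - u0))) ->
  Rabs (IR f) <= 2 * Rabs t / sqrt (INR n) * IR (Gk k).
Proof.
intros Hn Hf H. destruct (Gk_concentration n Hn) as [D B]. fold k u0 in D, B.
apply Rle_trans with (IR (fun u => Rabs t / 2 * (Gk k u * Rabs (2 * (u - u0))))).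
- apply IR_abs; auto using dec_scal. intros u. eapply Rle_trans; [apply H|].
  rewrite !Rabs_mult, (Rabs_pos_eq 2) by lra. right; field.
- rewrite IR_scal by auto. assert (0 <= Rabs t) by apply Rabs_pos.
  replace (2 * Rabs t / sqrt (INR n) * IR (Gk k)) with (Rabs t / 2 * (4 / sqrt (INR n) * IR (Gk k))).
  apply Rmult_le_compat_l; lra. field. apply Rgt_not_eq, sqrt_lt_R0, lt_0_INR; lia.
Qed.

(** For large n the kernel with k = 1/2 + 2 (n + 1) concentrates at u0, so its transform is nearly
    its mass times e^(i t u0). Pulled back by [gamma_product], this says that gamma(1/2 + it) e^(- i
    th n), rescaled by some rho n > 0, tends to 1, while th n tends to vartheta(t). That gamma does
    not vanish comes out of the same limit. *)
Lemma gamma_phase t : exists r, 0 < r /\ gc (1 / 2) t = r * cos (vartheta t) /\ gsn (1 / 2) t = r * sin (vartheta t).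
Proof.
assert (HP := PI_RGT_0).
set (g := gc (1 / 2) t). set (h := gsn (1 / 2) t).
set (th := fun n => vn t n - t / 2 * ln PI).
assert (Lth : is_lim_seq th (vartheta t)).
{ unfold vartheta. replace (- (t / 2) * ln PI + im_lngamma t) with (im_lngamma t - t / 2 * ln PI) by ring.
  apply is_lim_seq_minus'; [apply vn_lim | apply is_lim_seq_const]. }
assert (Hrho : forall n, exists rho, 0 < rho /\ ((1 <= n)%nat ->
   Rabs (rho * (g * cos (th n) + h * sin (th n)) - 1) <= 2 * Rabs t / sqrt (INR n) /\
   Rabs (rho * (h * cos (th n) - g * sin (th n))) <= 2 * Rabs t / sqrt (INR n))).
{ intros n. destruct n as [|m]; [exists 1; split; [lra|lia]|]. set (n := S m).
  assert (Hn : (1 <= n)%nat) by (unfold n; lia). clearbody n.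
  assert (HN : 1 <= INR n) by (apply (le_INR 1); auto).
  destruct (gamma_product t n) as [r [Hr [E1 E2]]].
  set (k := 1 / 2 + 2 * INR (S n)) in *. set (u0 := ln (INR n / PI) / 2).
  assert (Hk : 0 < k) by (unfold k; generalize (pos_INR (S n)); lra).
  assert (Dk := Gk_dec k Hk).
  assert (Hg0 : 0 < IR (Gk k)) by (rewrite <- gc_0; apply gc_0_pos; auto).
  assert (Hq : 0 < (2 * PI) ^ S n) by (apply pow_lt; lra).
  exists (r / ((2 * PI) ^ S n * IR (Gk k))). split; [apply Rdiv_lt_0_compat; auto; apply Rmult_lt_0_compat; auto|].
  intros _.
  (* The point u0 = ln(n / pi) / 2 is chosen so that t u0 - [argsum t n] is Gauss' approximant to
     vartheta(t). *)
  assert (Eth : th n = t * u0 - argsum t n).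
  { unfold th, vn, u0. rewrite ln_div by lra. field. }
  rewrite Eth. fold g h in E1, E2.
  assert (Q1 : r / ((2 * PI) ^ S n * IR (Gk k)) * (g * cos (t * u0 - argsum t n) + h * sin (t * u0 - argsum t n))
     = (gc k t * cos (t * u0) + gsn k t * sin (t * u0)) / IR (Gk k)).
  { apply Rmult_eq_reg_l with ((2 * PI) ^ S n * IR (Gk k)).
    2:{ apply Rgt_not_eq, Rmult_lt_0_compat; auto. }
    replace ((2 * PI) ^ S n * IR (Gk k) * ((gc k t * cos (t * u0) + gsn k t * sin (t * u0)) / IR (Gk k)))
      with (((2 * PI) ^ S n * gc k t) * cos (t * u0) + ((2 * PI) ^ S n * gsn k t) * sin (t * u0)) by (field; lra).
    rewrite E1, E2, cos_minus, sin_minus. field. split; [lra|apply Rgt_not_eq; auto]. }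
  assert (Q2 : r / ((2 * PI) ^ S n * IR (Gk k)) * (h * cos (t * u0 - argsum t n) - g * sin (t * u0 - argsum t n))
     = (gsn k t * cos (t * u0) - gc k t * sin (t * u0)) / IR (Gk k)).
  { apply Rmult_eq_reg_l with ((2 * PI) ^ S n * IR (Gk k)).
    2:{ apply Rgt_not_eq, Rmult_lt_0_compat; auto. }
    replace ((2 * PI) ^ S n * IR (Gk k) * ((gsn k t * cos (t * u0) - gc k t * sin (t * u0)) / IR (Gk k)))
      with (((2 * PI) ^ S n * gsn k t) * cos (t * u0) - ((2 * PI) ^ S n * gc k t) * sin (t * u0)) by (field; lra).
    rewrite E1, E2, cos_minus, sin_minus. field. split; [lra|apply Rgt_not_eq; auto]. }
  rewrite Q1, Q2.
  assert (Dc := dec_cos _ t Dk). assert (Ds := dec_sin _ t Dk).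
  assert (F1 : dec (fun u => cos (t * u0) * (Gk k u * cos (t * u)) + sin (t * u0) * (Gk k u * sin (t * u)) - Gk k u)).
  { dec_lin. }
  assert (F2 : dec (fun u => cos (t * u0) * (Gk k u * sin (t * u)) - sin (t * u0) * (Gk k u * cos (t * u)))).
  { dec_lin. }
  assert (B1 := abs_IR_le_concentration n t _ Hn F1). assert (B2 := abs_IR_le_concentration n t _ Hn F2).
  fold k u0 in B1, B2.
  rewrite IR_minus, IR_plus, !IR_scal in B1 by (dec_lin).
  rewrite IR_minus, !IR_scal in B2 by (dec_lin).
  fold (gc k t) (gsn k t) in B1, B2.
  assert (Dv : forall x y, Rabs x <= y * IR (Gk k) -> Rabs (x / IR (Gk k)) <= y).
  { intros x y Hxy. unfold Rdiv. rewrite Rabs_mult, (Rabs_pos_eq (/ _)) by (left; apply Rinv_0_lt_compat; auto).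
    apply Rmult_le_reg_r with (IR (Gk k)); auto. rewrite Rmult_assoc, Rinv_l, Rmult_1_r by lra. auto. }
  split.
  - replace ((gc k t * cos (t * u0) + gsn k t * sin (t * u0)) / IR (Gk k) - 1)
      with ((cos (t * u0) * gc k t + sin (t * u0) * gsn k t - IR (Gk k)) / IR (Gk k)) by (field; lra).
    apply Dv, B1. intros u.
    replace (cos (t * u0) * (Gk k u * cos (t * u)) + sin (t * u0) * (Gk k u * sin (t * u)) - Gk k u)
      with (Gk k u * (cos (t * u - t * u0) - cos 0)) by (rewrite cos_minus, cos_0; ring).
    rewrite Rabs_mult, Rabs_pos_eq by (left; apply Gk_pos). apply Rmult_le_compat_l; [left; apply Gk_pos|].
    eapply Rle_trans; [apply cos_lipschitz|]. right; f_equal; ring.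
  - replace (gsn k t * cos (t * u0) - gc k t * sin (t * u0))
      with (cos (t * u0) * gsn k t - sin (t * u0) * gc k t) by ring.
    apply Dv, B2. intros u.
    replace (cos (t * u0) * (Gk k u * sin (t * u)) - sin (t * u0) * (Gk k u * cos (t * u)))
      with (Gk k u * (sin (t * u - t * u0) - sin 0)) by (rewrite sin_minus, sin_0; ring).
    rewrite Rabs_mult, Rabs_pos_eq by (left; apply Gk_pos). apply Rmult_le_compat_l; [left; apply Gk_pos|].
    eapply Rle_trans; [apply sin_lipschitz|]. right; f_equal; ring. }
set (rho := fun n => proj1_sig (constructive_indefinite_description _ (Hrho n))).
assert (Rp : forall n, 0 < rho n).
{ intros n. unfold rho. destruct (constructive_indefinite_description _ (Hrho n)) as [x [A B]]; auto. }
assert (Rb : forall n, (1 <= n)%nat ->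
   Rabs (rho n * (g * cos (th n) + h * sin (th n)) - 1) <= 2 * Rabs t / sqrt (INR n) /\
   Rabs (rho n * (h * cos (th n) - g * sin (th n))) <= 2 * Rabs t / sqrt (INR n)).
{ intros n. unfold rho. destruct (constructive_indefinite_description _ (Hrho n)) as [x [A B]]; auto. }
clearbody rho. clear Hrho.
assert (Lb : is_lim_seq (fun n => 2 * Rabs t / sqrt (INR n)) 0).
{ replace (Finite 0) with (Rbar_mult (2 * Rabs t) 0) by (simpl; f_equal; ring).
  apply is_lim_seq_scal_l. apply (is_lim_seq_inv (fun n => sqrt (INR n)) p_infty).
  - apply (filterlim_comp _ _ _ INR sqrt _ (Rbar_locally p_infty)); [apply is_lim_seq_INR | apply filterlim_sqrt_p].
  - discriminate. }
assert (LX : is_lim_seq (fun n => rho n * (g * cos (th n) + h * sin (th n))) 1).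
{ apply is_lim_seq_spec. intros eps. apply is_lim_seq_spec in Lb. destruct (Lb eps) as [N HN].
  exists (max 1 N). intros n Hn. specialize (HN n ltac:(lia)). rewrite Rminus_0_r in HN.
  destruct (Rb n ltac:(lia)) as [A _]. eapply Rle_lt_trans; [apply A|]. apply Rle_lt_trans with (2 := HN), Rle_abs. }
assert (LY : is_lim_seq (fun n => rho n * (h * cos (th n) - g * sin (th n))) 0).
{ apply is_lim_seq_spec. intros eps. apply is_lim_seq_spec in Lb. destruct (Lb eps) as [N HN].
  exists (max 1 N). intros n Hn. specialize (HN n ltac:(lia)). rewrite Rminus_0_r in HN.
  destruct (Rb n ltac:(lia)) as [_ A]. rewrite Rminus_0_r. eapply Rle_lt_trans; [apply A|]. apply Rle_lt_trans with (2 :=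
    HN), Rle_abs. }
clear Rb Lb.
set (m2 := g * g + h * h).
assert (LR : is_lim_seq (fun n => rho n * rho n * m2) 1).
{ replace 1 with (1 * 1 + 0 * 0) by ring.
  eapply is_lim_seq_ext; [|apply (is_lim_seq_plus' _ _ _ _ (is_lim_seq_mult' _ _ _ _ LX LX) (is_lim_seq_mult' _ _ _ _ LY LY))].
  intros n; cbv beta. assert (SC := sin2_cos2 (th n)). unfold Rsqr in SC. unfold m2.
  replace (rho n * rho n * (g * g + h * h)) with (rho n * rho n * (g * g + h * h) * (sin (th n) * sin (th n) + cos (th n) *
    cos (th n))) by (rewrite SC; ring).
  ring. }
assert (Hm : 0 < m2).
{ assert (0 <= m2) by (unfold m2; nra). destruct (Req_dec m2 0) as [Z|]; [|lra]. exfalso.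
  assert (L0 : is_lim_seq (fun n => rho n * rho n * m2) 0).
  { apply is_lim_seq_ext with (fun _ => 0); [intros; rewrite Z; ring | apply is_lim_seq_const]. }
  apply is_lim_seq_unique in LR. apply is_lim_seq_unique in L0. rewrite LR in L0. injection L0; lra. }
set (m := sqrt m2). assert (Hm' : 0 < m) by (apply sqrt_lt_R0; auto).
assert (Hmm : m * m = m2) by (apply sqrt_sqrt; lra).
assert (Lrho : is_lim_seq (fun n => / m * sqrt (rho n * rho n * m2)) (/ m * sqrt 1)).
{ apply (is_lim_seq_scal_l (fun n => sqrt (rho n * rho n * m2)) (/ m) (sqrt 1)).
  apply (is_lim_seq_continuous sqrt _ 1); auto. apply continuity_pt_sqrt; lra. }
assert (Lrho' : is_lim_seq rho (/ m)).
{ rewrite sqrt_1, Rmult_1_r in Lrho. eapply is_lim_seq_ext; [|apply Lrho]. intros n; cbv beta.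
  rewrite sqrt_mult_alt by (specialize (Rp n); nra). rewrite sqrt_square by (left; auto). fold m. field; lra. }
assert (Lc : is_lim_seq (fun n => cos (th n)) (cos (vartheta t))).
{ apply (is_lim_seq_continuous cos _ (vartheta t)); auto. apply continuity_cos. }
assert (Ls : is_lim_seq (fun n => sin (th n)) (sin (vartheta t))).
{ apply (is_lim_seq_continuous sin _ (vartheta t)); auto. apply continuity_sin. }
set (c := cos (vartheta t)) in *. set (s := sin (vartheta t)) in *.
assert (UX : / m * (g * c + h * s) = 1).
{ assert (L := is_lim_seq_mult' _ _ _ _ Lrho' (is_lim_seq_plus' _ _ _ _ (is_lim_seq_scal_l _ g _ Lc) (is_lim_seq_scal_l _ h
    _ Ls))).
  apply is_lim_seq_unique in LX. apply is_lim_seq_unique in L. rewrite LX in L. simpl in L. injection L; auto. }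
assert (UY : / m * (h * c - g * s) = 0).
{ assert (L := is_lim_seq_mult' _ _ _ _ Lrho' (is_lim_seq_minus' _ _ _ _ (is_lim_seq_scal_l _ h _ Lc) (is_lim_seq_scal_l _ g
    _ Ls))).
  apply is_lim_seq_unique in LY. apply is_lim_seq_unique in L. rewrite LY in L. simpl in L. injection L; auto. }
assert (SC := sin2_cos2 (vartheta t)). unfold Rsqr in SC. fold c s in SC.
assert (UX' : g * c + h * s = m). { apply Rmult_eq_reg_l with (/ m); [|apply Rgt_not_eq, Rinv_0_lt_compat; auto]. rewrite
  UX. field; lra. }
assert (UY' : h * c - g * s = 0). { apply Rmult_eq_reg_l with (/ m); [|apply Rgt_not_eq, Rinv_0_lt_compat; auto]. rewrite
  UY. ring. }
exists m. split; auto. rewrite <- UX'. split.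
- replace ((g * c + h * s) * c) with (g * (s * s + c * c) + s * (h * c - g * s)) by ring. rewrite SC, UY'. ring.
- replace ((g * c + h * s) * s) with (h * (s * s + c * c) - c * (h * c - g * s)) by ring. rewrite SC, UY'. ring.
Qed.

(** * The completed zeta function *)

(** An error function, normalised to tend to 1/2 at infinity. *)
Definition Qg (z : R) : R := RInt (gs 1) 0 z.

Lemma gs1_cont : cont (gs 1).
Proof. apply dec_cont, gs_dec; lra. Qed.

Lemma Qg_derive z : is_derive Qg z (gs 1 z).
Proof.
apply (is_derive_RInt (gs 1) Qg 0 z); [|apply gs1_cont].
exists (mkposreal 1 Rlt_0_1). intros y _. apply (RInt_correct (V := R_CompleteNormedModule)). apply cont_ex_RInt, gs1_cont.
Qed.

Lemma Qg_cont : cont Qg.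
Proof. apply cont_derivable; intros; eexists; apply Qg_derive. Qed.

Lemma Qg_diff x y : Qg y - Qg x = RInt (gs 1) x y.
Proof. unfold Qg. rewrite <- (RInt_Chasles_R (gs 1) 0 x y) by apply gs1_cont. ring. Qed.

Lemma gs_decreasing a x y : 0 <= x <= y -> gs a y <= gs a x.
Proof.
intros H. unfold gs. apply exp_le. assert (HP := PI_RGT_0).
assert (x ^ 2 <= y ^ 2) by nra. assert (0 <= a ^ 2) by apply pow2_ge_0.
assert (0 <= PI * a ^ 2) by nra. nra.
Qed.

Lemma Qg_diff_bounds x y : 0 <= x <= y -> (y - x) * gs 1 y <= Qg y - Qg x <= (y - x) * gs 1 x.
Proof.
intros H. rewrite Qg_diff, <- !RInt_const_R.
split; apply RInt_le; try lra; try (apply cont_ex_RInt; auto using cont_const, gs1_cont); intros; apply gs_decreasing; lra.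
Qed.

Lemma Qg_0 : Qg 0 = 0.
Proof. unfold Qg. rewrite RInt_point. reflexivity. Qed.

Lemma Qg_odd x : RInt (gs 1) (- x) x = 2 * Qg x.
Proof.
rewrite <- (RInt_Chasles_R (gs 1) (- x) 0 x) by apply gs1_cont.
assert (E := RInt_comp_opp_R (gs 1) 0 x gs1_cont). rewrite Ropp_0 in E.
rewrite <- E. rewrite (RInt_ext _ (gs 1)). unfold Qg; toR; ring.
intros u _. unfold gs. toR. do 2 f_equal. ring.
Qed.

Lemma Qg_lim eps : 0 < eps -> exists X, forall x, X <= x -> Rabs (Qg x - 1 / 2) < eps.
Proof.
intros He. destruct (IR_correct (gs 1) (gs_dec 1 ltac:(lra)) (2 * eps) ltac:(lra)) as [X HX].
exists X. intros x Hx. specialize (HX (- x) x ltac:(lra) ltac:(lra)).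
rewrite Qg_odd, IR_gs, Rinv_1 in HX by lra.
replace (2 * Qg x - 1) with (2 * (Qg x - 1 / 2)) in HX by field.
rewrite Rabs_mult, (Rabs_pos_eq 2) in HX by lra. lra.
Qed.

Lemma Qg_le x : 0 <= x -> 0 <= Qg x <= Rmin x 1.
Proof.
intros Hx. assert (A := Qg_diff_bounds 0 x ltac:(lra)). rewrite Qg_0, !Rminus_0_r in A.
assert (G1 : 0 < gs 1 x) by apply exp_pos. assert (G0 : gs 1 0 = 1).
{ unfold gs. rewrite <- exp_0. f_equal; ring. }
split; [nra|]. apply Rmin_glb; [nra|].
destruct (Qg_lim (1 / 2) ltac:(lra)) as [X HX].
specialize (HX (Rmax x X) (Rmax_r _ _)). apply Rabs_def2 in HX.
assert (B := Qg_diff_bounds x (Rmax x X) ltac:(split; auto; apply Rmax_l)).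
assert (0 < gs 1 (Rmax x X)) by apply exp_pos. assert (x <= Rmax x X) by apply Rmax_l.
assert (0 <= (Rmax x X - x) * gs 1 (Rmax x X)) by nra. lra.
Qed.

(* At x = e^u this is sqrt x * (sum_{n >= 1} e^(- pi n^2 x^2) - 1/(2x)); subtracting 1/(2x) continues the Mellin transform of theta to 0 < Re s < 1. *)
Definition phi (u : R) : R := exp (u / 2) * (theta (exp u) - 1) / 2 - exp (- u / 2) / 2.

(** A partial sum of the series in [phi], and in [phitail] the corresponding integral of the
    Gaussian over [0, N]. Their transforms are gamma times the two terms of the Euler-Maclaurin
    approximation to zeta. *)
Definition phisum (N : nat) (u : R) : R := exp (u / 2) * (esum (gs (exp u)) N - 1) / 2.
Definition phitail (N : nat) (u : R) : R := exp (- u / 2) * Qg (INR N * exp u).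

(** This is theta inversion. Evenness makes the transform of [phi] real, which is the functional
    equation of zeta on the critical line. *)
Lemma phi_even u : phi (- u) = phi u.
Proof.
unfold phi. rewrite (theta_fe (exp (- u))) by apply exp_pos.
rewrite <- exp_Ropp, Ropp_involutive.
assert (E : exp (- u / 2) * exp u = exp (u / 2)) by (rewrite <- exp_plus; f_equal; field).
replace (exp (- u / 2) * (exp u * theta (exp u) - 1)) with (exp (- u / 2) * exp u * theta (exp u) - exp (- u / 2)) by ring.
rewrite E. replace (- - u / 2) with (u / 2) by field. field.
Qed.

(** A term of the theta series is, up to n^(-1/2), the Gamma kernel translated by ln n, so that its
    transform is gamma(s) n^(-s). *)
Lemma gs_shift n u : exp (u / 2) * gs (exp u) (INR (S n)) = / sqrt (INR (S n)) * Gk (1 / 2) (u + ln (INR (S n))).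
Proof.
assert (HN : 0 < INR (S n)) by (apply lt_0_INR; lia).
assert (Hs : 0 < sqrt (INR (S n))) by (apply sqrt_lt_R0; auto).
assert (E : sqrt (INR (S n)) = exp (ln (INR (S n)) / 2)).
{ rewrite <- (sqrt_square (exp (ln (INR (S n)) / 2))) by (left; apply exp_pos). f_equal.
  rewrite <- exp_plus. replace (ln (INR (S n)) / 2 + ln (INR (S n)) / 2) with (ln (INR (S n))) by field.
  rewrite exp_ln; auto. }
rewrite E, <- exp_Ropp. unfold gs, Gk. rewrite <- !exp_plus. f_equal.
replace (2 * (u + ln (INR (S n)))) with (u + u + (ln (INR (S n)) + ln (INR (S n)))) by ring.
rewrite !exp_plus, exp_ln by auto. field.
Qed.

Lemma Gk_half_le_1 v : Gk (1 / 2) v <= 1.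
Proof.
apply Rle_trans with (exp 0); [apply exp_le | rewrite exp_0; lra].
assert (HP := PI2_3_2). assert (E := exp_pos (2 * v)). assert (E1 := exp_ineq1_le (2 * v)).
assert (exp (2 * v) <= PI * exp (2 * v)) by nra. lra.
Qed.

(** Since the Gaussian decreases, sum and integral differ over [m, m + 1] by at most the drop of the
    integrand; the drops telescope and leave the value at N. As the bound integrates to O(N^(-1/2)),
    the transforms converge too, which gives zeta on the critical line. *)
Lemma phi_approx N u : (1 <= N)%nat ->
  Rabs (phi u - (phisum N u - phitail N u)) <= / sqrt (INR N) * Gk (1 / 2) (u + ln (INR N)).
Proof.
intros HN. destruct N as [|N]; [lia|]. rewrite <- gs_shift. revert HN. generalize (S N) as n. clear N. intros n Hn.
set (a := exp u). assert (Ha : 0 < a) by apply exp_pos.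
assert (gs1a : forall x, gs 1 (x * a) = gs a x).
{ intros x. unfold gs. do 2 f_equal. ring. }
assert (Ea : exp (- u / 2) * a = exp (u / 2)) by (unfold a; rewrite <- exp_plus; f_equal; field).
destruct (lim_seq_telescoping (fun n => phisum n u - phitail n u) (fun n => exp (u / 2) * gs a (INR n)) 0) as [l [Hl Hb]].
- intros m _. unfold phisum, phitail. fold a.
  change (esum (gs a) (S m)) with (esum (gs a) m + 2 * gs a (INR (S m))).
  assert (B := Qg_diff_bounds (INR m * a) (INR (S m) * a)). rewrite !gs1a in B.
  rewrite S_INR in *. assert (Hm := pos_INR m). specialize (B ltac:(nra)).
  replace ((INR m + 1) * a - INR m * a) with a in B by ring.
  assert (P := exp_pos (- u / 2)).
  set (q1 := Qg ((INR m + 1) * a)) in *. set (q0 := Qg (INR m * a)) in *.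
  replace (exp (u / 2) * (esum (gs a) m + 2 * gs a (INR m + 1) - 1) / 2 - exp (- u / 2) * q1 -
     (exp (u / 2) * (esum (gs a) m - 1) / 2 - exp (- u / 2) * q0))
    with (exp (u / 2) * gs a (INR m + 1) - exp (- u / 2) * (q1 - q0)) by field.
  rewrite <- Ea. apply Rabs_le.
  assert (exp (- u / 2) * (a * gs a (INR m + 1)) <= exp (- u / 2) * (q1 - q0)) by (apply Rmult_le_compat_l; lra).
  assert (exp (- u / 2) * (q1 - q0) <= exp (- u / 2) * (a * gs a (INR m))) by (apply Rmult_le_compat_l; lra).
  assert (gs a (INR m + 1) <= gs a (INR m)) by (apply gs_decreasing; lra).
  assert (0 < exp (- u / 2) * a) by (apply Rmult_lt_0_compat; auto). split; nra.
- replace (Finite 0) with (Rbar_mult (exp (u / 2)) 0) by (simpl; f_equal; ring).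
  apply is_lim_seq_scal_l.
  destruct (gs_bound a Ha) as [K [HK H]].
  apply is_lim_seq_le_le with (fun _ => 0) (fun n => K * (1 / 2) ^ n).
  + intros m. split; [left; apply exp_pos|]. eapply Rle_trans; [apply H|].
    apply Rmult_le_compat_l; [lra|]. eapply Rle_trans; [|apply exp_INR_le]. apply exp_le.
    rewrite Rabs_pos_eq by apply pos_INR. generalize (pos_INR m); lra.
  + apply is_lim_seq_const.
  + replace (Finite 0) with (Rbar_mult K 0) by (simpl; f_equal; ring).
    apply is_lim_seq_scal_l. apply is_lim_seq_geom. rewrite Rabs_pos_eq; lra.
- assert (El : l = phi u).
  { assert (L : is_lim_seq (fun n => phisum n u - phitail n u) (phi u)).
    { unfold phi. replace (exp (- u / 2) / 2) with (exp (- u / 2) * (1 / 2)) by field.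
      apply is_lim_seq_minus'.
      - unfold phisum. fold a.
        apply is_lim_seq_ext with (fun n => exp (u / 2) / 2 * (esum (gs a) n - 1)); [intros; field|].
        replace (exp (u / 2) * (theta a - 1) / 2) with (exp (u / 2) / 2 * (theta a - 1)) by field.
        apply (is_lim_seq_scal_l _ (exp (u / 2) / 2) (theta a - 1)).
        apply is_lim_seq_minus'; [apply theta_lim; auto | apply is_lim_seq_const].
      - apply (is_lim_seq_scal_l (fun n => Qg (INR n * a)) (exp (- u / 2)) (1 / 2)).
        apply is_lim_seq_spec. intros eps. destruct (Qg_lim eps (cond_pos eps)) as [X HX].
        destruct (nfloor_ex (Rabs X / a)) as [N0 [_ HN0]]; [apply Rdiv_le_0_compat; auto using Rabs_pos|].
        exists (S N0). intros m Hm. apply le_INR in Hm. rewrite S_INR in Hm. apply HX.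
        apply Rle_trans with (Rabs X); [apply Rle_abs|].
        replace (Rabs X) with (Rabs X / a * a) by (field; lra). apply Rmult_le_compat_r; lra. }
    apply is_lim_seq_unique in L. apply is_lim_seq_unique in Hl. rewrite L in Hl. injection Hl; auto. }
  rewrite <- El, Rabs_minus_sym. apply Hb. lia.
Qed.

Lemma phitail_dec N : dec (phitail N).
Proof.
assert (C : cont (phitail N)).
{ unfold phitail. apply (cont_mult (fun u => exp (- u / 2)) (fun u => Qg (INR N * exp u))).
  - apply cont_derivable; intros; auto_derive; auto.
  - apply (cont_comp Qg (fun u => INR N * exp u)); auto using Qg_cont.
    apply cont_derivable; intros; auto_derive; auto. }
split; auto. exists (INR N + 1), (1 / 2). split; [lra|]. intros u. assert (HN := pos_INR N).
unfold phitail. assert (P := exp_pos u).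
destruct (Qg_le (INR N * exp u) ltac:(nra)) as [A B].
assert (B1 := Rle_trans _ _ _ B (Rmin_l _ _)). assert (B2 := Rle_trans _ _ _ B (Rmin_r _ _)).
assert (P2 := exp_pos (- u / 2)). assert (P3 := exp_pos (- (1 / 2) * Rabs u)).
rewrite Rabs_pos_eq by nra.
destruct (Rle_dec 0 u) as [H|H].
- rewrite Rabs_pos_eq in * by auto. replace (- (1 / 2) * u) with (- u / 2) in * by field. nra.
- rewrite Rabs_left in * by lra. replace (- (1 / 2) * - u) with (- u / 2 + u) in * by field.
  rewrite exp_plus. nra.
Qed.

Lemma phisum_0 u : phisum 0 u = 0.
Proof. unfold phisum, esum, gs. replace (- (PI * exp u ^ 2 * 0 ^ 2)) with 0 by ring. rewrite exp_0. field. Qed.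

Lemma phisum_S N u : phisum (S N) u = phisum N u + / sqrt (INR (S N)) * Gk (1 / 2) (u + ln (INR (S N))).
Proof.
rewrite <- gs_shift. unfold phisum.
change (esum (gs (exp u)) (S N)) with (esum (gs (exp u)) N + 2 * gs (exp u) (INR (S N))). field.
Qed.

Lemma Gk_half_dec : dec (Gk (1 / 2)).
Proof. apply Gk_dec; lra. Qed.

Lemma phisum_dec N : dec (phisum N).
Proof.
induction N.
- rewrite (functional_extensionality _ _ phisum_0). assert (D := dec_scal 0 _ Gk_half_dec). cbv beta in D.
  replace (fun _ : R => 0) with (fun u => 0 * Gk (1 / 2) u); auto. apply functional_extensionality; intros; ring.
- rewrite (functional_extensionality _ _ (phisum_S N)). apply dec_plus; auto.
  apply dec_scal, dec_shift, Gk_half_dec.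
Qed.

(** Continuity comes from uniform convergence: [Gk (1/2)] <= 1 turns [phi_approx] into an error of
    at most N^(-1/2). Decay comes from [phi_approx] at N = 1. *)
Lemma phi_dec : dec phi.
Proof.
assert (C : cont phi).
{ intros u0. apply (proj1 (continuity_pt_filterlim phi u0)). intros eps He.
  destruct (nfloor_ex ((3 / eps) ^ 2)) as [n [_ Hn]]; [apply pow2_ge_0|].
  set (N := S n). assert (HN : 1 <= INR N) by (apply (le_INR 1); unfold N; lia).
  assert (Hb : forall u, Rabs (phi u - (phisum N u - phitail N u)) < eps / 3).
  { intros u. eapply Rle_lt_trans; [apply phi_approx; unfold N; lia|].
    assert (Hs : 3 / eps < sqrt (INR N)).
    { rewrite <- (sqrt_pow2 (3 / eps)) by (apply Rdiv_le_0_compat; lra).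
      apply sqrt_lt_1_alt. split; [apply pow2_ge_0|]. unfold N; rewrite S_INR. auto. }
    assert (Hs0 : 0 < 3 / eps) by (apply Rdiv_lt_0_compat; lra).
    apply Rle_lt_trans with (/ sqrt (INR N) * 1).
    { apply Rmult_le_compat_l; [left; apply Rinv_0_lt_compat; lra | apply Gk_half_le_1]. }
    rewrite Rmult_1_r. replace (eps / 3) with (/ (3 / eps)) by (field; lra).
    apply Rinv_lt_contravar; auto. apply Rmult_lt_0_compat; lra. }
  assert (CN : cont (fun u => phisum N u - phitail N u)).
  { apply dec_cont, dec_minus; auto using phisum_dec, phitail_dec. }
  assert (CN0 : continuity_pt (fun u => phisum N u - phitail N u) u0) by (apply continuity_pt_filterlim, CN).
  destruct (CN0 (eps / 3) ltac:(lra)) as [d [Hd HH]]. exists d; split; auto. intros x Hx.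
  specialize (HH x Hx). unfold dist, R_met, R_dist in HH |- *. simpl in HH |- *. unfold R_dist in *.
  assert (H1 := Hb x). assert (H2 := Hb u0).
  set (px := phi x) in *. set (p0 := phi u0) in *.
  set (fx := phisum N x - phitail N x) in *. set (f0 := phisum N u0 - phitail N u0) in *.
  replace (px - p0) with ((px - fx) + ((fx - f0) - (p0 - f0))) by ring.
  eapply Rle_lt_trans; [apply Rabs_triang|].
  assert (Rabs (fx - f0 - (p0 - f0)) <= Rabs (fx - f0) + Rabs (p0 - f0)).
  { unfold Rminus at 1. eapply Rle_trans; [apply Rabs_triang|]. rewrite Rabs_Ropp. lra. }
  lra. }
assert (D1 : dec (fun u => phisum 1 u - phitail 1 u)) by (apply dec_minus; auto using phisum_dec, phitail_dec).
apply dec_dom with (fun u => Rabs (phisum 1 u - phitail 1 u) + Gk (1 / 2) u) 1; auto; try lra.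
- apply dec_plus; [apply (dec_abs _ D1)|apply Gk_half_dec].
- intros u. assert (A := phi_approx 1 u ltac:(lia)). simpl INR in A.
  rewrite sqrt_1, Rinv_1, ln_1, Rplus_0_r, Rmult_1_l in A.
  rewrite Rmult_1_l, (Rabs_pos_eq (_ + _)).
  2:{ generalize (Rabs_pos (phisum 1 u - phitail 1 u)), (Gk_pos (1 / 2) u); lra. }
  set (f := phisum 1 u - phitail 1 u) in *. replace (phi u) with (phi u - f + f) by ring.
  eapply Rle_trans; [apply Rabs_triang|]. lra.
Qed.

Definition Xi (t : R) : R := IR (fun u => phi u * cos (t * u)).

Lemma phi_sin t : IR (fun u => phi u * sin (t * u)) = 0.
Proof.
apply IR_odd; [apply dec_sin, phi_dec|]. intros u. rewrite phi_even.
replace (t * - u) with (- (t * u)) by ring. rewrite sin_neg. ring.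
Qed.

Fixpoint zs_re (t : R) (N : nat) : R :=
  match N with O => 0 | S n => zs_re t n + / sqrt (INR (S n)) * cos (t * ln (INR (S n))) end.
Fixpoint zs_im (t : R) (N : nat) : R :=
  match N with O => 0 | S n => zs_im t n - / sqrt (INR (S n)) * sin (t * ln (INR (S n))) end.

(* N^(1-s) / (1-s) at s = 1/2 + it *)
Definition zt_re (t x : R) : R := sqrt x * (cos (t * ln x) / 2 + t * sin (t * ln x)) / (1 / 4 + t ^ 2).
Definition zt_im (t x : R) : R := sqrt x * (t * cos (t * ln x) - sin (t * ln x) / 2) / (1 / 4 + t ^ 2).

Definition em_re (t : R) (N : nat) : R := zs_re t N - zt_re t (INR N).
Definition em_im (t : R) (N : nat) : R := zs_im t N - zt_im t (INR N).

(** Translation by c multiplies gamma(1/2 + it) by e^(- i t c); c = ln n produces n^(-it). *)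
Lemma gamma_shift t c :
  IR (fun u => Gk (1 / 2) (u + c) * cos (t * u)) = gc (1 / 2) t * cos (t * c) + gsn (1 / 2) t * sin (t * c) /\
  IR (fun u => Gk (1 / 2) (u + c) * sin (t * u)) = gsn (1 / 2) t * cos (t * c) - gc (1 / 2) t * sin (t * c).
Proof.
assert (D := Gk_half_dec). assert (Dc := dec_cos _ t D). assert (Ds := dec_sin _ t D).
split.
- set (F := fun v => cos (t * c) * (Gk (1 / 2) v * cos (t * v)) + sin (t * c) * (Gk (1 / 2) v * sin (t * v))).
  rewrite (IR_ext _ (fun u => F (u + c))).
  + rewrite (IR_shift F c) by (unfold F; dec_lin). unfold F. rewrite IR_plus, !IR_scal by dec_lin. unfold gc, gsn. ring.
  + intros u. unfold F. replace (t * u) with (t * (u + c) - t * c) by ring. rewrite cos_minus. ring.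
- set (F := fun v => cos (t * c) * (Gk (1 / 2) v * sin (t * v)) - sin (t * c) * (Gk (1 / 2) v * cos (t * v))).
  rewrite (IR_ext _ (fun u => F (u + c))).
  + rewrite (IR_shift F c) by (unfold F; dec_lin). unfold F. rewrite IR_minus, !IR_scal by dec_lin. unfold gc, gsn. ring.
  + intros u. unfold F. replace (t * u) with (t * (u + c) - t * c) by ring. rewrite sin_minus. ring.
Qed.

Lemma phisum_FT t N :
  IR (fun u => phisum N u * cos (t * u)) = gc (1 / 2) t * zs_re t N - gsn (1 / 2) t * zs_im t N /\
  IR (fun u => phisum N u * sin (t * u)) = gc (1 / 2) t * zs_im t N + gsn (1 / 2) t * zs_re t N.
Proof.
induction N as [|N [I1 I2]].
- assert (D := dec_cos _ t Gk_half_dec).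
  split; rewrite (IR_ext _ (fun u => 0 * (Gk (1 / 2) u * cos (t * u)))) by (intros; rewrite phisum_0; ring);
   rewrite IR_scal by auto; simpl; ring.
- destruct (gamma_shift t (ln (INR (S N)))) as [G1 G2].
  assert (D := dec_shift _ (ln (INR (S N))) Gk_half_dec).
  assert (Dc := dec_cos _ t D). assert (Ds := dec_sin _ t D).
  assert (D' := phisum_dec N). assert (Dc' := dec_cos _ t D'). assert (Ds' := dec_sin _ t D').
  change (zs_re t (S N)) with (zs_re t N + / sqrt (INR (S N)) * cos (t * ln (INR (S N)))).
  change (zs_im t (S N)) with (zs_im t N - / sqrt (INR (S N)) * sin (t * ln (INR (S N)))).
  split.
  + rewrite (IR_ext _ (fun u => phisum N u * cos (t * u) + / sqrt (INR (S N)) * (Gk (1 / 2) (u + ln (INR (S N))) * cos (t * u)))).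
    * rewrite IR_plus, IR_scal, I1, G1 by (auto using dec_scal). ring.
    * intros u. rewrite phisum_S. ring.
  + rewrite (IR_ext _ (fun u => phisum N u * sin (t * u) + / sqrt (INR (S N)) * (Gk (1 / 2) (u + ln (INR (S N))) * sin (t * u)))).
    * rewrite IR_plus, IR_scal, I2, G2 by (auto using dec_scal). ring.
    * intros u. rewrite phisum_S. ring.
Qed.

Lemma phitail_derive N u : (1 <= N)%nat ->
  is_derive (phitail N) u (- / 2 * phitail N u + sqrt (INR N) * Gk (1 / 2) (u + ln (INR N))).
Proof.
intros HN. assert (HN' : 0 < INR N) by (apply lt_0_INR; lia).
assert (E : sqrt (INR N) * Gk (1 / 2) (u + ln (INR N)) = exp (- u / 2) * (INR N * exp u * gs 1 (INR N * exp u))).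
{ destruct N as [|n]; [lia|]. set (N := S n) in *.
  assert (A := gs_shift n u). fold N in A.
  assert (Hs : 0 < sqrt (INR N)) by (apply sqrt_lt_R0; auto).
  replace (Gk (1 / 2) (u + ln (INR N))) with (sqrt (INR N) * (exp (u / 2) * gs (exp u) (INR N))) by (rewrite A; field; lra).
  replace (exp (u / 2)) with (exp (- u / 2) * exp u) by (rewrite <- exp_plus; f_equal; field).
  replace (gs 1 (INR N * exp u)) with (gs (exp u) (INR N)) by (unfold gs; do 2 f_equal; ring).
  rewrite <- Rmult_assoc, sqrt_sqrt by lra. ring. }
rewrite E. unfold phitail.
replace (- / 2 * (exp (- u / 2) * Qg (INR N * exp u)) + exp (- u / 2) * (INR N * exp u * gs 1 (INR N * exp u)))
 with ((- / 2 * exp (- u / 2)) * Qg (INR N * exp u) + exp (- u / 2) * (INR N * exp u * gs 1 (INR N * exp u))) by ring.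
apply (is_derive_mult (fun u => exp (- u / 2)) (fun u => Qg (INR N * exp u))).
- auto_derive; auto. toR. unfold Rdiv. ring.
- apply (is_derive_comp Qg (fun u => INR N * exp u) u (gs 1 (INR N * exp u)) (INR N * exp u)).
  apply Qg_derive. auto_derive; auto. ring.
- intros; apply Rmult_comm.
Qed.

(** [phitail] solves a first-order equation whose source is a translate of [Gk (1/2)]. Integrating
    its products with cosine and sine determines (1/2 - it) times the transform, whence the division
    by 1 - s in [zt_re] and [zt_im]. *)
Lemma phitail_FT t N : (1 <= N)%nat ->
  IR (fun u => phitail N u * cos (t * u)) = gc (1 / 2) t * zt_re t (INR N) - gsn (1 / 2) t * zt_im t (INR N) /\
  IR (fun u => phitail N u * sin (t * u)) = gc (1 / 2) t * zt_im t (INR N) + gsn (1 / 2) t * zt_re t (INR N).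
Proof.
intros HN. destruct (gamma_shift t (ln (INR N))) as [G1 G2].
assert (D := dec_shift _ (ln (INR N)) Gk_half_dec).
assert (Dc := dec_cos _ t D). assert (Ds := dec_sin _ t D).
assert (D' := phitail_dec N). assert (Dc' := dec_cos _ t D'). assert (Ds' := dec_sin _ t D').
cbv beta in Dc, Ds.
assert (Z1 : IR (fun u => sqrt (INR N) * (Gk (1 / 2) (u + ln (INR N)) * cos (t * u)) - / 2 * (phitail N u * cos (t * u)) - t
  * (phitail N u * sin (t * u))) = 0).
{ apply IR_FTC with (fun u => phitail N u * cos (t * u)); auto; [|dec_lin]. intros u.
  replace (sqrt (INR N) * (Gk (1 / 2) (u + ln (INR N)) * cos (t * u)) - / 2 * (phitail N u * cos (t * u)) - t * (phitail N u
    * sin (t * u)))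
   with ((- / 2 * phitail N u + sqrt (INR N) * Gk (1 / 2) (u + ln (INR N))) * cos (t * u) + phitail N u * (- (t * sin (t *
     u)))) by ring.
  apply (is_derive_mult (phitail N) (fun u => cos (t * u))); [apply phitail_derive; auto | auto_derive; auto; ring | intros;
    apply Rmult_comm]. }
assert (Z2 : IR (fun u => sqrt (INR N) * (Gk (1 / 2) (u + ln (INR N)) * sin (t * u)) - / 2 * (phitail N u * sin (t * u)) + t
  * (phitail N u * cos (t * u))) = 0).
{ apply IR_FTC with (fun u => phitail N u * sin (t * u)); auto; [|dec_lin]. intros u.
  replace (sqrt (INR N) * (Gk (1 / 2) (u + ln (INR N)) * sin (t * u)) - / 2 * (phitail N u * sin (t * u)) + t * (phitail N u
    * cos (t * u)))
   with ((- / 2 * phitail N u + sqrt (INR N) * Gk (1 / 2) (u + ln (INR N))) * sin (t * u) + phitail N u * (t * cos (t * u)))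
     by ring.
  apply (is_derive_mult (phitail N) (fun u => sin (t * u))); [apply phitail_derive; auto | auto_derive; auto; ring | intros;
    apply Rmult_comm]. }
rewrite !IR_minus, !IR_scal in Z1 by dec_lin.
rewrite IR_plus, IR_minus, !IR_scal in Z2 by dec_lin.
rewrite G1 in Z1. rewrite G2 in Z2. unfold zt_re, zt_im.
set (Pc := IR (fun u => phitail N u * cos (t * u))) in *. set (Ps := IR (fun u => phitail N u * sin (t * u))) in *.
set (c := cos (t * ln (INR N))) in *. set (s := sin (t * ln (INR N))) in *.
set (g := gc (1 / 2) t) in *. set (h := gsn (1 / 2) t) in *. set (w := sqrt (INR N)) in *.
assert (Hd : 1 / 4 + t ^ 2 <> 0) by (generalize (pow2_ge_0 t); lra).
split; apply Rmult_eq_reg_l with (1 / 4 + t ^ 2); auto.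
- transitivity (/ 2 * (w * (g * c + h * s)) - t * (w * (h * c - g * s))).
  + replace (w * (g * c + h * s)) with (/ 2 * Pc + t * Ps) by lra.
    replace (w * (h * c - g * s)) with (/ 2 * Ps - t * Pc) by lra. field.
  + field. lra.
- transitivity (/ 2 * (w * (h * c - g * s)) + t * (w * (g * c + h * s))).
  + replace (w * (g * c + h * s)) with (/ 2 * Pc + t * Ps) by lra.
    replace (w * (h * c - g * s)) with (/ 2 * Ps - t * Pc) by lra. field.
  + field. lra.
Qed.

Definition gmod (t : R) : R := sqrt (gc (1 / 2) t ^ 2 + gsn (1 / 2) t ^ 2).

Lemma gmod_phase t : 0 < gmod t /\ gc (1 / 2) t = gmod t * cos (vartheta t) /\ gsn (1 / 2) t = gmod t * sin (vartheta t).
Proof.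
destruct (gamma_phase t) as [r [Hr [A B]]].
assert (E : gmod t = r).
{ unfold gmod. rewrite A, B.
  replace ((r * cos (vartheta t)) ^ 2 + (r * sin (vartheta t)) ^ 2) with (r ^ 2 * (Rsqr (sin (vartheta t)) + Rsqr (cos
    (vartheta t)))) by (unfold Rsqr; ring).
  rewrite sin2_cos2, Rmult_1_r. apply sqrt_pow2; lra. }
rewrite E; auto.
Qed.

(** Multiplied by gamma(1/2 + it), the approximation is the transform of [phisum] minus [phitail],
    which tends to that of [phi], whose sine part vanishes by evenness. Division by gamma = gmod
    e^(i vartheta) leaves the real number Xi / gmod times e^(- i vartheta). *)
Lemma em_lim t :
  is_lim_seq (em_re t) (Xi t / gmod t * cos (vartheta t)) /\
  is_lim_seq (em_im t) (- (Xi t / gmod t * sin (vartheta t))).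
Proof.
destruct (gmod_phase t) as [Hm [Ec Es]].
set (g := gc (1 / 2) t) in *. set (h := gsn (1 / 2) t) in *.
assert (Dphi := phi_dec). assert (Dpc := dec_cos _ t Dphi). assert (Dps := dec_sin _ t Dphi).
assert (Bd : forall N, (1 <= N)%nat -> Rabs (g * em_re t N - h * em_im t N - Xi t) <= / sqrt (INR N) * IR (Gk (1 / 2)) /\
   Rabs (g * em_im t N + h * em_re t N) <= / sqrt (INR N) * IR (Gk (1 / 2))).
{ intros N HN. destruct (phisum_FT t N) as [A1 A2]. destruct (phitail_FT t N HN) as [B1 B2].
  fold g h in A1, A2, B1, B2.
  assert (D1 := phisum_dec N). assert (D2 := phitail_dec N).
  assert (C1 := dec_cos _ t D1). assert (C2 := dec_sin _ t D1). assert (C3 := dec_cos _ t D2). assert (C4 := dec_sin _ t D2).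
  assert (DS := dec_scal (/ sqrt (INR N)) _ (dec_shift _ (ln (INR N)) Gk_half_dec)). cbv beta in DS.
  assert (EI : IR (fun u => / sqrt (INR N) * Gk (1 / 2) (u + ln (INR N))) = / sqrt (INR N) * IR (Gk (1 / 2))).
  { rewrite IR_scal by apply (dec_shift _ (ln (INR N)) Gk_half_dec). rewrite (IR_shift (Gk (1 / 2))) by apply Gk_half_dec.
      reflexivity. }
  unfold em_re, em_im. rewrite <- EI. split.
  - replace (g * (zs_re t N - zt_re t (INR N)) - h * (zs_im t N - zt_im t (INR N)) - Xi t)
      with ((IR (fun u => phisum N u * cos (t * u)) - IR (fun u => phitail N u * cos (t * u))) - Xi t) by (rewrite A1, B1; ring).
    unfold Xi. rewrite <- !IR_minus by dec_lin. apply IR_abs; auto; [dec_lin|]. intros u.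
    replace (phisum N u * cos (t * u) - phitail N u * cos (t * u) - phi u * cos (t * u))
      with (- ((phi u - (phisum N u - phitail N u)) * cos (t * u))) by ring.
    rewrite Rabs_Ropp, Rabs_mult. eapply Rle_trans; [|apply phi_approx; auto].
    assert (Rabs (cos (t * u)) <= 1) by (apply Rabs_le; generalize (COS_bound (t * u)); lra).
    assert (P := Rabs_pos (phi u - (phisum N u - phitail N u))). nra.
  - replace (g * (zs_im t N - zt_im t (INR N)) + h * (zs_re t N - zt_re t (INR N)))
      with ((IR (fun u => phisum N u * sin (t * u)) - IR (fun u => phitail N u * sin (t * u))) - IR (fun u => phi u * sin (t
        * u))) by (rewrite A2, B2, phi_sin; ring).
    rewrite <- !IR_minus by dec_lin. apply IR_abs; auto; [dec_lin|]. intros u.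
    replace (phisum N u * sin (t * u) - phitail N u * sin (t * u) - phi u * sin (t * u))
      with (- ((phi u - (phisum N u - phitail N u)) * sin (t * u))) by ring.
    rewrite Rabs_Ropp, Rabs_mult. eapply Rle_trans; [|apply phi_approx; auto].
    assert (Rabs (sin (t * u)) <= 1) by (apply Rabs_le; generalize (SIN_bound (t * u)); lra).
    assert (P := Rabs_pos (phi u - (phisum N u - phitail N u))). nra. }
assert (Lb : is_lim_seq (fun n => / sqrt (INR n) * IR (Gk (1 / 2))) 0).
{ replace (Finite 0) with (Rbar_mult 0 (IR (Gk (1 / 2)))) by (simpl; f_equal; ring).
  apply is_lim_seq_scal_r. apply (is_lim_seq_inv (fun n => sqrt (INR n)) p_infty).
  - apply (filterlim_comp _ _ _ INR sqrt _ (Rbar_locally p_infty)); [apply is_lim_seq_INR | apply filterlim_sqrt_p].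
  - discriminate. }
assert (L1 : is_lim_seq (fun N => g * em_re t N - h * em_im t N) (Xi t)).
{ apply is_lim_seq_spec. intros eps. apply is_lim_seq_spec in Lb. destruct (Lb eps) as [N HN].
  exists (max 1 N). intros n Hn. specialize (HN n ltac:(lia)). rewrite Rminus_0_r in HN.
  destruct (Bd n ltac:(lia)) as [A _]. eapply Rle_lt_trans; [apply A|]. apply Rle_lt_trans with (2 := HN), Rle_abs. }
assert (L2 : is_lim_seq (fun N => g * em_im t N + h * em_re t N) 0).
{ apply is_lim_seq_spec. intros eps. apply is_lim_seq_spec in Lb. destruct (Lb eps) as [N HN].
  exists (max 1 N). intros n Hn. specialize (HN n ltac:(lia)). rewrite Rminus_0_r in HN.
  destruct (Bd n ltac:(lia)) as [_ A]. rewrite Rminus_0_r. eapply Rle_lt_trans; [apply A|]. apply Rle_lt_trans with (2 :=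
    HN), Rle_abs. }
set (c := cos (vartheta t)) in *. set (s := sin (vartheta t)) in *.
assert (SC : s * s + c * c = 1) by apply (sin2_cos2 (vartheta t)).
split.
- replace (Xi t / gmod t * c) with (c / gmod t * Xi t + s / gmod t * 0) by (field; lra).
  eapply is_lim_seq_ext; [|apply (is_lim_seq_plus' _ _ _ _ (is_lim_seq_scal_l _ (c / gmod t) _ L1) (is_lim_seq_scal_l _ (s /
    gmod t) _ L2))].
  intros N. cbv beta. rewrite Ec, Es.
  transitivity (em_re t N * (s * s + c * c)); [field; lra | rewrite SC; ring].
- replace (- (Xi t / gmod t * s)) with (c / gmod t * 0 - s / gmod t * Xi t) by (field; lra).
  eapply is_lim_seq_ext; [|apply (is_lim_seq_minus' _ _ _ _ (is_lim_seq_scal_l _ (c / gmod t) _ L2) (is_lim_seq_scal_l _ (s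
    / gmod t) _ L1))].
  intros N. cbv beta. rewrite Ec, Es.
  transitivity (em_im t N * (s * s + c * c)); [field; lra | rewrite SC; ring].
Qed.

(** * The eta series and Z = Xi / gmod *)

Lemma is_lim_seq_even_odd (u : nat -> R) (l : R) :
  is_lim_seq (fun n => u (2 * n)%nat) l -> is_lim_seq (fun n => u (2 * n + 1)%nat) l -> is_lim_seq u l.
Proof.
intros H1 H2. apply is_lim_seq_spec. intros eps.
apply is_lim_seq_spec in H1. apply is_lim_seq_spec in H2.
destruct (H1 eps) as [N1 A1]. destruct (H2 eps) as [N2 A2].
exists (2 * N1 + 2 * N2 + 2)%nat. intros n Hn.
destruct (Nat.Even_or_Odd n) as [[m E]|[m E]]; rewrite E.
- apply A1; lia.
- apply A2; lia.
Qed.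

Definition zterm_re (t x : R) : R := / sqrt x * cos (t * ln x).
Definition zterm_im (t x : R) : R := - (/ sqrt x * sin (t * ln x)).

Fixpoint altsum (f : R -> R) (n : nat) : R :=
  match n with O => 0 | S m => altsum f m + (-1) ^ m * f (INR (S m)) end.

Lemma altsum_S f m : altsum f (S m) = altsum f m + (-1) ^ m * f (INR (S m)).
Proof. reflexivity. Qed.

(** An alternating sum is the full sum h minus twice the even terms, which g accumulates. *)
Lemma altsum_double f g h n : (forall m, 2 * f (2 * INR (S m)) = g (S m) - g m) -> g 0%nat = 0 ->
  (forall m, h (S m) = h m + f (INR (S m))) -> h 0%nat = 0 ->
  altsum f (2 * n) = h (2 * n)%nat - g n.
Proof.
intros Hf Hg Hh H0. induction n.
- change (2 * 0)%nat with 0%nat. rewrite Hg, H0. simpl. ring.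
- replace (2 * S n)%nat with (S (S (2 * n))) by lia. rewrite !Hh, !altsum_S, IHn.
  assert (E : (-1) ^ S (2 * n) = -1) by (rewrite <- tech_pow_Rmult, pow_1_even; ring).
  rewrite E, pow_1_even. specialize (Hf n).
  replace (INR (S (S (2 * n)))) with (2 * INR (S n)) by (rewrite !S_INR, mult_INR; simpl; ring).
  lra.
Qed.

Lemma altsum_sum f n : sum_f_R0 (fun k => (-1) ^ k * f (INR (S k))) n = altsum f (S n).
Proof.
induction n; [simpl; ring|]. rewrite tech5, IHn. reflexivity.
Qed.

Lemma inv_sqrt_double x : 0 < x -> 2 * / sqrt (2 * x) = sqrt 2 * / sqrt x.
Proof.
intros Hx. assert (0 < sqrt 2) by (apply sqrt_lt_R0; lra). assert (0 < sqrt x) by (apply sqrt_lt_R0; auto).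
rewrite sqrt_mult by lra.
transitivity (sqrt 2 * sqrt 2 * / (sqrt 2 * sqrt x)); [rewrite sqrt_sqrt by lra; reflexivity|]. field. split; apply
  Rgt_not_eq; auto.
Qed.

Lemma zterm_double t x : 0 < x ->
  2 * zterm_re t (2 * x) = (1 - den_re t) * zterm_re t x + den_im t * zterm_im t x /\
  2 * zterm_im t (2 * x) = (1 - den_re t) * zterm_im t x - den_im t * zterm_re t x.
Proof.
intros Hx. unfold zterm_re, zterm_im, den_re, den_im.
rewrite ln_mult, Rmult_plus_distr_l, cos_plus, sin_plus by lra.
assert (E := inv_sqrt_double x Hx). split.
- rewrite <- Rmult_assoc, E. ring.
- replace (2 * - (/ sqrt (2 * x) * (sin (t * ln 2) * cos (t * ln x) + cos (t * ln 2) * sin (t * ln x))))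
   with (- ((2 * / sqrt (2 * x)) * (sin (t * ln 2) * cos (t * ln x) + cos (t * ln 2) * sin (t * ln x)))) by ring.
  rewrite E. ring.
Qed.

Lemma zt_double t x : 0 < x ->
  zt_re t (2 * x) = (1 - den_re t) * zt_re t x + den_im t * zt_im t x /\
  zt_im t (2 * x) = (1 - den_re t) * zt_im t x - den_im t * zt_re t x.
Proof.
intros Hx. unfold zt_re, zt_im, den_re, den_im. assert (Hd : 1 / 4 + t ^ 2 <> 0) by (generalize (pow2_ge_0 t); lra).
rewrite ln_mult, sqrt_mult by lra.
replace (t * (ln 2 + ln x)) with (t * ln 2 + t * ln x) by ring. rewrite cos_plus, sin_plus.
split; field; lra.
Qed.

Lemma zs_re_S t n : zs_re t (S n) = zs_re t n + zterm_re t (INR (S n)).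
Proof. reflexivity. Qed.
Lemma zs_im_S t n : zs_im t (S n) = zs_im t n + zterm_im t (INR (S n)).
Proof. reflexivity. Qed.

Lemma zterm_bound t n : Rabs (zterm_re t (INR (S n))) <= / sqrt (INR (S n)) /\ Rabs (zterm_im t (INR (S n))) <= / sqrt (INR
  (S n)).
Proof.
assert (H : 0 < / sqrt (INR (S n))) by (apply Rinv_0_lt_compat, sqrt_lt_R0, lt_0_INR; lia).
unfold zterm_re, zterm_im. rewrite Rabs_Ropp, !Rabs_mult, !(Rabs_pos_eq (/ _)) by lra.
split; rewrite <- (Rmult_1_r (/ sqrt _)) at 2; apply Rmult_le_compat_l; try lra; apply Rabs_le.
- generalize (COS_bound (t * ln (INR (S n)))); lra.
- generalize (SIN_bound (t * ln (INR (S n)))); lra.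
Qed.

Lemma is_lim_seq_double u (l : R) : is_lim_seq u l -> is_lim_seq (fun n => u (2 * n)%nat) l.
Proof.
intros H. apply (is_lim_seq_subseq u l (fun n => (2 * n)%nat)); auto.
apply eventually_subseq. intros n; lia.
Qed.

Lemma altsum_lim f (l : R) : (forall n, Rabs (f (INR (S n))) <= / sqrt (INR (S n))) ->
  is_lim_seq (fun n => altsum f (2 * n)) l -> is_lim_seq (fun n => altsum f (S n)) l.
Proof.
intros Hf H. apply (is_lim_seq_incr_1 (altsum f)). apply is_lim_seq_even_odd; auto.
rewrite <- (Rplus_0_r l).
apply is_lim_seq_ext with (fun n => altsum f (2 * n) + f (INR (S (2 * n)))).
{ intros n. replace (2 * n + 1)%nat with (S (2 * n)) by lia. rewrite altsum_S, pow_1_even. ring. }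
apply is_lim_seq_plus'; auto.
assert (Lb : is_lim_seq (fun n => / sqrt (INR n)) 0).
{ apply (is_lim_seq_inv (fun n => sqrt (INR n)) p_infty).
  - apply (filterlim_comp _ _ _ INR sqrt _ (Rbar_locally p_infty)); [apply is_lim_seq_INR | apply filterlim_sqrt_p].
  - discriminate. }
apply is_lim_seq_spec. intros eps. apply is_lim_seq_spec in Lb. destruct (Lb eps) as [N HN].
exists N. intros n Hn. specialize (HN (S (2 * n)) ltac:(lia)). rewrite Rminus_0_r in *.
eapply Rle_lt_trans; [apply Hf|]. apply Rle_lt_trans with (2 := HN), Rle_abs.
Qed.

Lemma den_pos t : 0 < den_re t ^ 2 + den_im t ^ 2.
Proof.
unfold den_re, den_im. set (A := t * ln 2).
replace ((1 - sqrt 2 * cos A) ^ 2 + (sqrt 2 * sin A) ^ 2)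
  with (1 - 2 * sqrt 2 * cos A + sqrt 2 * sqrt 2 * (Rsqr (sin A) + Rsqr (cos A))) by (unfold Rsqr; ring).
rewrite sqrt_sqrt, sin2_cos2 by lra.
assert (B := COS_bound A). assert (S2 := sqrt_sqrt 2 ltac:(lra)).
assert (P : 0 < sqrt 2) by (apply sqrt_lt_R0; lra). assert (sqrt 2 < 3 / 2) by nra. nra.
Qed.

(** Let em denote the Euler-Maclaurin approximation. The alternating sum of 2n terms is em(2n) -
    2^(1-s) em(n): the corrections N^(1-s) / (1-s) cancel exactly, as (2n)^(1-s) = 2^(1-s) n^(1-s).
    Hence eta = (1 - 2^(1-s)) lim em, and zeta, defined by division, is lim em. *)
Lemma eta_zeta t zr zi : is_lim_seq (em_re t) zr -> is_lim_seq (em_im t) zi ->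
  forall (r i : R), zr = Finite r -> zi = Finite i -> zeta_re t = r /\ zeta_im t = i.
Proof.
intros Hr Hi r i -> ->.
set (dr := den_re t). set (di := den_im t).
assert (Hpos : forall n, 0 < INR (S n)) by (intros; apply lt_0_INR; lia).
assert (Er : eta_re t = dr * r - di * i).
{ apply lim_seq_eq. apply is_lim_seq_ext with (fun n => altsum (zterm_re t) (S n)).
  { intros n. rewrite <- altsum_sum. apply sum_eq. intros k _. unfold zterm_re, Rdiv. ring. }
  apply altsum_lim; [intros; apply zterm_bound|].
  replace (dr * r - di * i) with (r - ((1 - dr) * r + di * i)) by ring.
  assert (L := is_lim_seq_minus' _ _ _ _ (is_lim_seq_double _ _ Hr) (is_lim_seq_plus' _ _ _ _ (is_lim_seq_scal_l _ (1 - dr)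
    _ Hr) (is_lim_seq_scal_l _ di _ Hi))).
  apply is_lim_seq_incr_1 in L. apply (is_lim_seq_incr_1 (fun n => altsum (zterm_re t) (2 * n))).
  eapply is_lim_seq_ext; [|apply L]. intros n. cbv beta.
  rewrite (altsum_double (zterm_re t) (fun m => (1 - dr) * zs_re t m + di * zs_im t m) (zs_re t)); try (simpl; ring); try
    reflexivity.
  - unfold em_re, em_im. rewrite mult_INR. simpl (INR 2). replace (1 + 1) with 2 by ring.
    destruct (zt_double t (INR (S n)) (Hpos n)) as [-> _]. fold dr di. ring.
  - intros m. destruct (zterm_double t (INR (S m)) (Hpos m)) as [-> _]. rewrite zs_re_S, zs_im_S. fold dr di. ring. }
assert (Ei : eta_im t = dr * i + di * r).
{ apply lim_seq_eq. apply is_lim_seq_ext with (fun n => altsum (zterm_im t) (S n)).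
  { intros n. rewrite <- altsum_sum. apply sum_eq. intros k _. unfold zterm_im, Rdiv. ring. }
  apply altsum_lim; [intros; apply zterm_bound|].
  replace (dr * i + di * r) with (i - ((1 - dr) * i - di * r)) by ring.
  assert (L := is_lim_seq_minus' _ _ _ _ (is_lim_seq_double _ _ Hi) (is_lim_seq_minus' _ _ _ _ (is_lim_seq_scal_l _ (1 - dr)
    _ Hi) (is_lim_seq_scal_l _ di _ Hr))).
  apply is_lim_seq_incr_1 in L. apply (is_lim_seq_incr_1 (fun n => altsum (zterm_im t) (2 * n))).
  eapply is_lim_seq_ext; [|apply L]. intros n. cbv beta.
  rewrite (altsum_double (zterm_im t) (fun m => (1 - dr) * zs_im t m - di * zs_re t m) (zs_im t)); try (simpl; ring); try
    reflexivity.
  - unfold em_re, em_im. rewrite mult_INR. simpl (INR 2). replace (1 + 1) with 2 by ring.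
    destruct (zt_double t (INR (S n)) (Hpos n)) as [_ ->]. fold dr di. ring.
  - intros m. destruct (zterm_double t (INR (S m)) (Hpos m)) as [_ ->]. rewrite zs_re_S, zs_im_S. fold dr di. ring. }
unfold zeta_re, zeta_im. rewrite Er, Ei. assert (D := den_pos t). fold dr di in D |- *.
split; field; lra.
Qed.

Lemma zeta_lim t : is_lim_seq (em_re t) (zeta_re t) /\ is_lim_seq (em_im t) (zeta_im t).
Proof.
destruct (em_lim t) as [A B]. destruct (eta_zeta t _ _ A B _ _ eq_refl eq_refl) as [-> ->]. auto.
Qed.

Lemma Zfun_polar t : Zfun t = Xi t / gmod t /\
  zeta_re t = Zfun t * cos (vartheta t) /\ zeta_im t = - (Zfun t * sin (vartheta t)).
Proof.
destruct (em_lim t) as [A B]. destruct (eta_zeta t _ _ A B _ _ eq_refl eq_refl) as [Er Ei].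
assert (E : Zfun t = Xi t / gmod t).
{ unfold Zfun. rewrite Er, Ei.
  transitivity (Xi t / gmod t * (Rsqr (sin (vartheta t)) + Rsqr (cos (vartheta t)))); [unfold Rsqr; ring|].
  rewrite sin2_cos2. ring. }
rewrite E, Er, Ei. auto.
Qed.

(** * Analyticity and zeros of odd order *)

(** Nested witnesses instead of iterated [Derive] make closure under products and inverse square
    roots a plain induction. *)
Fixpoint Ck (n : nat) (f : R -> R) : Prop :=
  match n with
  | O => True
  | S m => exists f', (forall x, is_derive f x (f' x)) /\ Ck m f'
  end.

Lemma Ck_pred n f : Ck (S n) f -> Ck n f.
Proof.
revert f; induction n; intros f H; [exact I|].
destruct H as [f' [H1 H2]]. exists f'; split; auto.
Qed.

Lemma Ck_plus n f g : Ck n f -> Ck n g -> Ck n (fun x => f x + g x).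
Proof.
revert f g; induction n; intros f g Hf Hg; [exact I|].
destruct Hf as [f' [F1 F2]], Hg as [g' [G1 G2]].
exists (fun x => f' x + g' x). split; [|apply IHn; auto].
intros x. apply (is_derive_plus f g); auto.
Qed.

Lemma Ck_mult n f g : Ck n f -> Ck n g -> Ck n (fun x => f x * g x).
Proof.
revert f g; induction n; intros f g Hf Hg; [exact I|].
assert (Pf := Ck_pred _ _ Hf). assert (Pg := Ck_pred _ _ Hg).
destruct Hf as [f' [F1 F2]], Hg as [g' [G1 G2]].
exists (fun x => f' x * g x + f x * g' x). split.
- intros x. apply (is_derive_mult f g); auto. intros; apply Rmult_comm.
- apply Ck_plus; apply IHn; auto.
Qed.

Lemma Ck_const n k : Ck n (fun _ => k).
Proof.
revert k; induction n; intros k; [exact I|]. exists (fun _ => 0). split; auto.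
intros x. apply (is_derive_const k x).
Qed.

Lemma Ck_inv_sqrt n g : (forall x, 0 < g x) -> Ck n g -> Ck n (fun x => / sqrt (g x)).
Proof.
intros Hg. revert n. induction n; intros H; [exact I|].
assert (P := IHn (Ck_pred _ _ H)). destruct H as [g' [G1 G2]].
exists (fun x => (-1 / 2 * g' x) * (/ sqrt (g x) * (/ sqrt (g x) * / sqrt (g x)))). split.
- intros x. assert (Hs : 0 < sqrt (g x)) by (apply sqrt_lt_R0; auto).
  replace (-1 / 2 * g' x * (/ sqrt (g x) * (/ sqrt (g x) * / sqrt (g x))))
    with (- (g' x / (2 * sqrt (g x))) / (sqrt (g x)) ^ 2) by (field; lra).
  apply (is_derive_inv (fun x => sqrt (g x))); [|lra].
  apply is_derive_sqrt; auto.
- apply Ck_mult; [apply (Ck_mult n (fun _ => -1 / 2)); auto using Ck_const|].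
  apply Ck_mult; auto. apply Ck_mult; auto.
Qed.

Definition smooth (f : R -> R) : Prop := forall n, Ck n f.

Lemma deriv_seq_Ck f D : deriv_seq f D -> smooth f.
Proof.
intros [<- H] n. generalize 0%nat. induction n; intros j; [exact I|].
exists (D (S j)). split; auto. intros x. apply is_derive_Reals, H.
Qed.

Lemma smooth_Derive f : smooth f -> (forall x, is_derive f x (Derive f x)) /\ smooth (Derive f).
Proof.
intros H. destruct (H 1%nat) as [f' [H1 _]].
assert (E : f' = Derive f) by (apply functional_extensionality; intros x; symmetry; apply is_derive_unique, H1).
subst f'. split; auto. intros n. destruct (H (S n)) as [g [G1 G2]].
replace (Derive f) with g; auto. apply functional_extensionality; intros x; symmetry; apply is_derive_unique, G1.
Qed.

Lemma smooth_deriv_seq f : smooth f -> exists D, deriv_seq f D.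
Proof.
intros H. set (D := fix D n := match n with O => f | S m => Derive (D m) end).
assert (S : forall n, smooth (D n)).
{ induction n; auto. apply smooth_Derive; auto. }
exists D. split; [reflexivity|]. intros n x. apply is_derive_Reals. apply (smooth_Derive _ (S n)).
Qed.

Lemma deriv_seq_unique f D E : deriv_seq f D -> deriv_seq f E -> forall n x, D n x = E n x.
Proof.
intros [D0 HD] [E0 HE]. assert (A : forall n, D n = E n).
{ induction n; [congruence|]. apply functional_extensionality; intros x.
  apply (uniqueness_limite (D n) x); auto. rewrite IHn. auto. }
intros; rewrite A; auto.
Qed.

(* For derivative sequences D and E, [prodD D E n i j] is the n-th derivative of [D i * E j]. *)
Fixpoint prodD (D E : nat -> R -> R) (n i j : nat) (x : R) : R :=
  match n with
  | O => D i x * E j x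
  | S m => prodD D E m (S i) j x + prodD D E m i (S j) x
  end.

Lemma prodD_derive D E f g n i j x : deriv_seq f D -> deriv_seq g E ->
  derivable_pt_lim (prodD D E n i j) x (prodD D E (S n) i j x).
Proof.
intros [_ HD] [_ HE]. revert i j; induction n; intros i j.
- simpl. replace (D (S i) x * E j x + D i x * E (S j) x) with (D (S i) x * E j x + D i x * E (S j) x) by ring.
  apply (derivable_pt_lim_mult (D i) (E j)); auto.
- change (prodD D E (S (S n)) i j x) with (prodD D E (S n) (S i) j x + prodD D E (S n) i (S j) x).
  apply (derivable_pt_lim_plus (prodD D E n (S i) j) (prodD D E n i (S j))); auto.
Qed.

Lemma prodD_deriv_seq D E f g : deriv_seq f D -> deriv_seq g E ->
  deriv_seq (fun x => f x * g x) (fun n => prodD D E n 0 0).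
Proof.
intros HD HE. split.
- apply functional_extensionality; intros x. simpl. rewrite (proj1 HD), (proj1 HE). reflexivity.
- intros n x. eapply prodD_derive; eauto.
Qed.

Lemma prodD_flat D E n i j c : (forall k, D k c = 0) -> prodD D E n i j c = 0.
Proof.
intros H. revert i j; induction n; intros i j; simpl; [rewrite H; ring|]. rewrite !IHn; ring.
Qed.

(** One C and one r serve at every point: analyticity in a strip of fixed width, which permits
    continuation along the line in steps of one length. *)
Definition analytic (f : R -> R) : Prop := exists D C r, 0 < r /\ deriv_seq f D /\
  forall n x, Rabs (D n x) <= C * INR (fact n) / r ^ n.

Lemma FT_analytic G p : dec G -> analytic (FT G p).
Proof.
intros H. destruct (FTD_bound G p H) as [C [r [Hr B]]].
exists (FTD G p), C, r. split; auto. split; auto. apply FTD_deriv_seq; auto.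
Qed.

Lemma bound_radius_le C r r' n : 0 <= C -> 0 < r' <= r -> C * INR (fact n) / r ^ n <= C * INR (fact n) / r' ^ n.
Proof.
intros HC H. apply Rmult_le_compat_l.
- apply Rmult_le_pos; auto. left; apply INR_fact_lt_0.
- apply Rinv_le_contravar; [apply pow_lt; lra|]. apply pow_incr; lra.
Qed.

Lemma analytic_const_nonneg C r (D : nat -> R -> R) : 0 < r -> (forall n x, Rabs (D n x) <= C * INR (fact n) / r ^ n) -> 0 <= C.
Proof.
intros Hr H. specialize (H 0%nat 0). simpl in H. rewrite Rdiv_1_r, Rmult_1_r in H.
generalize (Rabs_pos (D 0%nat 0)); lra.
Qed.

Lemma fact_mult_le i j : (fact i * fact j <= fact (i + j))%nat.
Proof.
induction i; simpl; [lia|].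
assert (A := lt_O_fact j). assert (B := lt_O_fact i). nia.
Qed.

(** Leibniz' rule without binomial coefficients: the n-th derivative is a sum of 2^n products
    [D i * E j] with i + j = n, each at most C C2 n! / q^n because i! j! <= (i + j)!. The factor 2^n
    halves the radius. *)
Lemma analytic_mult f g : analytic f -> analytic g -> analytic (fun x => f x * g x).
Proof.
intros [D [C [r [Hr [HD HC]]]]] [E [C2 [r2 [Hr2 [HE HC2]]]]].
assert (P1 := analytic_const_nonneg _ _ _ Hr HC). assert (P2 := analytic_const_nonneg _ _ _ Hr2 HC2).
set (q := Rmin r r2). assert (Hq : 0 < q) by (apply Rmin_glb_lt; auto).
exists (fun n => prodD D E n 0 0), (C * C2), (q / 2). split; [lra|]. split; [eapply prodD_deriv_seq; eauto|].
assert (B : forall n i j x, Rabs (prodD D E n i j x) <= C * C2 * 2 ^ n * INR (fact (n + i + j)) / q ^ (n + i + j)).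
{ induction n; intros i j x.
  - simpl. rewrite Rabs_mult.
    assert (A1 := Rle_trans _ _ _ (HC i x) (bound_radius_le C r q i P1 (conj Hq (Rmin_l _ _)))).
    assert (A2 := Rle_trans _ _ _ (HC2 j x) (bound_radius_le C2 r2 q j P2 (conj Hq (Rmin_r _ _)))).
    eapply Rle_trans; [apply Rmult_le_compat; [apply Rabs_pos | apply Rabs_pos | apply A1 | apply A2]|].
    rewrite pow_add. assert (Q1 : 0 < q ^ i) by (apply pow_lt; auto). assert (Q2 : 0 < q ^ j) by (apply pow_lt; auto).
    replace (C * INR (fact i) / q ^ i * (C2 * INR (fact j) / q ^ j)) with (C * C2 * (INR (fact i) * INR (fact j)) / (q ^ i *
      q ^ j)) by (field; lra).
    rewrite Rmult_1_r. apply Rmult_le_compat_r; [left; apply Rinv_0_lt_compat, Rmult_lt_0_compat; auto|].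
    apply Rmult_le_compat_l; [apply Rmult_le_pos; auto|]. rewrite <- mult_INR. apply le_INR, fact_mult_le.
  - simpl prodD. eapply Rle_trans; [apply Rabs_triang|].
    assert (A1 := IHn (S i) j x). assert (A2 := IHn i (S j) x).
    replace (n + S i + j)%nat with (S n + i + j)%nat in A1 by lia.
    replace (n + i + S j)%nat with (S n + i + j)%nat in A2 by lia.
    simpl (2 ^ S n). unfold Rdiv in *. lra. }
intros n x. eapply Rle_trans; [apply B|]. rewrite !Nat.add_0_r.
right. unfold Rdiv. rewrite Rpow_mult_distr, pow_inv. field. split; apply pow_nonzero; lra.
Qed.

Lemma analytic_comb f g a : analytic f -> analytic g -> analytic (fun x => f x + a * g x).
Proof.
intros [D [C [r [Hr [HD HC]]]]] [E [C2 [r2 [Hr2 [HE HC2]]]]].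
assert (P1 := analytic_const_nonneg _ _ _ Hr HC). assert (P2 := analytic_const_nonneg _ _ _ Hr2 HC2).
set (q := Rmin r r2). assert (Hq : 0 < q) by (apply Rmin_glb_lt; auto).
exists (fun n x => D n x + a * E n x), (C + Rabs a * C2), q. split; auto. split.
- destruct HD as [D0 HD], HE as [E0 HE]. split; [rewrite D0, E0; auto|]. intros n x.
  apply (derivable_pt_lim_plus (D n) (fun x => a * E n x)); auto. apply (derivable_pt_lim_scal (E n)); auto.
- intros n x. eapply Rle_trans; [apply Rabs_triang|]. rewrite Rabs_mult.
  assert (A1 := Rle_trans _ _ _ (HC n x) (bound_radius_le C r q n P1 (conj Hq (Rmin_l _ _)))).
  assert (A2 := Rle_trans _ _ _ (HC2 n x) (bound_radius_le C2 r2 q n P2 (conj Hq (Rmin_r _ _)))).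
  assert (A3 := Rmult_le_compat_l _ _ _ (Rabs_pos a) A2). unfold Rdiv in *. nra.
Qed.

Lemma deriv_seq_Derive_n f D : deriv_seq f D -> forall n x, ex_derive_n f n x /\ Derive_n f n x = D n x.
Proof.
intros [<- H]. assert (A : forall n, Derive_n (D 0%nat) n = D n).
{ induction n; [reflexivity|]. apply functional_extensionality; intros x. simpl. rewrite IHn.
  apply is_derive_unique, is_derive_Reals, H. }
intros n x. rewrite A. split; auto. destruct n; simpl; auto. rewrite A. eexists; apply is_derive_Reals, H.
Qed.

Lemma flat_zero_right f D C r c x : 0 < r -> deriv_seq f D ->
  (forall n x, Rabs (D n x) <= C * INR (fact n) / r ^ n) -> (forall n, D n c = 0) ->
  c < x < c + r -> f x = 0.
Proof.
intros Hr HD HC Hc Hx. assert (P1 := analytic_const_nonneg _ _ _ Hr HC).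
assert (HDn := deriv_seq_Derive_n f D HD).
set (w := (x - c) / r).
assert (Hw : 0 < w < 1).
{ unfold w. split; [apply Rdiv_lt_0_compat; lra|]. apply Rmult_lt_reg_r with r; auto.
  unfold Rdiv; rewrite Rmult_assoc, Rinv_l; lra. }
assert (B : forall n, Rabs (f x) <= C * w ^ S n).
{ intros n. destruct (Taylor_Lagrange f n c x ltac:(lra)) as [z [Hz E]].
  { intros t _ k _. apply HDn. }
  rewrite E. rewrite (proj2 (HDn (S n) z)).
  rewrite (sum_eq _ (fun _ => 0)), sum_cte, Rmult_0_l, Rplus_0_l.
  2:{ intros i _. rewrite (proj2 (HDn i c)), Hc. ring. }
  assert (F := INR_fact_lt_0 (S n)).
  rewrite Rabs_mult. unfold Rdiv. rewrite Rabs_mult, (Rabs_pos_eq (/ _)) by (left; apply Rinv_0_lt_compat; auto).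
  rewrite (Rabs_pos_eq ((x - c) ^ S n)) by (apply pow_le; lra).
  assert (P : 0 < (x - c) ^ S n) by (apply pow_lt; lra).
  assert (Q : 0 < r ^ S n) by (apply pow_lt; lra).
  apply Rle_trans with ((x - c) ^ S n * / INR (fact (S n)) * (C * INR (fact (S n)) / r ^ S n)).
  - apply Rmult_le_compat_l; [|apply HC]. left; apply Rmult_lt_0_compat; auto. apply Rinv_0_lt_compat; auto.
  - right. unfold w, Rdiv. rewrite Rpow_mult_distr, pow_inv. field. split; lra. }
assert (L : is_lim_seq (fun n => C * w ^ S n) 0).
{ replace (Finite 0) with (Rbar_mult C 0) by (simpl; f_equal; ring). apply is_lim_seq_scal_l.
  apply (is_lim_seq_incr_1 (fun n => w ^ n)). apply is_lim_seq_geom. rewrite Rabs_pos_eq; lra. }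
assert (Z : Rabs (f x) <= 0).
{ change (Rbar_le (Rabs (f x)) 0). exact (is_lim_seq_le _ _ _ _ B (is_lim_seq_const _) L). }
destruct (Req_dec (f x) 0) as [|N]; auto. apply Rabs_pos_lt in N. lra.
Qed.

Lemma flat_zero_near f D C r c x : 0 < r -> deriv_seq f D ->
  (forall n x, Rabs (D n x) <= C * INR (fact n) / r ^ n) -> (forall n, D n c = 0) ->
  Rabs (x - c) < r -> f x = 0.
Proof.
intros Hr HD HC Hc Hx. apply Rabs_def2 in Hx.
destruct (Rtotal_order x c) as [L|[->|L]].
- replace (f x) with ((fun y => f (- y)) (- x)) by (cbv beta; f_equal; ring).
  apply (flat_zero_right (fun y => f (- y)) (fun n y => (-1) ^ n * D n (- y)) C r (- c)); auto; try lra.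
  + destruct HD as [D0 HD]. split.
    * apply functional_extensionality; intros y. rewrite D0. simpl; ring.
    * intros n y. simpl. replace (-1 * (-1) ^ n * D (S n) (- y)) with ((-1) ^ n * (D (S n) (- y) * -1)) by ring.
      apply (derivable_pt_lim_scal (fun y => D n (- y))).
      apply (derivable_pt_lim_comp (fun y => - y) (D n)); auto.
      apply is_derive_Reals. auto_derive; auto.
  + intros n y. rewrite Rabs_mult, pow_1_abs, Rmult_1_l. apply HC.
  + intros n. rewrite Ropp_involutive, Hc. ring.
- rewrite <- (Hc 0%nat), (proj1 HD). reflexivity.
- apply (flat_zero_right f D C r c); auto; lra.
Qed.

Lemma zero_near_flat f D c d : 0 < d -> deriv_seq f D -> (forall x, Rabs (x - c) < d -> f x = 0) ->
  forall n x, Rabs (x - c) < d -> D n x = 0.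
Proof.
intros Hd [<- HD] Hz n. induction n; auto. intros x Hx.
apply (uniqueness_limite (D n) x); auto.
apply is_derive_Reals. apply (is_derive_ext_loc (fun _ => 0)).
- assert (H : 0 < d - Rabs (x - c)) by lra. exists (mkposreal _ H). intros y Hy.
  unfold ball in Hy; simpl in Hy; unfold AbsRing_ball in Hy; simpl in Hy. unfold abs, minus, plus, opp in Hy; simpl in Hy.
  symmetry; apply IHn. replace (y - c) with ((y - x) + (x - c)) by ring.
  eapply Rle_lt_trans; [apply Rabs_triang|]. unfold Rminus in *. lra.
- apply (is_derive_const 0 x).
Qed.

(** The Taylor remainder forces f to vanish within r of a flat point. The point c is joined to x by
    N + 1 steps shorter than r, and each endpoint is flat again. *)
Lemma analytic_flat_zero f D c : analytic f -> deriv_seq f D -> (forall n, D n c = 0) -> forall x, f x = 0.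
Proof.
intros [E [C [r [Hr [HE HC]]]]] HD Hc x.
assert (Hc' : forall n, E n c = 0) by (intros; rewrite <- (deriv_seq_unique _ _ _ HD HE); auto).
destruct (nfloor_ex (Rabs (x - c) / r)) as [N [_ HN]]; [apply Rdiv_le_0_compat; auto using Rabs_pos|].
set (d := (x - c) / (INR N + 1)). assert (PN := pos_INR N).
assert (Hd : Rabs d < r).
{ unfold d, Rdiv. rewrite Rabs_mult, (Rabs_pos_eq (/ _)) by (left; apply Rinv_0_lt_compat; lra).
  apply Rmult_lt_reg_r with (INR N + 1); [lra|]. rewrite Rmult_assoc, Rinv_l, Rmult_1_r by lra.
  apply Rmult_lt_reg_r with (/ r); [apply Rinv_0_lt_compat; auto|].
  replace (r * (INR N + 1) * / r) with (INR N + 1) by (field; lra). exact HN. }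
assert (A : forall k n, E n (c + INR k * d) = 0).
{ induction k; intros n.
  - simpl. rewrite Rmult_0_l, Rplus_0_r. auto.
  - apply (zero_near_flat f E (c + INR k * d) r); auto.
    + intros y Hy. apply (flat_zero_near f E C r (c + INR k * d)); auto.
    + rewrite S_INR. replace (c + (INR k + 1) * d - (c + INR k * d)) with d by ring. auto. }
specialize (A (S N) 0%nat). rewrite (proj1 HE), S_INR in A.
replace x with (c + (INR N + 1) * d); auto. unfold d. field. lra.
Qed.

(** * Smoothness of Z and the order of the zeros of its derivative *)

Lemma Xi_FT : Xi = FT phi 0.
Proof. apply functional_extensionality; intros t. unfold Xi, FT. apply IR_ext; intros u. rewrite Rplus_0_r; auto. Qed.

Lemma gc_FT : gc (1 / 2) = FT (Gk (1 / 2)) 0.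
Proof. apply functional_extensionality; intros t. unfold gc, FT. apply IR_ext; intros u. rewrite Rplus_0_r; auto. Qed.

Lemma gsn_FT : gsn (1 / 2) = FT (Gk (1 / 2)) (- (PI / 2)).
Proof.
apply functional_extensionality; intros t. unfold gsn, FT. apply IR_ext; intros u.
f_equal. rewrite <- (cos_neg (t * u + _)). replace (- (t * u + - (PI / 2))) with (PI / 2 - t * u) by ring.
rewrite cos_shift; auto.
Qed.

Definition gsq (t : R) : R := gc (1 / 2) t * gc (1 / 2) t + gsn (1 / 2) t * gsn (1 / 2) t.

Lemma gsq_pos t : 0 < gsq t.
Proof.
destruct (gmod_phase t) as [H _]. unfold gmod in H.
replace (gc (1 / 2) t ^ 2 + gsn (1 / 2) t ^ 2) with (gsq t) in H by (unfold gsq; ring).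
destruct (Rlt_dec 0 (gsq t)); auto. rewrite sqrt_neg_0 in H; lra.
Qed.

Lemma Zfun_eq t : Zfun t = Xi t * / sqrt (gsq t).
Proof.
destruct (Zfun_polar t) as [-> _]. unfold gmod.
replace (gc (1 / 2) t ^ 2 + gsn (1 / 2) t ^ 2) with (gsq t) by (unfold gsq; ring). reflexivity.
Qed.

Lemma analytic_smooth f : analytic f -> smooth f.
Proof. intros [D [C [r [_ [H _]]]]]. eapply deriv_seq_Ck; eauto. Qed.

Lemma Xi_analytic : analytic Xi.
Proof. rewrite Xi_FT. apply FT_analytic, phi_dec. Qed.

Lemma gsq_analytic : analytic gsq.
Proof.
assert (H1 : analytic (gc (1 / 2))) by (rewrite gc_FT; apply FT_analytic, Gk_half_dec).
assert (H2 : analytic (gsn (1 / 2))) by (rewrite gsn_FT; apply FT_analytic, Gk_half_dec).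
replace gsq with (fun t => gc (1 / 2) t * gc (1 / 2) t + 1 * (gsn (1 / 2) t * gsn (1 / 2) t)).
- apply (analytic_comb (fun t => gc (1 / 2) t * gc (1 / 2) t)); apply analytic_mult; auto.
- apply functional_extensionality; intros; unfold gsq; ring.
Qed.

Lemma Zfun_smooth : smooth Zfun.
Proof.
rewrite (functional_extensionality _ _ Zfun_eq). intros n. apply Ck_mult.
- apply analytic_smooth, Xi_analytic.
- apply Ck_inv_sqrt; [apply gsq_pos|]. apply analytic_smooth, gsq_analytic.
Qed.

(** Only smoothness of Z = Xi / sqrt(gsq) is available. If Z' were flat at c, with K = Z(c), then (Z
    - K)(Z + K) gsq = Xi^2 - K^2 gsq would be flat at c; being analytic it would vanish, so Z^2 =
    K^2 everywhere. Differentiation at x, where Z' is not 0, gives Z(x) = 0, hence K = 0 and Z = 0,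
    which is absurd. *)
Lemma Zfun_deriv_not_flat D x c : deriv_seq Zfun D -> D 1%nat x <> 0 -> exists m, D (S m) c <> 0.
Proof.
intros HD Hx. destruct (classic (exists m, D (S m) c <> 0)) as [|N]; auto. exfalso.
assert (Hc : forall m, D (S m) c = 0).
{ intros m. destruct (Req_dec (D (S m) c) 0); auto. exfalso; apply N; eauto. }
set (K := Zfun c).
set (D1 := fun n => match n with O => (fun x => Zfun x - K) | S m => D (S m) end).
assert (HD1 : deriv_seq (fun x => Zfun x - K) D1).
{ destruct HD as [D0 HD]. split; auto. intros [|n] y; simpl; [|apply HD].
  rewrite <- (Rminus_0_r (D 1%nat y)).
  apply (derivable_pt_lim_minus Zfun (fun _ => K)); [rewrite <- D0; apply HD | apply derivable_pt_lim_const]. }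
assert (S2 : smooth (fun x => (Zfun x + K) * gsq x)).
{ intros n. apply Ck_mult; [apply Ck_plus; [apply Zfun_smooth | apply Ck_const] | apply analytic_smooth, gsq_analytic]. }
destruct (smooth_deriv_seq _ S2) as [E HE].
assert (HP := prodD_deriv_seq _ _ _ _ HD1 HE).
assert (EF : forall y, (Zfun y - K) * ((Zfun y + K) * gsq y) = Xi y * Xi y + (- K ^ 2) * gsq y).
{ intros y. rewrite Zfun_eq. assert (P := gsq_pos y). assert (Hs : 0 < sqrt (gsq y)) by (apply sqrt_lt_R0; auto).
  rewrite <- (sqrt_sqrt (gsq y)) at 3 4 by lra. field. lra. }
cbv beta in HP. rewrite (functional_extensionality _ _ EF) in HP.
assert (AF : analytic (fun y => Xi y * Xi y + (- K ^ 2) * gsq y)).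
{ apply (analytic_comb (fun y => Xi y * Xi y)); [apply analytic_mult; apply Xi_analytic | apply gsq_analytic]. }
assert (Z : forall y, (Zfun y - K) * ((Zfun y + K) * gsq y) = 0).
{ intros y. rewrite EF. apply (analytic_flat_zero _ _ c AF HP). intros n. apply prodD_flat.
  intros [|k]; simpl; auto. unfold K; ring. }
assert (Z2 : forall y, Zfun y * Zfun y = K * K).
{ intros y. assert (P := gsq_pos y). apply Rmult_eq_reg_r with (gsq y); [|lra]. specialize (Z y). lra. }
assert (Dz : derivable_pt_lim Zfun x (D 1%nat x)) by (destruct HD as [<- HD]; apply HD).
assert (Dsq := derivable_pt_lim_mult _ _ _ _ _ Dz Dz).
assert (Dk : derivable_pt_lim (Zfun * Zfun)%F x 0).
{ replace (Zfun * Zfun)%F with (fun _ : R => K * K) by (apply functional_extensionality; intros; symmetry; apply Z2).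
  apply derivable_pt_lim_const. }
assert (U := uniqueness_limite _ _ _ _ Dsq Dk).
assert (Zx : Zfun x = 0). { apply Rmult_eq_reg_l with (2 * D 1%nat x); lra. }
assert (K0 : K = 0). { specialize (Z2 x). rewrite Zx in Z2. nra. }
apply Hx. apply (uniqueness_limite Zfun x); auto.
replace Zfun with (fun _ : R => 0); [apply derivable_pt_lim_const|].
apply functional_extensionality; intros y. specialize (Z2 y). rewrite K0 in Z2. nra.
Qed.

(** Descent from the first nonvanishing derivative: by the mean value theorem each lower derivative
    keeps the sign on the right of c and reverses it on the left, hence (-1)^m. *)
Lemma local_sign_of_order (D : nat -> R -> R) c : forall m j, (forall n x, derivable_pt_lim (D n) x (D (S n) x)) ->
  (forall i, (i < m)%nat -> D (j + i)%nat c = 0) -> D (j + m)%nat c <> 0 ->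
  exists d, 0 < d /\ (forall x, c < x < c + d -> 0 < D (j + m)%nat c * D j x) /\
    (forall x, c - d < x < c -> 0 < (-1) ^ m * (D (j + m)%nat c * D j x)).
Proof.
induction m; intros j HD Hz Hn.
- rewrite Nat.add_0_r in *. set (A := D j c) in *.
  assert (C : continuity_pt (D j) c) by (apply derivable_continuous_pt; eexists; apply HD).
  assert (HA : 0 < Rabs A) by (apply Rabs_pos_lt; auto).
  destruct (C (Rabs A) HA) as [d [Hd H]]. exists d. split; auto.
  assert (G : forall x, x <> c -> Rabs (x - c) < d -> 0 < A * D j x).
  { intros x Hxc Hx. specialize (H x). unfold dist, R_met, R_dist in H; simpl in H. unfold R_dist in H.
    assert (H' := H (conj (conj I (not_eq_sym Hxc)) Hx)). fold A in H'.
    unfold Rabs in H', HA. destruct (Rcase_abs (D j x - A)); destruct (Rcase_abs A); nra. }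
  split; intros x Hx; simpl; rewrite ?Rmult_1_l; apply G; try lra; apply Rabs_def1; lra.
- replace (j + S m)%nat with (S j + m)%nat in * by lia.
  destruct (IHm (S j) HD) as [d [Hd [H1 H2]]]; auto.
  { intros i Hi. replace (S j + i)%nat with (j + S i)%nat by lia. apply Hz; lia. }
  assert (Hc : D j c = 0) by (specialize (Hz 0%nat ltac:(lia)); rewrite Nat.add_0_r in Hz; auto).
  assert (DD : forall y, is_derive (D j) y (D (S j) y)) by (intros; apply is_derive_Reals, HD).
  assert (CC : forall y, continuity_pt (D j) y) by (intros; apply derivable_continuous_pt; eexists; apply HD).
  assert (MV : forall a b, a < b -> exists z, a < z < b /\ D j b - D j a = D (S j) z * (b - a)).
  { intros a b Hab. destruct (MVT_cor2 (D j) (D (S j)) a b Hab) as [z [E Hz']]; [intros; apply HD|]. exists z; split; auto. }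
  exists d. split; auto. split; intros x Hx.
  + destruct (MV c x ltac:(lra)) as [z [Hz' E]]. rewrite Hc, Rminus_0_r in E. rewrite E.
    specialize (H1 z ltac:(lra)). rewrite <- Rmult_assoc. apply Rmult_lt_0_compat; lra.
  + destruct (MV x c ltac:(lra)) as [z [Hz' E]]. rewrite Hc in E.
    specialize (H2 z ltac:(lra)). replace (D j x) with (- (D (S j) z * (c - x))) by lra.
    simpl. replace (-1 * (-1) ^ m * (D (S (j + m)) c * - (D (S j) z * (c - x)))) with ((-1) ^ m * (D (S j + m)%nat c * D (S
      j) z) * (c - x)) by (simpl; ring).
    apply Rmult_lt_0_compat; lra.
Qed.

(** The zero is the supremum c of the points where [D 1] is positive: [D 1] is nonpositive on the
    right of c and positive arbitrarily close on its left. An even order would give equal signs on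
    both sides. *)
Lemma odd_order_of_sign_change (D : nat -> R -> R) x1 x2 : (forall n x, derivable_pt_lim (D n) x (D (S n) x)) ->
  (forall c, exists m, D (S m) c <> 0) -> x1 < x2 -> 0 < D 1%nat x1 -> D 1%nat x2 < 0 ->
  exists c m, x1 < c < x2 /\ Nat.odd m = true /\ (forall j, (j < m)%nat -> D (S j) c = 0) /\ D (S m) c <> 0.
Proof.
intros HD Hfin H12 Hp Hn.
assert (CC : forall y, continuity_pt (D 1%nat) y) by (intros; apply derivable_continuous_pt; eexists; apply HD).
assert (Near : forall y, D 1%nat y <> 0 -> exists d, 0 < d /\ forall x, Rabs (x - y) < d -> 0 < D 1%nat y * D 1%nat x).
{ intros y Hy. destruct (local_sign_of_order D y 0 1 HD ltac:(intros; lia) Hy) as [d [Hd [A B]]].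
  exists d. split; auto. intros x Hx. apply Rabs_def2 in Hx. simpl in *.
  destruct (Rtotal_order x y) as [L|[->|L]].
  - specialize (B x ltac:(lra)). lra.
  - nra.
  - apply A; lra. }
set (S := fun x => x1 <= x <= x2 /\ 0 < D 1%nat x).
destruct (completeness S) as [c [Hub Hlub]].
{ exists x2. intros x [H _]; lra. } { exists x1. split; auto; lra. }
assert (Hc1 : x1 <= c) by (apply Hub; split; auto; lra).
assert (Hc2 : c <= x2) by (apply Hlub; intros x [H _]; lra).
assert (Hright : forall x, c < x <= x2 -> D 1%nat x <= 0).
{ intros x Hx. destruct (Rle_dec (D 1%nat x) 0) as [|N]; auto. apply Rnot_le_lt in N.
  assert (x <= c) by (apply Hub; split; auto; lra). lra. }
assert (Hleft : forall d, 0 < d -> exists x, c - d < x <= c /\ x1 <= x /\ 0 < D 1%nat x).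
{ intros d Hd. destruct (classic (exists x, c - d < x <= c /\ x1 <= x /\ 0 < D 1%nat x)) as [|N]; auto.
  exfalso. assert (c <= c - d); [|lra]. apply Hlub. intros x [Hx Px].
  destruct (Rle_dec x (c - d)) as [|M]; auto. exfalso; apply N. exists x. repeat split; try lra. apply Hub; split; auto. }
assert (Hc0 : D 1%nat c = 0).
{ destruct (Req_dec (D 1%nat c) 0) as [|N]; auto. exfalso. destruct (Near c N) as [d [Hd H]].
  destruct (Rlt_dec 0 (D 1%nat c)) as [P|P].
  - destruct (Req_dec c x2) as [E|NE]; [rewrite E in P; lra|].
    set (y := Rmin (c + d / 2) x2). assert (Hy : c < y <= x2) by (unfold y, Rmin; destruct (Rle_dec (c + d / 2) x2); lra).
    assert (y <= c + d / 2) by apply Rmin_l.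
    specialize (H y ltac:(apply Rabs_def1; lra)). specialize (Hright y Hy). nra.
  - destruct (Hleft d Hd) as [x [Hx [Hx1 Px]]]. specialize (H x ltac:(apply Rabs_def1; lra)). nra. }
assert (c <> x1) by (intros ->; lra). assert (c <> x2) by (intros ->; lra).
assert (Hmin : exists m, D (Datatypes.S m) c <> 0 /\ forall j, (j < m)%nat -> D (Datatypes.S j) c = 0).
{ destruct (Hfin c) as [m0 Hm0]. revert Hm0. pattern m0. apply (well_founded_induction lt_wf). clear m0. intros m0 IH Hm0.
  destruct (classic (exists j, (j < m0)%nat /\ D (Datatypes.S j) c <> 0)) as [[j [Hj1 Hj2]]|N]; [apply (IH j); auto|].
  exists m0. split; auto. intros j Hj. destruct (Req_dec (D (Datatypes.S j) c) 0); auto. exfalso; apply N; eauto. }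
destruct Hmin as [m [Hm1 Hm2]]. exists c, m. split; [lra|]. split; [|split; auto].
destruct (local_sign_of_order D c m 1 HD Hm2 Hm1) as [d [Hd [A B]]]. simpl in A, B.
set (y := Rmin (c + d / 2) x2). assert (Hy : c < y <= x2) by (unfold y, Rmin; destruct (Rle_dec (c + d / 2) x2); lra).
assert (y <= c + d / 2) by apply Rmin_l.
assert (A' := A y ltac:(lra)). assert (Ry := Hright y Hy).
destruct (Hleft d Hd) as [x [Hx [Hx1 Px]]].
assert (x <> c) by (intros ->; lra).
assert (B' := B x ltac:(lra)).
destruct (Nat.odd m) eqn:Eo; auto. exfalso.
assert (Nat.Even m) by (apply Nat.even_spec; rewrite <- Nat.negb_odd, Eo; auto).
destruct H3 as [k ->]. rewrite pow_1_even in B'. nra.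
Qed.

Theorem odd_order_root_of_sign_change x1 x2 D : deriv_seq Zfun D ->
  D 1%nat x1 * D 1%nat x2 < 0 ->
  exists c, Rmin x1 x2 < c < Rmax x1 x2 /\ odd_order_root_of_deriv Zfun c.
Proof.
intros HD. assert (G : forall a b, D 1%nat a * D 1%nat b < 0 -> a < b ->
   exists c, a < c < b /\ odd_order_root_of_deriv Zfun c).
{ intros a b Hab Lab.
  assert (Hfin : forall c, exists m, D (S m) c <> 0) by (intros c; apply (Zfun_deriv_not_flat D a c HD); nra).
  destruct (Rlt_dec 0 (D 1%nat a)) as [P|P].
  - destruct (odd_order_of_sign_change D a b (proj2 HD) Hfin Lab P ltac:(nra)) as [c [m [Hc [Hm [H1 H2]]]]].
    exists c. split; auto. exists D. split; auto. exists m. auto.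
  - assert (Na : D 1%nat a < 0) by (destruct (Rtotal_order (D 1%nat a) 0) as [|[E|]]; [auto | rewrite E in Hab; lra | lra]).
    assert (Pb : 0 < D 1%nat b) by nra.
    destruct (odd_order_of_sign_change (fun n x => -1 * D n x) a b) as [c [m [Hc [Hm [H1 H2]]]]]; auto; try lra.
    + intros n x. apply (derivable_pt_lim_scal (D n)), HD.
    + intros c. destruct (Hfin c) as [m Hm]. exists m. lra.
    + exists c. split; auto. exists D. split; auto. exists m. repeat split; auto.
      * intros j Hj. specialize (H1 j Hj). lra.
      * lra. }
intros H. unfold Rmin, Rmax. destruct (Rle_dec x1 x2) as [L|L].
- apply G; auto. destruct L; auto. subst. nra.
- apply G; [nra | lra].
Qed.

(** * Approximation of Z by Dirichlet polynomials *)

Lemma argsum_derive t n : is_derive (fun t => argsum t n) t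
  (/ 2 * sum_f_R0 (fun k => (INR k + 1 / 4) / ((INR k + 1 / 4) ^ 2 + (t / 2) ^ 2)) n).
Proof.
assert (E : forall k, is_derive (fun t => atan (2 * t / (4 * INR k + 1))) t
   (/ 2 * ((INR k + 1 / 4) / ((INR k + 1 / 4) ^ 2 + (t / 2) ^ 2)))).
{ intros k. assert (Hk := pos_INR k). auto_derive; auto.
  assert (0 <= t ^ 2) by apply pow2_ge_0. field. split; nra. }
induction n.
- apply E.
- unfold argsum. apply (is_derive_ext (fun t => argsum t n + atan (2 * t / (4 * INR (S n) + 1)))).
  { intros x. unfold argsum. rewrite tech5. reflexivity. }
  rewrite tech5, Rmult_plus_distr_l. apply (is_derive_plus (fun t => argsum t n)); auto.
Qed.

(** A summand r(y) is compared with the increment over [y, y + 1] of its primitive ln(y^2 + tau^2) /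
    2. Since |r'(c)| <= 1 / (c^2 + tau^2), the error is dominated by a telescoping difference. *)
Lemma riemann_sum_log tau n : 2 <= tau ->
  Rabs (sum_f_R0 (fun k => (INR k + 1 / 4) / ((INR k + 1 / 4) ^ 2 + tau ^ 2)) n
    - (ln ((INR n + 5 / 4) ^ 2 + tau ^ 2) / 2 - ln ((1 / 4) ^ 2 + tau ^ 2) / 2)) <= 2 / (tau - 3 / 4) - 2 / (INR n + 1 / 4 + tau).
Proof.
intros Ht.
set (r := fun y => y / (y ^ 2 + tau ^ 2)). set (H := fun y => ln (y ^ 2 + tau ^ 2) / 2).
assert (St : forall y, 0 < y -> Rabs (r y - (H (y + 1) - H y)) <= 2 / (y - 1 + tau) - 2 / (y + tau)).
{ intros y Hy.
  destruct (MVT_gen H y (y + 1) r) as [c [Hc E]].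
  - intros x Hx. unfold H, r. assert (0 <= x ^ 2) by apply pow2_ge_0. auto_derive; [nra|]. field. nra.
  - intros x Hx. apply derivable_continuous_pt, ex_derive_Reals_0. unfold H. assert (0 <= x ^ 2) by apply pow2_ge_0.
      auto_derive; nra.
  - rewrite Rmin_left, Rmax_right in Hc by lra. rewrite E. replace (y + 1 - y) with 1 by ring. rewrite Rmult_1_r.
    destruct (MVT_gen r y c (fun x => (tau ^ 2 - x ^ 2) / (x ^ 2 + tau ^ 2) ^ 2)) as [c2 [Hc2 E2]].
    + intros x Hx. unfold r. assert (0 <= x ^ 2) by apply pow2_ge_0. auto_derive; [nra|]. field. nra.
    + intros x Hx. apply derivable_continuous_pt, ex_derive_Reals_0. unfold r. assert (0 <= x ^ 2) by apply pow2_ge_0.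
        auto_derive; nra.
    + rewrite Rmin_left, Rmax_right in Hc2 by lra.
      rewrite Rabs_minus_sym, E2, Rabs_mult.
      assert (P : 0 < c2 ^ 2 + tau ^ 2) by nra.
      assert (B1 : Rabs ((tau ^ 2 - c2 ^ 2) / (c2 ^ 2 + tau ^ 2) ^ 2) <= / (c2 ^ 2 + tau ^ 2)).
      { unfold Rdiv. rewrite Rabs_mult, (Rabs_pos_eq (/ _)) by (left; apply Rinv_0_lt_compat, pow_lt; auto).
        apply Rmult_le_reg_r with ((c2 ^ 2 + tau ^ 2) ^ 2); [apply pow_lt; auto|].
        rewrite Rmult_assoc, Rinv_l, Rmult_1_r by (apply pow_nonzero; lra).
        replace (/ (c2 ^ 2 + tau ^ 2) * (c2 ^ 2 + tau ^ 2) ^ 2) with (c2 ^ 2 + tau ^ 2) by (field; lra).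
        apply Rabs_le. nra. }
      assert (B2 : / (c2 ^ 2 + tau ^ 2) <= 2 / (y - 1 + tau) - 2 / (y + tau)).
      { replace (2 / (y - 1 + tau) - 2 / (y + tau)) with (/ ((y - 1 + tau) * (y + tau) / 2)) by (field; lra).
        assert (0 <= (c2 - tau) ^ 2) by apply pow2_ge_0.
        assert (0 < (y - 1 + tau) * (y + tau)) by (apply Rmult_lt_0_compat; lra).
        apply Rinv_le_contravar; [lra|]. nra. }
      assert (B3 : Rabs (c - y) <= 1) by (apply Rabs_le; lra).
      assert (0 < / (c2 ^ 2 + tau ^ 2)) by (apply Rinv_0_lt_compat; auto).
      generalize (Rabs_pos (c - y)), (Rabs_pos ((tau ^ 2 - c2 ^ 2) / (c2 ^ 2 + tau ^ 2) ^ 2)). nra. }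
change (fun k => (INR k + 1 / 4) / ((INR k + 1 / 4) ^ 2 + tau ^ 2)) with (fun k => r (INR k + 1 / 4)).
change (ln ((INR n + 5 / 4) ^ 2 + tau ^ 2) / 2) with (H (INR n + 5 / 4)).
change (ln ((1 / 4) ^ 2 + tau ^ 2) / 2) with (H (1 / 4)).
induction n.
- assert (A := St (1 / 4) ltac:(lra)). simpl. rewrite Rplus_0_l. replace (0 + 5 / 4) with (1 / 4 + 1) by field.
  replace (1 / 4 - 1 + tau) with (tau - 3 / 4) in A by field. exact A.
- assert (Hn := pos_INR n). rewrite tech5, S_INR.
  assert (A := St (INR n + 1 + 1 / 4) ltac:(lra)).
  replace (INR n + 1 + 1 / 4 + 1) with (INR n + 1 + 5 / 4) in A by field.
  replace (INR n + 1 + 1 / 4 - 1 + tau) with (INR n + 1 / 4 + tau) in A by ring.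
  replace (INR n + 5 / 4) with (INR n + 1 + 1 / 4) in IHn by field.
  set (s := sum_f_R0 (fun k : nat => r (INR k + 1 / 4)) n) in *.
  replace (s + r (INR n + 1 + 1 / 4) - (H (INR n + 1 + 5 / 4) - H (1 / 4)))
    with ((s - (H (INR n + 1 + 1 / 4) - H (1 / 4))) + (r (INR n + 1 + 1 / 4) - (H (INR n + 1 + 5 / 4) - H (INR n + 1 + 1 /
      4)))) by ring.
  eapply Rle_trans; [apply Rabs_triang|]. lra.
Qed.

Lemma vn_derive_bound t n : 4 <= t -> (1 <= n)%nat -> exists d, is_derive (fun t => vn t n) t d /\
  Rabs (d - ln (t / 2) / 2) <= 5 / t + (5 + t ^ 2) / INR n.
Proof.
intros Ht Hn. assert (HN : 1 <= INR n) by (apply (le_INR 1); auto).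
set (tau := t / 2). assert (Htau : 2 <= tau) by (unfold tau; lra).
set (s := sum_f_R0 (fun k => (INR k + 1 / 4) / ((INR k + 1 / 4) ^ 2 + tau ^ 2)) n).
exists (ln (INR n) / 2 - / 2 * s). split.
- unfold vn. apply (is_derive_minus (fun t => t / 2 * ln (INR n)) (fun t => argsum t n)).
  + auto_derive; auto. field.
  + apply argsum_derive.
- assert (A := riemann_sum_log tau n Htau). fold s in A.
  assert (L1 := ln_bounds (((1 / 4) ^ 2 + tau ^ 2) / tau ^ 2) ltac:(apply Rdiv_lt_0_compat; nra)).
  rewrite ln_div in L1 by nra. replace (ln (tau ^ 2)) with (2 * ln tau) in L1.
  2:{ simpl. rewrite Rmult_1_r, ln_mult by lra. ring. }
  assert (L2 := ln_bounds (((INR n + 5 / 4) ^ 2 + tau ^ 2) / INR n ^ 2) ltac:(apply Rdiv_lt_0_compat; nra)).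
  rewrite ln_div in L2 by nra. replace (ln (INR n ^ 2)) with (2 * ln (INR n)) in L2.
  2:{ simpl. rewrite Rmult_1_r, ln_mult by lra. ring. }
  destruct L1 as [L1a L1b]. destruct L2 as [L2a L2b].
  set (N := INR n) in *. set (w1 := ln ((1 / 4) ^ 2 + tau ^ 2)) in *. set (w2 := ln ((N + 5 / 4) ^ 2 + tau ^ 2)) in *.
  assert (M1 : 0 <= 1 - / (((1 / 4) ^ 2 + tau ^ 2) / tau ^ 2)).
  { replace (1 - / (((1 / 4) ^ 2 + tau ^ 2) / tau ^ 2)) with ((1 / 4) ^ 2 / ((1 / 4) ^ 2 + tau ^ 2)) by (field; split; nra).
    apply Rdiv_le_0_compat; nra. }
  assert (M2 : ((1 / 4) ^ 2 + tau ^ 2) / tau ^ 2 - 1 <= / 16 / tau).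
  { apply Rmult_le_reg_r with (tau ^ 2); [nra|].
    replace ((((1 / 4) ^ 2 + tau ^ 2) / tau ^ 2 - 1) * tau ^ 2) with (1 / 16) by (field; lra).
    replace (/ 16 / tau * tau ^ 2) with (/ 16 * tau) by (field; lra). lra. }
  assert (M3 : 0 <= 1 - / (((N + 5 / 4) ^ 2 + tau ^ 2) / N ^ 2)).
  { replace (1 - / (((N + 5 / 4) ^ 2 + tau ^ 2) / N ^ 2)) with (((N + 5 / 4) ^ 2 - N ^ 2 + tau ^ 2) / ((N + 5 / 4) ^ 2 + tau
      ^ 2)) by (field; split; nra).
    apply Rdiv_le_0_compat; nra. }
  assert (M4 : ((N + 5 / 4) ^ 2 + tau ^ 2) / N ^ 2 - 1 <= (5 + tau ^ 2) / N).
  { apply Rmult_le_reg_r with (N ^ 2); [nra|].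
    replace ((((N + 5 / 4) ^ 2 + tau ^ 2) / N ^ 2 - 1) * N ^ 2) with (5 / 2 * N + 25 / 16 + tau ^ 2) by (field; lra).
    replace ((5 + tau ^ 2) / N * N ^ 2) with ((5 + tau ^ 2) * N) by (field; lra). nra. }
  assert (M5 : 2 / (tau - 3 / 4) <= 4 / tau).
  { apply Rmult_le_reg_r with ((tau - 3 / 4) * tau); [nra|].
    replace (2 / (tau - 3 / 4) * ((tau - 3 / 4) * tau)) with (2 * tau) by (field; lra).
    replace (4 / tau * ((tau - 3 / 4) * tau)) with (4 * (tau - 3 / 4)) by (field; lra). lra. }
  assert (M6 : 0 < 2 / (N + 1 / 4 + tau)) by (apply Rdiv_lt_0_compat; lra).
  assert (M7 : 5 / t = 5 / 2 * / tau) by (unfold tau; field; lra).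
  assert (M8 : (5 + tau ^ 2) / N <= (5 + t ^ 2) / N).
  { apply Rmult_le_compat_r; [left; apply Rinv_0_lt_compat; lra|]. unfold tau. nra. }
  assert (M9 : 0 < / tau) by (apply Rinv_0_lt_compat; lra).
  assert (M10 : 0 < (5 + tau ^ 2) / N) by (apply Rdiv_lt_0_compat; nra).
  apply Rabs_le_between in A. apply Rabs_le. unfold Rdiv in *. lra.
Qed.

(** The mean value theorem is applied to the approximants [vn], whose derivative is ln(t/2) / 2 +
    O(1/t) + O(t^2/n), before n goes to infinity; so vartheta is linearised without being
    differentiated. The term - (t/2) ln pi turns ln(T/2) into ln(T / (2 pi)). *)
Lemma vartheta_linear T h : 8 <= T -> Rabs h <= T / 2 ->
  Rabs (vartheta (T + h) - vartheta T - h * (ln (T / (2 * PI)) / 2)) <= Rabs h * (10 + Rabs h) / T.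
Proof.
intros HT Hh. assert (HP := PI_RGT_0).
assert (Hh' := proj1 (Rabs_le_between _ _) Hh).
assert (B : forall n, (1 <= n)%nat -> Rabs (vn (T + h) n - vn T n - h * (ln (T / 2) / 2)) <= Rabs h * (10 + Rabs h) / T +
  Rabs h * (5 + 4 * T ^ 2) * / INR n).
{ intros n Hn.
  (* A derivative is chosen as a function, with dummy value 0 for t < 4, because [MVT_gen] asks for
     one. *)
  set (df := fun t => match excluded_middle_informative (4 <= t) with
     | left H => proj1_sig (constructive_indefinite_description _ (vn_derive_bound t n H Hn)) | right _ => 0 end).
  assert (Hdf : forall t, 4 <= t -> is_derive (fun t => vn t n) t (df t) /\ Rabs (df t - ln (t / 2) / 2) <= 5 / t + (5 + t ^
    2) / INR n).
  { intros t Ht. unfold df. destruct (excluded_middle_informative (4 <= t)) as [H|]; [|contradiction].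
    destruct (constructive_indefinite_description _ (vn_derive_bound t n H Hn)) as [d Hd]. exact Hd. }
  destruct (MVT_gen (fun t => vn t n) T (T + h) df) as [c [Hc E]].
  - intros x Hx. apply Hdf. revert Hx. unfold Rmin, Rmax. destruct (Rle_dec T (T + h)); lra.
  - intros x Hx. apply derivable_continuous_pt, ex_derive_Reals_0. eexists. apply Hdf.
    revert Hx. unfold Rmin, Rmax. destruct (Rle_dec T (T + h)); lra.
  - assert (Hc1 : T / 2 <= c <= 3 / 2 * T /\ Rabs (c - T) <= Rabs h).
    { revert Hc. unfold Rmin, Rmax, Rabs in *. destruct (Rle_dec T (T + h)); destruct (Rcase_abs h); destruct (Rcase_abs (c
        - T)); lra. }
    destruct Hc1 as [Hc1 Hc2].
    rewrite E. replace (T + h - T) with h by ring.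
    replace (df c * h - h * (ln (T / 2) / 2)) with (h * (df c - ln (T / 2) / 2)) by ring.
    rewrite Rabs_mult.
    replace (Rabs h * (10 + Rabs h) / T + Rabs h * (5 + 4 * T ^ 2) * / INR n)
      with (Rabs h * ((10 + Rabs h) / T + (5 + 4 * T ^ 2) * / INR n)).
    2:{ field. split; [|lra]. apply not_0_INR; lia. }
    apply Rmult_le_compat_l; [apply Rabs_pos|].
    destruct (Hdf c ltac:(lra)) as [_ A].
    assert (HN : 0 < / INR n) by (apply Rinv_0_lt_compat, lt_0_INR; lia).
    assert (A1 : 5 / c <= 10 / T).
    { apply Rmult_le_reg_r with (c * T); [nra|].
      replace (5 / c * (c * T)) with (5 * T) by (field; lra). replace (10 / T * (c * T)) with (10 * c) by (field; lra). lra. }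
    assert (A2 : (5 + c ^ 2) / INR n <= (5 + 4 * T ^ 2) * / INR n) by (apply Rmult_le_compat_r; [lra|nra]).
    assert (A3 : Rabs (ln (c / 2) / 2 - ln (T / 2) / 2) <= Rabs h / T).
    { rewrite !ln_div by lra.
      replace ((ln c - ln 2) / 2 - (ln T - ln 2) / 2) with (/ 2 * (ln c - ln T)) by field.
      rewrite Rabs_mult, Rabs_pos_eq by lra. rewrite <- ln_div by lra.
      destruct (ln_bounds (c / T) ltac:(apply Rdiv_lt_0_compat; lra)) as [l1 l2].
      replace (/ (c / T)) with (T / c) in l1 by (field; lra).
      assert (q1 : 1 - T / c >= - (2 * (Rabs h / T))).
      { replace (1 - T / c) with ((c - T) * / c) by (field; lra).
        assert (- Rabs h <= c - T) by (apply Rabs_le_between in Hc2; lra).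
        assert (/ c <= 2 * / T). { apply Rmult_le_reg_r with (c * T); [nra|].
          replace (/ c * (c * T)) with T by (field; lra). replace (2 * / T * (c * T)) with (2 * c) by (field; lra). lra. }
        assert (0 < / c) by (apply Rinv_0_lt_compat; lra). assert (0 <= Rabs h) by apply Rabs_pos. unfold Rdiv. nra. }
      assert (q2 : c / T - 1 <= Rabs h / T).
      { replace (c / T - 1) with ((c - T) / T) by (field; lra). apply Rmult_le_compat_r; [left; apply Rinv_0_lt_compat; lra|].
        apply Rabs_le_between in Hc2; lra. }
      assert (0 <= Rabs h / T) by (apply Rdiv_le_0_compat; [apply Rabs_pos | lra]).
      assert (Rabs (ln (c / T)) <= 2 * (Rabs h / T)) by (apply Rabs_le; lra). lra. }
    replace (df c - ln (T / 2) / 2) with ((df c - ln (c / 2) / 2) + (ln (c / 2) / 2 - ln (T / 2) / 2)) by ring.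
    eapply Rle_trans; [apply Rabs_triang|]. unfold Rdiv in *. lra. }
set (X := Rabs h * (10 + Rabs h) / T) in *.
assert (E : vartheta (T + h) - vartheta T - h * (ln (T / (2 * PI)) / 2) = im_lngamma (T + h) - im_lngamma T - h * (ln (T /
  2) / 2)).
{ unfold vartheta. rewrite !ln_div, ln_mult by lra. field. }
rewrite E.
assert (L1 := is_lim_seq_abs _ _ (is_lim_seq_minus' _ _ _ _ (is_lim_seq_minus' _ _ _ _ (vn_lim (T + h)) (vn_lim T))
  (is_lim_seq_const (h * (ln (T / 2) / 2))))).
assert (L2 : is_lim_seq (fun n => X + Rabs h * (5 + 4 * T ^ 2) * / INR n) X).
{ rewrite <- (Rplus_0_r X) at 1. apply is_lim_seq_plus'; [apply is_lim_seq_const|]. apply is_lim_seq_const_div. }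
change (Rbar_le (Rabs (im_lngamma (T + h) - im_lngamma T - h * (ln (T / 2) / 2))) X).
refine (is_lim_seq_le_loc _ _ _ _ _ L1 L2). exists 1%nat. intros n Hn. apply B; auto.
Qed.

(** * Euler-Maclaurin approximation of zeta on the critical line *)

Lemma inv_pow_three_half n : (1 <= n)%nat -> / (INR n * sqrt (INR n)) <= 4 * (/ sqrt (INR n) - / sqrt (INR (S n))).
Proof.
intros Hn. assert (HN : 1 <= INR n) by (apply (le_INR 1); auto). rewrite S_INR. set (N := INR n) in *.
set (a := sqrt N). set (b := sqrt (N + 1)).
assert (Ha : 0 < a) by (apply sqrt_lt_R0; lra). assert (Hb : 0 < b) by (apply sqrt_lt_R0; lra).
assert (Ea : a * a = N) by (apply sqrt_sqrt; lra). assert (Eb : b * b = N + 1) by (apply sqrt_sqrt; lra).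
rewrite <- Ea. replace (/ a - / b) with ((b - a) * / (a * b)) by (field; lra).
replace (b - a) with (/ (a + b)). 2:{ apply Rmult_eq_reg_l with (a + b); [|lra]. rewrite Rinv_r by lra. lra. }
rewrite <- Rinv_mult. replace 4 with (/ (/ 4)) by field. rewrite <- Rinv_mult.
assert (a < b) by (apply sqrt_lt_1; lra).
assert (0 < a * b) by (apply Rmult_lt_0_compat; auto).
apply Rinv_le_contravar; [apply Rmult_lt_0_compat; [lra | apply Rmult_lt_0_compat; lra]|].
assert ((a + b) * (a * b) <= 2 * (b * b) * a) by nra. nra.
Qed.

Lemma zt_derive t x : 0 < x -> is_derive (zt_re t) x (zterm_re t x) /\ is_derive (zt_im t) x (zterm_im t x).
Proof.
intros Hx. assert (Hs : 0 < sqrt x) by (apply sqrt_lt_R0; auto). assert (Ht := pow2_ge_0 t).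
assert (E : 1 * / x = / (sqrt x * sqrt x)) by (rewrite sqrt_sqrt by lra; ring).
unfold zt_re, zt_im, zterm_re, zterm_im.
split; auto_derive; try (repeat split; auto; lra); rewrite E; field; repeat split; nra.
Qed.

Lemma zterm_derive_bound t x : 0 < x -> exists d e, is_derive (zterm_re t) x d /\ is_derive (zterm_im t) x e /\
  Rabs d <= (1 / 2 + Rabs t) * / (x * sqrt x) /\ Rabs e <= (1 / 2 + Rabs t) * / (x * sqrt x).
Proof.
intros Hx. assert (Hs : 0 < sqrt x) by (apply sqrt_lt_R0; auto).
assert (Hq : 0 < / (x * sqrt x)) by (apply Rinv_0_lt_compat, Rmult_lt_0_compat; auto).
set (c := cos (t * ln x)). set (s := sin (t * ln x)).
exists ((- (c / 2) - t * s) * / (x * sqrt x)), ((s / 2 - t * c) * / (x * sqrt x)).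
assert (E : / (x * sqrt x) = / sqrt x * / x) by (field; lra).
assert (Hc : Rabs c <= 1) by (apply Rabs_le; generalize (COS_bound (t * ln x)); unfold c; lra).
assert (Hss : Rabs s <= 1) by (apply Rabs_le; generalize (SIN_bound (t * ln x)); unfold s; lra).
assert (Pt := Rabs_pos t).
split; [|split; [|split]].
- unfold zterm_re. auto_derive; [repeat split; auto; lra|]. fold c s. rewrite sqrt_sqrt by lra. field. lra.
- unfold zterm_im. auto_derive; [repeat split; auto; lra|]. fold c s. rewrite sqrt_sqrt by lra. field. lra.
- rewrite Rabs_mult, (Rabs_pos_eq (/ _)) by lra. apply Rmult_le_compat_r; [lra|].
  eapply Rle_trans; [apply Rabs_triang|]. unfold Rdiv. rewrite !Rabs_Ropp, !Rabs_mult, (Rabs_pos_eq (/ 2)) by lra. nra.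
- rewrite Rabs_mult, (Rabs_pos_eq (/ _)) by lra. apply Rmult_le_compat_r; [lra|].
  eapply Rle_trans; [apply Rabs_triang|]. unfold Rdiv. rewrite !Rabs_Ropp, !Rabs_mult, (Rabs_pos_eq (/ 2)) by lra. nra.
Qed.

(** One term against the integral over [n, n + 1], by two mean values; the derivative bound B
    x^(-3/2) becomes a telescoping difference of multiples of n^(-1/2). *)
Lemma euler_maclaurin_step (F f : R -> R) n B : (1 <= n)%nat ->
  (forall x, 0 < x -> is_derive F x (f x)) ->
  (forall x, 0 < x -> exists d, is_derive f x d /\ Rabs d <= B * / (x * sqrt x)) -> 0 <= B ->
  Rabs (f (INR (S n)) - (F (INR (S n)) - F (INR n))) <= 4 * B / sqrt (INR n) - 4 * B / sqrt (INR (S n)).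
Proof.
intros Hn HF Hf HB. assert (HN : 1 <= INR n) by (apply (le_INR 1); auto).
assert (T := inv_pow_three_half n Hn). rewrite S_INR in *. set (N := INR n) in *.
destruct (MVT_gen F N (N + 1) f) as [c [Hc E]].
- intros x Hx. rewrite Rmin_left, Rmax_right in Hx by lra. apply HF; lra.
- intros x Hx. rewrite Rmin_left, Rmax_right in Hx by lra. apply derivable_continuous_pt, ex_derive_Reals_0. eexists; apply
    HF; lra.
- rewrite Rmin_left, Rmax_right in Hc by lra. rewrite E. replace (N + 1 - N) with 1 by ring. rewrite Rmult_1_r.
  set (df := fun x => match excluded_middle_informative (0 < x) with
     | left H => proj1_sig (constructive_indefinite_description _ (Hf x H)) | right _ => 0 end).
  assert (Hdf : forall x, 0 < x -> is_derive f x (df x) /\ Rabs (df x) <= B * / (x * sqrt x)).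
  { intros x Hx. unfold df. destruct (excluded_middle_informative (0 < x)) as [H|]; [|contradiction].
    destruct (constructive_indefinite_description _ (Hf x H)) as [d Hd]. exact Hd. }
  destruct (MVT_gen f c (N + 1) df) as [c2 [Hc2 E2]].
  + intros x Hx. rewrite Rmin_left, Rmax_right in Hx by lra. apply Hdf; lra.
  + intros x Hx. rewrite Rmin_left, Rmax_right in Hx by lra. apply derivable_continuous_pt, ex_derive_Reals_0. eexists;
      apply Hdf; lra.
  + rewrite Rmin_left, Rmax_right in Hc2 by lra. rewrite E2, Rabs_mult.
    destruct (Hdf c2 ltac:(lra)) as [_ A].
    assert (M : / (c2 * sqrt c2) <= / (N * sqrt N)).
    { assert (0 < sqrt N) by (apply sqrt_lt_R0; lra). apply Rinv_le_contravar; [apply Rmult_lt_0_compat; lra|].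
      apply Rmult_le_compat; try lra. apply sqrt_le_1; lra. }
    assert (M1 : Rabs (N + 1 - c) <= 1) by (apply Rabs_le; lra).
    assert (M2 := Rabs_pos (N + 1 - c)). assert (M3 := Rabs_pos (df c2)).
    apply Rle_trans with (B * (4 * (/ sqrt N - / sqrt (N + 1)))).
    * apply Rle_trans with (B * / (c2 * sqrt c2)); [nra|]. apply Rmult_le_compat_l; lra.
    * right; unfold Rdiv; ring.
Qed.

Lemma is_lim_seq_div_sqrt c : is_lim_seq (fun n => c / sqrt (INR n)) 0.
Proof.
replace (Finite 0) with (Rbar_mult c 0) by (simpl; f_equal; ring).
apply is_lim_seq_scal_l. apply (is_lim_seq_inv (fun n => sqrt (INR n)) p_infty).
- apply (filterlim_comp _ _ _ INR sqrt _ (Rbar_locally p_infty)); [apply is_lim_seq_INR | apply filterlim_sqrt_p].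
- discriminate.
Qed.

Lemma zeta_approx t n : (1 <= n)%nat ->
  Rabs (em_re t n - zeta_re t) <= (2 + 4 * Rabs t) / sqrt (INR n) /\
  Rabs (em_im t n - zeta_im t) <= (2 + 4 * Rabs t) / sqrt (INR n).
Proof.
intros Hn. destruct (zeta_lim t) as [Lr Li]. assert (Pt := Rabs_pos t).
assert (G : forall (u : nat -> R) F f (l : R), (forall n, u (S n) - u n = f (INR (S n)) - (F (INR (S n)) - F (INR n))) ->
   (forall x, 0 < x -> is_derive F x (f x)) ->
   (forall x, 0 < x -> exists d, is_derive f x d /\ Rabs d <= (1 / 2 + Rabs t) * / (x * sqrt x)) ->
   is_lim_seq u l -> Rabs (u n - l) <= (2 + 4 * Rabs t) / sqrt (INR n)).
{ intros u F f l Hu HF Hf Hl.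
  destruct (lim_seq_telescoping u (fun n => (2 + 4 * Rabs t) / sqrt (INR n)) 1) as [l' [Hl' Hb]].
  - intros m Hm. rewrite Hu. eapply Rle_trans; [apply euler_maclaurin_step; eauto; lra|].
    replace (4 * (1 / 2 + Rabs t)) with (2 + 4 * Rabs t) by field. lra.
  - apply is_lim_seq_div_sqrt.
  - apply is_lim_seq_unique in Hl. apply is_lim_seq_unique in Hl'. rewrite Hl in Hl'. injection Hl'; intros ->. auto. }
split.
- apply (G (em_re t) (zt_re t) (zterm_re t)); auto.
  + intros m. unfold em_re. rewrite zs_re_S. ring.
  + intros x Hx. apply zt_derive; auto.
  + intros x Hx. destruct (zterm_derive_bound t x Hx) as [d [e [A [_ [B _]]]]]. eauto.
- apply (G (em_im t) (zt_im t) (zterm_im t)); auto.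
  + intros m. unfold em_im. rewrite zs_im_S. ring.
  + intros x Hx. apply zt_derive; auto.
  + intros x Hx. destruct (zterm_derive_bound t x Hx) as [d [e [_ [A [_ B]]]]]. eauto.
Qed.

Lemma zs_bound t n : Rabs (zs_re t n) <= 2 * sqrt (INR n) /\ Rabs (zs_im t n) <= 2 * sqrt (INR n).
Proof.
induction n as [|n [I1 I2]].
- simpl. rewrite Rabs_R0, sqrt_0. lra.
- rewrite zs_re_S, zs_im_S. destruct (zterm_bound t n) as [B1 B2].
  assert (M : / sqrt (INR (S n)) <= 2 * sqrt (INR (S n)) - 2 * sqrt (INR n)).
  { rewrite S_INR. assert (HN := pos_INR n). set (a := sqrt (INR n)). set (b := sqrt (INR n + 1)).
    assert (Ha : 0 <= a) by apply sqrt_pos. assert (Hb : 0 < b) by (apply sqrt_lt_R0; lra).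
    assert (Ea : a * a = INR n) by (apply sqrt_sqrt; lra). assert (Eb : b * b = INR n + 1) by (apply sqrt_sqrt; lra).
    apply Rmult_le_reg_r with b; auto. rewrite Rinv_l by lra.
    assert (0 <= (b - a) * (b - a)) by nra. nra. }
  split; (eapply Rle_trans; [apply Rabs_triang|]; lra).
Qed.

Lemma zt_bound t x : 1 <= t -> 0 <= x -> Rabs (zt_re t x) <= 2 * sqrt x / t /\ Rabs (zt_im t x) <= 2 * sqrt x / t.
Proof.
intros Ht Hx. assert (Hs := sqrt_pos x).
assert (Hc := COS_bound (t * ln x)). assert (Hsn := SIN_bound (t * ln x)).
unfold zt_re, zt_im. set (c := cos (t * ln x)) in *. set (s := sin (t * ln x)) in *.
assert (G : forall w, Rabs w <= 1 / 2 + t -> Rabs (sqrt x * w / (1 / 4 + t ^ 2)) <= 2 * sqrt x / t).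
{ intros w Hw. unfold Rdiv. rewrite !Rabs_mult, (Rabs_pos_eq (sqrt x)), (Rabs_pos_eq (/ _)) by (auto; left; apply
    Rinv_0_lt_compat; nra).
  replace (2 * sqrt x * / t) with (sqrt x * (2 * / t)) by ring. rewrite Rmult_assoc. apply Rmult_le_compat_l; auto.
  apply Rmult_le_reg_r with (t * (1 / 4 + t ^ 2)); [nra|].
  replace (Rabs w * / (1 * / 4 + t ^ 2) * (t * (1 / 4 + t ^ 2))) with (Rabs w * t) by (field; nra).
  replace (2 * / t * (t * (1 / 4 + t ^ 2))) with (2 * (1 / 4 + t ^ 2)) by (field; lra).
  assert (Rabs w * t <= (1 / 2 + t) * t) by (apply Rmult_le_compat_r; lra). nra. }
split; apply G; apply Rabs_le; nra.
Qed.

Lemma nat_ceil x : 0 <= x -> exists N : nat, x <= INR N <= x + 1.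
Proof.
intros Hx. destruct (nfloor_ex x Hx) as [n Hn]. exists (S n). rewrite S_INR. lra.
Qed.

(** With about t terms the sum, the correction and the remainder are all O(sqrt t). So crude a size
    is affordable, as it only multiplies the phase error O((1 + h^2) / T) in [Z_approx]. *)
Lemma zeta_crude t : 1 <= t -> Rabs (zeta_re t) <= 13 * sqrt t /\ Rabs (zeta_im t) <= 13 * sqrt t.
Proof.
intros Ht. destruct (nat_ceil t ltac:(lra)) as [N HN].
assert (HN1 : (1 <= N)%nat) by (apply INR_le; simpl; lra).
assert (Hst : 1 <= sqrt t) by (rewrite <- sqrt_1; apply sqrt_le_1; lra).
assert (Est : sqrt t * sqrt t = t) by (apply sqrt_sqrt; lra).
assert (HsN : sqrt t <= sqrt (INR N)) by (apply sqrt_le_1; lra).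
assert (HsN2 : sqrt (INR N) <= 3 / 2 * sqrt t).
{ replace (3 / 2) with (sqrt ((3 / 2) ^ 2)) by (apply sqrt_pow2; lra). rewrite <- sqrt_mult by lra. apply sqrt_le_1; lra. }
destruct (zeta_approx t N HN1) as [A1 A2]. destruct (zs_bound t N) as [B1 B2].
destruct (zt_bound t (INR N) Ht ltac:(lra)) as [C1 C2].
assert (D1 : 2 * sqrt (INR N) / t <= 3).
{ apply Rmult_le_reg_r with t; [lra|]. unfold Rdiv. rewrite Rmult_assoc, Rinv_l by lra. nra. }
assert (D2 : (2 + 4 * Rabs t) / sqrt (INR N) <= 6 * sqrt t).
{ rewrite Rabs_pos_eq by lra. apply Rmult_le_reg_r with (sqrt (INR N)); [lra|].
  unfold Rdiv. rewrite Rmult_assoc, Rinv_l by lra. nra. }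
unfold em_re, em_im in *. apply Rabs_le_between in A1, A2, B1, B2, C1, C2.
split; apply Rabs_le; lra.
Qed.

(** * Complex exponentials, finite sums, and the linearised Dirichlet polynomial *)

Definition cis (x : R) : Complex.C := (cos x, sin x).

Lemma cis_plus x y : cis (x + y) = (cis x * cis y)%C.
Proof. unfold cis, Cmult; simpl. rewrite cos_plus, sin_plus. f_equal; ring. Qed.

Lemma cis_0 : cis 0 = 1%C.
Proof. unfold cis. rewrite cos_0, sin_0. reflexivity. Qed.

Lemma Cmod_cis x : Cmod (cis x) = 1.
Proof.
unfold Cmod, cis; simpl. replace (cos x * (cos x * 1) + sin x * (sin x * 1)) with 1; [apply sqrt_1|].
generalize (sin2_cos2 x). unfold Rsqr. lra.
Qed.

Lemma Cmod_le_abs (z : Complex.C) : Cmod z <= Rabs (fst z) + Rabs (snd z).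
Proof.
destruct z as [a b]; unfold Cmod; cbn [fst snd]. rewrite <- (sqrt_pow2 (Rabs a + Rabs b)).
2:{ generalize (Rabs_pos a), (Rabs_pos b); lra. }
apply sqrt_le_1_alt. rewrite <- (pow2_abs a), <- (pow2_abs b).
generalize (Rabs_pos a), (Rabs_pos b); nra.
Qed.

Lemma Re_le_Cmod z : Rabs (fst z) <= Cmod z.
Proof. destruct z; eapply Rle_trans; [apply Rmax_l | apply Rmax_Cmod]. Qed.

Lemma Im_le_Cmod z : Rabs (snd z) <= Cmod z.
Proof. destruct z; eapply Rle_trans; [apply Rmax_r | apply Rmax_Cmod]. Qed.

Lemma cis_lipschitz x y : Cmod (cis x - cis y)%C <= 2 * Rabs (x - y).
Proof.
eapply Rle_trans; [apply Cmod_le_abs|]. simpl.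
assert (A := cos_lipschitz x y). assert (B := sin_lipschitz x y). unfold Rminus in *. lra.
Qed.

Fixpoint Csum (f : nat -> Complex.C) (n : nat) : Complex.C :=
  match n with O => 0%C | S m => (Csum f m + f m)%C end.
Fixpoint Rsum (f : nat -> R) (n : nat) : R :=
  match n with O => 0 | S m => Rsum f m + f m end.

Lemma Csum_S f n : Csum f (S n) = (Csum f n + f n)%C.
Proof. reflexivity. Qed.

Lemma Csum_ext f g n : (forall k, (k < n)%nat -> f k = g k) -> Csum f n = Csum g n.
Proof. intros H; induction n; simpl; auto. rewrite IHn, H; auto. Qed.

Lemma Csum_plus f g n : Csum (fun k => f k + g k)%C n = (Csum f n + Csum g n)%C.
Proof. induction n; simpl; [ring|]. rewrite IHn. ring. Qed.

Lemma Csum_scal a f n : Csum (fun k => a * f k)%C n = (a * Csum f n)%C.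
Proof. induction n; simpl; [ring|]. rewrite IHn. ring. Qed.

Lemma Csum_minus f g n : Csum (fun k => f k - g k)%C n = (Csum f n - Csum g n)%C.
Proof. induction n; simpl; [ring|]. rewrite IHn. ring. Qed.

Lemma Csum_swap (f : nat -> nat -> Complex.C) n m :
  Csum (fun i => Csum (fun j => f i j) m) n = Csum (fun j => Csum (fun i => f i j) n) m.
Proof.
induction n; simpl.
- induction m; simpl; auto. rewrite <- IHm. ring.
- rewrite IHn, <- Csum_plus. reflexivity.
Qed.

Lemma Cmod_Csum f n : Cmod (Csum f n) <= Rsum (fun k => Cmod (f k)) n.
Proof.
induction n; simpl; [rewrite Cmod_0; lra|].
eapply Rle_trans; [apply Cmod_triangle|]. lra.
Qed.

Lemma Rsum_le f g n : (forall k, (k < n)%nat -> f k <= g k) -> Rsum f n <= Rsum g n.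
Proof. intros H; induction n; simpl; [lra|]. specialize (IHn ltac:(auto)). specialize (H n ltac:(lia)). lra. Qed.

Lemma Rsum_scal a f n : Rsum (fun k => a * f k) n = a * Rsum f n.
Proof. induction n; simpl; [ring|]. rewrite IHn. ring. Qed.

Lemma Rsum_const a n : Rsum (fun _ => a) n = INR n * a.
Proof. induction n; [simpl; ring|]. rewrite S_INR. simpl. rewrite IHn. ring. Qed.

Lemma Csum_split f n m : Csum f (n + m) = (Csum f n + Csum (fun k => f (n + k)%nat) m)%C.
Proof.
induction m; simpl; [rewrite Nat.add_0_r; ring|].
rewrite Nat.add_succ_r. simpl. rewrite IHm. ring.
Qed.

Lemma zs_Csum t n : (zs_re t n, zs_im t n) =
  Csum (fun k => RtoC (/ sqrt (INR (S k))) * cis (- (t * ln (INR (S k)))))%C n.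
Proof.
induction n; [reflexivity|]. rewrite zs_re_S, zs_im_S, Csum_S, <- IHn.
unfold zterm_re, zterm_im, cis, Cmult, Cplus, RtoC; cbn [fst snd].
rewrite cos_neg, sin_neg. f_equal; ring.
Qed.

(* 1 / (1/2 - it) *)
Definition wC (t : R) : Complex.C := ((1 / 2) / (1 / 4 + t ^ 2), t / (1 / 4 + t ^ 2)).

Lemma zt_wC t x : (zt_re t x, zt_im t x) = (RtoC (sqrt x) * cis (- (t * ln x)) * wC t)%C.
Proof.
assert (Ht := pow2_ge_0 t).
unfold zt_re, zt_im, wC, cis, Cmult, RtoC; cbn [fst snd]. rewrite cos_neg, sin_neg.
f_equal; field; lra.
Qed.

Lemma Cmod_wC t : 0 < t -> Cmod (wC t) <= / t.
Proof.
intros Ht. unfold Cmod, wC; cbn [fst snd]. rewrite <- (sqrt_pow2 (/ t)) by (left; apply Rinv_0_lt_compat; auto).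
apply sqrt_le_1_alt.
replace ((1 / 2 / (1 / 4 + t ^ 2)) ^ 2 + (t / (1 / 4 + t ^ 2)) ^ 2) with (/ (1 / 4 + t ^ 2)) by (field; nra).
rewrite pow_inv. apply Rinv_le_contravar; nra.
Qed.

Lemma wC_diff t t' : 0 < t -> 0 < t' -> Cmod (wC t - wC t')%C <= Rabs (t - t') * (/ t * / t').
Proof.
intros Ht Ht'.
replace (wC t - wC t')%C with ((0, t - t')%R * (wC t * wC t'))%C.
- rewrite !Cmod_mult. apply Rmult_le_compat; try (apply Cmod_ge_0); [apply Rmult_le_pos; apply Cmod_ge_0| |apply
    Rmult_le_compat; auto using Cmod_ge_0, Cmod_wC].
  eapply Rle_trans; [apply Cmod_le_abs|]. simpl. rewrite Rabs_R0. lra.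
- unfold wC, Cmult, Cminus, Cplus, Copp; cbn [fst snd]. f_equal; field; nra.
Qed.

Lemma Zfun_cis t : RtoC (Zfun t) = (cis (vartheta t) * (zeta_re t, zeta_im t))%C.
Proof.
destruct (Zfun_polar t) as [_ [-> ->]]. unfold cis, Cmult, RtoC; cbn [fst snd].
assert (E := sin2_cos2 (vartheta t)). unfold Rsqr in E.
f_equal; [|ring].
transitivity (Zfun t * (sin (vartheta t) * sin (vartheta t) + cos (vartheta t) * cos (vartheta t))); [rewrite E; ring | ring].
Qed.

(* The main term of the derivative of [vartheta]. *)
Definition Lam (T : R) : R := ln (T / (2 * PI)) / 2.

(** The phase vartheta(T + h) - (T + h) ln n is replaced by its linear part in h. About T^3 terms
    bring the Euler-Maclaurin remainder T / sqrt N down to T^(-1/2), the order of the phase error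
    times sqrt T. The correction N^(1-s) / (1-s) oscillates like the term n = N apart from 1 /
    (1-s), which is frozen at h = 0 and absorbed into [b N]; this is why that coefficient may be as
    large as 2 sqrt T. *)
Lemma Z_approx T : 8 <= T -> exists (N : nat) (b : nat -> Complex.C),
  T ^ 3 <= INR N <= T ^ 3 + 1 /\
  (forall n, (1 <= n < N)%nat -> b n = (RtoC (/ sqrt (INR n)) * cis (vartheta T - T * ln (INR n)))%C) /\
  Cmod (b N) <= 2 * sqrt T /\
  forall h, Rabs h <= T / 2 ->
    Cmod (RtoC (Zfun (T + h)) - Csum (fun k => b (S k) * cis (h * (Lam T - ln (INR (S k)))))%C N)%C <= 400 * (1 + h ^ 2) / sqrt T.
Proof.
intros HT.
assert (HT3 : 512 <= T ^ 3) by (replace 512 with (8 ^ 3) by ring; apply pow_incr; lra).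
destruct (nat_ceil (T ^ 3) ltac:(lra)) as [N HN].
assert (HN1 : (1 <= N)%nat) by (apply INR_le; simpl; lra).
set (w := sqrt T). assert (Hw : 0 < w) by (apply sqrt_lt_R0; lra). assert (Ew : w * w = T) by (apply sqrt_sqrt; lra).
assert (Hw2 : 2 <= w) by nra.
assert (HsN : T * w <= sqrt (INR N)).
{ rewrite <- (sqrt_pow2 (T * w)) by nra. apply sqrt_le_1_alt. replace ((T * w) ^ 2) with (T ^ 2 * (w * w)) by ring. rewrite
    Ew. lra. }
assert (HsN2 : sqrt (INR N) <= 11 / 10 * (T * w)).
{ rewrite <- (sqrt_pow2 (11 / 10 * (T * w))) by nra. apply sqrt_le_1_alt. replace ((11 / 10 * (T * w)) ^ 2) with (121 / 100
    * T ^ 2 * (w * w)) by field. rewrite Ew. nra. }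
set (b := fun n => if Nat.eq_dec n N then
   (RtoC (/ sqrt (INR n)) * cis (vartheta T - T * ln (INR n)) - cis (vartheta T) * (RtoC (sqrt (INR N)) * cis (- (T * ln
     (INR N))) * wC T))%C
   else (RtoC (/ sqrt (INR n)) * cis (vartheta T - T * ln (INR n)))%C).
assert (Hinv : 0 < / sqrt (INR N)) by (apply Rinv_0_lt_compat; nra).
exists N, b. split; auto. split; [|split].
- intros n Hn. unfold b. destruct (Nat.eq_dec n N); [lia | reflexivity].
- unfold b. destruct (Nat.eq_dec N N) as [_|]; [|contradiction].
  eapply Rle_trans; [apply Cmod_triangle|]. rewrite Cmod_opp, !Cmod_mult, !Cmod_cis, !Cmod_R.
  rewrite !Rabs_pos_eq by (try apply sqrt_pos; lra).
  assert (W := Cmod_wC T ltac:(lra)). rewrite !Rmult_1_r, Rmult_1_l.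
  assert (/ sqrt (INR N) <= 1). { rewrite <- Rinv_1. apply Rinv_le_contravar; nra. }
  assert (sqrt (INR N) * Cmod (wC T) <= 11 / 10 * (T * w) * / T).
  { apply Rmult_le_compat; auto using Cmod_ge_0, sqrt_pos. }
  replace (11 / 10 * (T * w) * / T) with (11 / 10 * w) in H0 by (field; lra). lra.
- intros h Hh. assert (Hh' := proj1 (Rabs_le_between _ _) Hh).
  set (th := vartheta T + h * Lam T).
  set (Zs := (zs_re (T + h) N, zs_im (T + h) N)).
  set (zeta := (zeta_re (T + h), zeta_im (T + h))).
  set (E := (em_re (T + h) N, em_im (T + h) N)).
  set (t1 := (RtoC (sqrt (INR N)) * cis (- ((T + h) * ln (INR N))) * wC (T + h))%C).
  set (t2 := (RtoC (sqrt (INR N)) * cis (- ((T + h) * ln (INR N))) * wC T)%C).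
  assert (EZ : Zs = (E + t1)%C).
  { unfold t1. rewrite <- zt_wC. unfold Zs, E, em_re, em_im, Cplus; cbn [fst snd]. f_equal; ring. }
  assert (ES : Csum (fun k => b (S k) * cis (h * (Lam T - ln (INR (S k)))))%C N = (cis th * (Zs - t2))%C).
  { unfold Zs. rewrite zs_Csum. destruct N as [|M]; [lia|]. rewrite !Csum_S.
    rewrite (Csum_ext _ (fun k => cis th * (RtoC (/ sqrt (INR (S k))) * cis (- ((T + h) * ln (INR (S k))))))%C).
    - rewrite Csum_scal. unfold b. destruct (Nat.eq_dec (S M) (S M)) as [_|]; [|contradiction].
      fold (Csum (fun k => RtoC (/ sqrt (INR (S k))) * cis (- ((T + h) * ln (INR (S k)))))%C M).
      set (l := ln (INR (S M))). unfold t2. fold l.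
      replace (vartheta T - T * l) with (vartheta T + - (T * l)) by ring.
      unfold th. replace (- ((T + h) * l)) with (- (T * l) + - (h * l)) by ring.
      replace (h * (Lam T - l)) with (h * Lam T + - (h * l)) by ring. rewrite !cis_plus. ring.
    - intros k Hk. unfold b. destruct (Nat.eq_dec (S k) (S M)); [lia|].
      set (l := ln (INR (S k))). unfold th.
      replace (vartheta T - T * l) with (vartheta T + - (T * l)) by ring.
      replace (- ((T + h) * l)) with (- (T * l) + - (h * l)) by ring.
      replace (h * (Lam T - l)) with (h * Lam T + - (h * l)) by ring. rewrite !cis_plus. ring. }
  rewrite ES, EZ, Zfun_cis. fold zeta.
  replace (cis (vartheta (T + h)) * zeta - cis th * (E + t1 - t2))%C
    with ((cis (vartheta (T + h)) - cis th) * zeta + (cis th * (zeta - E) + cis th * (t2 - t1)))%C by ring.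
  assert (Hsh : sqrt (T + h) <= 5 / 4 * w).
  { rewrite <- (sqrt_pow2 (5 / 4 * w)) by lra. apply sqrt_le_1_alt. replace ((5 / 4 * w) ^ 2) with (25 / 16 * (w * w)) by
      field. rewrite Ew. lra. }
  assert (B1 : Cmod ((cis (vartheta (T + h)) - cis th) * zeta)%C <= 65 * (Rabs h * (10 + Rabs h)) / w).
  { rewrite Cmod_mult.
    assert (V := vartheta_linear T h HT Hh). fold (Lam T) in V.
    replace (vartheta (T + h) - vartheta T - h * Lam T) with (vartheta (T + h) - th) in V by (unfold th; ring).
    assert (C1 := cis_lipschitz (vartheta (T + h)) th).
    destruct (zeta_crude (T + h) ltac:(lra)) as [Z1 Z2].
    assert (C2 := Cmod_le_abs zeta). simpl in C2.
    apply Rle_trans with (2 * (Rabs h * (10 + Rabs h) / T) * (65 / 2 * w)).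
    - apply Rmult_le_compat; auto using Cmod_ge_0; lra.
    - right. rewrite <- Ew. field. lra. }
  assert (B2 : Cmod (cis th * (zeta - E))%C <= 16 / w).
  { rewrite Cmod_mult, Cmod_cis, Rmult_1_l. destruct (zeta_approx (T + h) N HN1) as [Z1 Z2].
    eapply Rle_trans; [apply Cmod_le_abs|]. unfold zeta, E, Cminus, Cplus, Copp; cbn [fst snd].
    rewrite Rabs_minus_sym in Z1. rewrite Rabs_minus_sym in Z2. unfold Rminus in Z1, Z2.
    rewrite (Rabs_pos_eq (T + h)) in * by lra.
    assert ((2 + 4 * (T + h)) / sqrt (INR N) <= 8 / w).
    { apply Rle_trans with (8 * T / (T * w)); [|right; field; lra].
      unfold Rdiv. apply Rmult_le_compat; try lra. apply Rinv_le_contravar; nra. }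
    unfold Rdiv in *. lra. }
  assert (B3 : Cmod (cis th * (t2 - t1))%C <= 3 * Rabs h / w).
  { rewrite Cmod_mult, Cmod_cis, Rmult_1_l. unfold t1, t2.
    replace (RtoC (sqrt (INR N)) * cis (- ((T + h) * ln (INR N))) * wC T - RtoC (sqrt (INR N)) * cis (- ((T + h) * ln (INR
      N))) * wC (T + h))%C
      with (RtoC (sqrt (INR N)) * cis (- ((T + h) * ln (INR N))) * (wC T - wC (T + h)))%C by ring.
    rewrite !Cmod_mult, Cmod_cis, Rmult_1_r, Cmod_R, Rabs_pos_eq by apply sqrt_pos.
    assert (W := wC_diff T (T + h) ltac:(lra) ltac:(lra)). replace (T - (T + h)) with (- h) in W by ring. rewrite Rabs_Ropp in W.
    apply Rle_trans with (11 / 10 * (T * w) * (Rabs h * (/ T * (2 * / T)))).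
    - apply Rmult_le_compat; auto using sqrt_pos, Cmod_ge_0. eapply Rle_trans; [apply W|].
      apply Rmult_le_compat_l; [apply Rabs_pos|]. apply Rmult_le_compat_l; [left; apply Rinv_0_lt_compat; lra|].
      replace (2 * / T) with (/ (T / 2)) by (field; lra). apply Rinv_le_contravar; lra.
    - rewrite <- Ew. assert (0 <= Rabs h) by apply Rabs_pos.
      replace (11 / 10 * (w * w * w) * (Rabs h * (/ (w * w) * (2 * / (w * w))))) with (22 / 10 * (Rabs h / w)) by (field; lra).
      replace (3 * Rabs h / w) with (3 * (Rabs h / w)) by (field; lra).
      assert (0 <= Rabs h / w) by (apply Rdiv_le_0_compat; lra). lra. }
  eapply Rle_trans; [apply Cmod_triangle|].
  eapply Rle_trans; [apply Rplus_le_compat_l, Cmod_triangle|].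
  apply Rle_trans with ((65 * (Rabs h * (10 + Rabs h)) + 16 + 3 * Rabs h) / w); [unfold Rdiv in *; lra|].
  apply Rmult_le_compat_r; [left; apply Rinv_0_lt_compat; auto|].
  rewrite <- (pow2_abs h). assert (0 <= Rabs h) by apply Rabs_pos. assert (0 <= (Rabs h - 1) ^ 2) by apply pow2_ge_0. nra.
Qed.

(** * A trigonometric kernel concentrated at the origin *)

Fixpoint zsum (f : Z -> R) (l : list Z) : R :=
  match l with [] => 0 | j :: l' => f j + zsum f l' end.

Lemma zsum_app f l1 l2 : zsum f (l1 ++ l2) = zsum f l1 + zsum f l2.
Proof. induction l1; simpl; [ring | rewrite IHl1; ring]. Qed.

Lemma zsum_map f g l : zsum f (map g l) = zsum (fun j => f (g j)) l.
Proof. induction l; simpl; [auto | rewrite IHl; auto]. Qed.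

Lemma zsum_plus f g l : zsum (fun j => f j + g j) l = zsum f l + zsum g l.
Proof. induction l; simpl; [ring | rewrite IHl; ring]. Qed.

Lemma zsum_scal a f l : zsum (fun j => a * f j) l = a * zsum f l.
Proof. induction l; simpl; [ring | rewrite IHl; ring]. Qed.

Lemma zsum_ext f g l : (forall j, In j l -> f j = g j) -> zsum f l = zsum g l.
Proof. intros H; induction l; simpl; auto. rewrite IHl, H; simpl; auto. intros; apply H; simpl; auto. Qed.

Lemma zsum_le f g l : (forall j, In j l -> f j <= g j) -> zsum f l <= zsum g l.
Proof.
intros H; induction l; simpl; [lra|]. assert (A := H a ltac:(simpl; auto)).
assert (zsum f l <= zsum g l) by (apply IHl; intros; apply H; simpl; auto). lra.
Qed.

Lemma zsum_const a l : zsum (fun _ => a) l = INR (length l) * a.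
Proof. induction l; [simpl; ring|]. simpl length. rewrite S_INR. simpl. rewrite IHl. ring. Qed.

(** Lists serve as multisets of frequencies. This is convolution with unit masses at d and - d,
    under which an average of cos(j x) acquires the factor cos(d x). *)
Definition step (d : Z) (l : list Z) : list Z := map (fun j => (j + d)%Z) l ++ map (fun j => (j - d)%Z) l.

Lemma zsum_cos_step d l x : zsum (fun j => cos (IZR j * x)) (step d l) =
  2 * cos (IZR d * x) * zsum (fun j => cos (IZR j * x)) l.
Proof.
unfold step. rewrite zsum_app, !zsum_map, <- zsum_plus, <- zsum_scal. apply zsum_ext. intros j _.
rewrite plus_IZR, minus_IZR, Rmult_plus_distr_r, Rmult_minus_distr_r, cos_plus, cos_minus. ring.
Qed.

Lemma step_length d l : length (step d l) = (2 * length l)%nat.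
Proof. unfold step. rewrite length_app, !length_map. lia. Qed.

(* The average of cos(j x) over [kl m] is cos x * (cos 2x * cos 4x * ... * cos (2^m x))^10. *)
Fixpoint kl (m : nat) : list Z :=
  match m with
  | O => [1%Z]
  | S m' => Nat.iter 10 (step (2 ^ Z.of_nat (S m'))) (kl m')
  end.

Fixpoint cosprod (m : nat) (x : R) : R :=
  match m with O => 1 | S m' => cosprod m' x * cos (2 ^ (S m') * x) end.

Definition avg (f : Z -> R) (l : list Z) : R := zsum f l / INR (length l).

Lemma avg_cos_step d l x : l <> [] -> avg (fun j => cos (IZR j * x)) (step d l) =
  cos (IZR d * x) * avg (fun j => cos (IZR j * x)) l.
Proof.
intros Hl. unfold avg. rewrite zsum_cos_step, step_length, mult_INR. simpl (INR 2). field.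
apply not_0_INR. destruct l; simpl; [congruence | lia].
Qed.

Lemma step_nonempty d l : l <> [] -> step d l <> [].
Proof. destruct l; simpl; [congruence | discriminate]. Qed.

Lemma avg_cos_iter n d l x : l <> [] -> Nat.iter n (step d) l <> [] /\
  avg (fun j => cos (IZR j * x)) (Nat.iter n (step d) l) = cos (IZR d * x) ^ n * avg (fun j => cos (IZR j * x)) l.
Proof.
intros Hl. induction n; [split; [auto | simpl; ring]|]. destruct IHn as [A B].
simpl Nat.iter. split; [apply step_nonempty; auto|]. rewrite avg_cos_step, B by auto. simpl; ring.
Qed.

Lemma kl_spec m x : kl m <> [] /\ avg (fun j => cos (IZR j * x)) (kl m) = cos x * cosprod m x ^ 10.
Proof.
induction m as [|m [A B]].
- split; [discriminate|]. unfold avg; simpl. rewrite Rmult_1_l. field.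
- destruct (avg_cos_iter 10 (2 ^ Z.of_nat (S m)) (kl m) x A) as [C D]. split; [exact C|].
  change (kl (S m)) with (Nat.iter 10 (step (2 ^ Z.of_nat (S m))) (kl m)). rewrite D, B, <- pow_IZR.
  change (cosprod (S m) x) with (cosprod m x * cos (2 ^ S m * x)). rewrite Rpow_mult_distr. ring.
Qed.

Lemma step_bound d l R : (forall j, In j l -> Z.odd j = true /\ (Z.abs j <= R)%Z) -> Z.even d = true -> (0 <= d)%Z ->
  forall j, In j (step d l) -> Z.odd j = true /\ (Z.abs j <= R + d)%Z.
Proof.
intros H Hd Hd0 j Hj. unfold step in Hj. apply in_app_or in Hj.
destruct Hj as [Hj|Hj]; apply in_map_iff in Hj; destruct Hj as [i [<- Hi]]; destruct (H i Hi) as [A B].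
- rewrite Z.odd_add, A, <- (Z.negb_even d), Hd. split; [auto | lia].
- rewrite Z.odd_sub, A, <- (Z.negb_even d), Hd. split; [auto | lia].
Qed.

Lemma iter_bound n d l R : (forall j, In j l -> Z.odd j = true /\ (Z.abs j <= R)%Z) -> Z.even d = true -> (0 <= d)%Z ->
  forall j, In j (Nat.iter n (step d) l) -> Z.odd j = true /\ (Z.abs j <= R + Z.of_nat n * d)%Z.
Proof.
intros H Hd Hd0. induction n.
- intros j Hj. destruct (H j Hj). split; auto. lia.
- intros j Hj. simpl Nat.iter in Hj. destruct (step_bound d _ _ IHn Hd Hd0 j Hj). split; auto. lia.
Qed.

Lemma kl_bound m : forall j, In j (kl m) -> Z.odd j = true /\ (Z.abs j <= 20 * 2 ^ Z.of_nat m - 19)%Z.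
Proof.
induction m.
- intros j [<-|[]]. split; auto; simpl; lia.
- intros j Hj. assert (E : (2 ^ Z.of_nat (S m) = 2 * 2 ^ Z.of_nat m)%Z) by (rewrite Nat2Z.inj_succ, Z.pow_succ_r; lia).
  assert (P : (0 <= 2 ^ Z.of_nat (S m))%Z) by (apply Z.pow_nonneg; lia).
  assert (Ev : Z.even (2 ^ Z.of_nat (S m)) = true) by (rewrite E, Z.even_mul; reflexivity).
  change (kl (S m)) with (Nat.iter 10 (step (2 ^ Z.of_nat (S m))) (kl m)) in Hj.
  destruct (iter_bound 10 (2 ^ Z.of_nat (S m)) (kl m) _ IHm Ev P j Hj) as [A B].
  split; [exact A|]. clear - B E. rewrite E in B. rewrite E. lia.
Qed.

Lemma kl_in m j : In j (kl m) -> 1 <= Rabs (IZR j) <= 20 * 2 ^ m.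
Proof.
intros H. destruct (kl_bound m j H) as [A B]. rewrite <- abs_IZR. split.
- apply IZR_le. assert (j <> 0%Z) by (intros ->; discriminate). lia.
- rewrite pow_IZR, <- mult_IZR. apply IZR_le. lia.
Qed.

Lemma avg_abs_le f l M : l <> [] -> (forall j, In j l -> Rabs (f j) <= M) -> Rabs (avg f l) <= M.
Proof.
intros Hl H. assert (HL : 0 < INR (length l)) by (apply lt_0_INR; destruct l; simpl; [congruence|lia]).
assert (U : zsum f l <= INR (length l) * M).
{ rewrite <- zsum_const. apply zsum_le. intros j Hj. eapply Rle_trans; [apply Rle_abs | apply H; auto]. }
assert (V : - (INR (length l) * M) <= zsum f l).
{ replace (- (INR (length l) * M)) with (INR (length l) * - M) by ring. rewrite <- zsum_const. apply zsum_le. intros j Hj.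
  specialize (H j Hj). apply Rabs_le_between in H. lra. }
unfold avg, Rdiv. rewrite Rabs_mult, (Rabs_pos_eq (/ _)) by (left; apply Rinv_0_lt_compat; auto).
apply Rmult_le_reg_r with (INR (length l)); auto. rewrite Rmult_assoc, Rinv_l, Rmult_1_r by lra.
apply Rabs_le. lra.
Qed.

Lemma avg_plus f g l : avg (fun j => f j + g j) l = avg f l + avg g l.
Proof. unfold avg. rewrite zsum_plus. unfold Rdiv; ring. Qed.

Lemma avg_scal a f l : avg (fun j => a * f j) l = a * avg f l.
Proof. unfold avg. rewrite zsum_scal. unfold Rdiv; ring. Qed.

(** The odd primitive of [kk]. Divided by [pI m] it is a smooth sign function on [- pi/4, pi/4];
    being a combination of sin(j x) / j, it can be applied to the frequencies of Z by shifting the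
    argument of Z by multiples j h0. *)
Definition pk (m : nat) (x : R) : R := avg (fun j => sin (IZR j * x) / IZR j) (kl m).

(** The exponent is even, which makes [kk] nonnegative on [- pi/2, pi/2], and gives the tail (2^m
    x)^(-10). The lone factor cos x makes every frequency odd, hence nonzero, so that the primitive
    is again a trigonometric polynomial. *)
Definition kk (m : nat) (x : R) : R := cos x * cosprod m x ^ 10.

Lemma pk_derive m x : is_derive (pk m) x (kk m x).
Proof.
unfold kk. rewrite <- (proj2 (kl_spec m x)). unfold pk, avg.
assert (G : forall l, (forall j, In j l -> IZR j <> 0) ->
  is_derive (fun x => zsum (fun j => sin (IZR j * x) / IZR j) l) x (zsum (fun j => cos (IZR j * x)) l)).
{ induction l as [|j l IH]; intros H; simpl.
  - apply (is_derive_const 0 x).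
  - apply (is_derive_plus (fun x => sin (IZR j * x) / IZR j)).
    + auto_derive; auto. field. apply H; simpl; auto.
    + apply IH. intros; apply H; simpl; auto. }
unfold Rdiv at 1. apply is_derive_ext with (fun x => / INR (length (kl m)) * zsum (fun j => sin (IZR j * x) / IZR j) (kl m)).
{ intros; apply Rmult_comm. }
unfold Rdiv. rewrite (Rmult_comm (zsum _ _)). apply is_derive_scal. apply G.
intros j Hj E. apply kl_in in Hj. rewrite E, Rabs_R0 in Hj. lra.
Qed.

Lemma pk_odd m x : pk m (- x) = - pk m x.
Proof.
unfold pk. replace (- avg (fun j => sin (IZR j * x) / IZR j) (kl m)) with (-1 * avg (fun j => sin (IZR j * x) / IZR j) (kl
  m)) by ring.
rewrite <- avg_scal. unfold avg. f_equal. apply zsum_ext. intros j _.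
replace (IZR j * - x) with (- (IZR j * x)) by ring. rewrite sin_neg. unfold Rdiv; ring.
Qed.

Lemma pk_0 m : pk m 0 = 0.
Proof. generalize (pk_odd m 0). rewrite Ropp_0. lra. Qed.

(** Repeated doubling of the angle collapses the product; the decay in [kk_tail] rests on this. *)
Lemma cosprod_sin m x : 2 ^ m * sin (2 * x) * cosprod m x = sin (2 ^ S m * x).
Proof.
induction m.
- simpl. rewrite !Rmult_1_r, Rmult_1_l. reflexivity.
- change (cosprod (S m) x) with (cosprod m x * cos (2 ^ S m * x)).
  replace (2 ^ S m * sin (2 * x) * (cosprod m x * cos (2 ^ S m * x))) with
    (2 * (2 ^ m * sin (2 * x) * cosprod m x) * cos (2 ^ S m * x)) by (simpl; ring).
  rewrite IHm. replace (2 ^ S (S m) * x) with (2 * (2 ^ S m * x)) by (simpl; ring). rewrite sin_2a. ring.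
Qed.

Lemma PI_gt_3 : 3 < PI.
Proof. generalize PI2_3_2; lra. Qed.

Lemma kk_nonneg m x : - (PI / 2) <= x <= PI / 2 -> 0 <= kk m x.
Proof.
intros Hx. unfold kk. apply Rmult_le_pos; [apply cos_ge_0; lra|].
replace (cosprod m x ^ 10) with ((cosprod m x ^ 5) ^ 2) by ring. apply pow2_ge_0.
Qed.

Lemma kk_tail m x : 0 < x <= PI / 4 -> kk m x <= / (2 ^ m * x) ^ 10.
Proof.
intros Hx. assert (HP := PI_gt_3).
assert (HJ : 0 < 2 ^ m) by (apply pow_lt; lra).
assert (A := sin_ge_chord (2 * x) ltac:(lra)). assert (PI <= 4) by apply PI_4.
assert (Hs : x <= sin (2 * x)).
{ eapply Rle_trans; [|apply A]. replace (2 / PI * (2 * x)) with (x * (4 / PI)) by (field; lra).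
  rewrite <- (Rmult_1_r x) at 1. apply Rmult_le_compat_l; [lra|].
  apply Rmult_le_reg_r with PI; [lra|]. unfold Rdiv. rewrite Rmult_assoc, Rinv_l; lra. }
assert (E := cosprod_sin m x). assert (B := SIN_bound (2 ^ S m * x)).
assert (C : Rabs (cosprod m x) <= / (2 ^ m * x)).
{ assert (Hd : 0 < 2 ^ m * x) by (apply Rmult_lt_0_compat; lra).
  apply Rmult_le_reg_l with (2 ^ m * x); auto. rewrite Rinv_r by lra.
  apply Rle_trans with (2 ^ m * sin (2 * x) * Rabs (cosprod m x)).
  - apply Rmult_le_compat_r; [apply Rabs_pos|]. apply Rmult_le_compat_l; lra.
  - rewrite <- (Rabs_pos_eq (2 ^ m * sin (2 * x))) by nra. rewrite <- Rabs_mult, E. apply Rabs_le. lra. }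
unfold kk. assert (D : Rabs (cosprod m x) ^ 10 <= (/ (2 ^ m * x)) ^ 10) by (apply pow_incr; split; [apply Rabs_pos | auto]).
rewrite RPow_abs, Rabs_pos_eq in D.
2:{ replace (cosprod m x ^ 10) with ((cosprod m x ^ 5) ^ 2) by ring. apply pow2_ge_0. }
rewrite pow_inv in D. assert (0 <= cosprod m x ^ 10) by (replace (cosprod m x ^ 10) with ((cosprod m x ^ 5) ^ 2) by ring;
  apply pow2_ge_0).
assert (CB := COS_bound x). nra.
Qed.

Lemma pk_mono m x y : - (PI / 2) <= x <= y -> y <= PI / 2 -> pk m x <= pk m y.
Proof.
intros H1 H2. destruct (MVT_gen (pk m) x y (kk m)) as [c [Hc E]].
- intros; apply pk_derive.
- intros z _. apply derivable_continuous_pt, ex_derive_Reals_0. eexists; apply pk_derive.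
- rewrite Rmin_left, Rmax_right in Hc by lra. assert (A := kk_nonneg m c ltac:(lra)). nra.
Qed.

Definition pI (m : nat) : R := pk m (PI / 4).

Lemma cos_ge_half_quadratic x : 1 - x ^ 2 / 2 <= cos x.
Proof.
assert (E : cos x = 1 - 2 * (sin (x / 2) * sin (x / 2))).
{ replace x with (2 * (x / 2)) at 1 by field. rewrite cos_2a_sin. ring. }
assert (A := sin_lipschitz (x / 2) 0). rewrite sin_0, !Rminus_0_r in A.
assert (sin (x / 2) * sin (x / 2) <= x / 2 * (x / 2)).
{ replace (sin (x / 2) * sin (x / 2)) with (Rsqr (sin (x / 2))) by (unfold Rsqr; ring).
  replace (x / 2 * (x / 2)) with (Rsqr (x / 2)) by (unfold Rsqr; ring). apply Rsqr_le_abs_1; auto. }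
rewrite E. simpl. lra.
Qed.

(** All frequencies are at most r = 20 2^m in absolute value, so every cos(j x), hence [kk], is at
    least 1/2 on [0, 1/r]. This interval alone contributes 1 / (2 r). *)
Lemma pI_lower m : / (40 * 2 ^ m) <= pI m.
Proof.
assert (HP := PI_gt_3). assert (HJ : 1 <= 2 ^ m) by (apply pow_R1_Rle; lra).
set (r := 20 * 2 ^ m). assert (Hr : 20 <= r) by (unfold r; lra).
assert (Hi : 0 < / r) by (apply Rinv_0_lt_compat; lra).
assert (Hi2 : / r <= / 20) by (apply Rinv_le_contravar; lra).
apply Rle_trans with (pk m (/ r)); [|apply pk_mono; lra].
destruct (MVT_gen (pk m) 0 (/ r) (kk m)) as [c [Hc E]].
- intros; apply pk_derive.
- intros z _. apply derivable_continuous_pt, ex_derive_Reals_0. eexists; apply pk_derive.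
- rewrite Rmin_left, Rmax_right in Hc by lra. rewrite pk_0, !Rminus_0_r in E. rewrite E.
  assert (K : 1 / 2 <= kk m c).
  { unfold kk. rewrite <- (proj2 (kl_spec m c)).
    assert (A := avg_abs_le (fun j => 1 + -1 * cos (IZR j * c)) (kl m) (1 / 2) (proj1 (kl_spec m c))).
    rewrite avg_plus, avg_scal in A.
    assert (E1 : avg (fun _ => 1) (kl m) = 1).
    { unfold avg. rewrite zsum_const. field. apply not_0_INR. generalize (proj1 (kl_spec m c)). destruct (kl m); simpl;
        [congruence|lia]. }
    rewrite E1 in A. assert (A' : Rabs (1 + -1 * avg (fun j => cos (IZR j * c)) (kl m)) <= 1 / 2).
    { apply A. intros j Hj. assert (B := cos_ge_half_quadratic (IZR j * c)). assert (CB := COS_bound (IZR j * c)).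
      apply kl_in in Hj. fold r in Hj.
      assert (Rabs (IZR j * c) <= 1).
      { rewrite Rabs_mult, (Rabs_pos_eq c) by lra. apply Rle_trans with (r * / r); [|rewrite Rinv_r; lra].
        apply Rmult_le_compat; try apply Rabs_pos; lra. }
      assert ((IZR j * c) ^ 2 <= 1) by (rewrite <- pow2_abs; generalize (Rabs_pos (IZR j * c)); nra).
      apply Rabs_le; lra. }
    apply Rabs_le_between in A'. lra. }
  replace (/ (40 * 2 ^ m)) with (1 / 2 * / r) by (unfold r; field; lra).
  apply Rmult_le_compat_r; lra.
Qed.

(** By [kk_tail], pk(y) + 1 / (9 J^10 y^9) with J = 2^m is nonincreasing up to pi/4. *)
Lemma pk_tail m x : 0 < x <= PI / 4 -> pI m - pk m x <= / 9 * / ((2 ^ m) ^ 10 * x ^ 9).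
Proof.
intros Hx. assert (HP := PI_gt_3). assert (HJ : 1 <= 2 ^ m) by (apply pow_R1_Rle; lra).
set (J := 2 ^ m) in *. assert (HJ10 : 0 < J ^ 10) by (apply pow_lt; lra).
set (F := fun y => pk m y + / 9 * / (J ^ 10 * y ^ 9)).
assert (DF : forall y, 0 < y -> is_derive F y (kk m y + - / (J * y) ^ 10)).
{ intros y Hy. apply (is_derive_plus (pk m)); [apply pk_derive|].
  assert (0 < y ^ 9) by (apply pow_lt; auto).
  auto_derive; [apply Rgt_not_eq, Rmult_lt_0_compat; auto|]. field. lra. }
destruct (MVT_gen F x (PI / 4) (fun y => kk m y + - / (J * y) ^ 10)) as [c [Hc E]].
- intros y Hy. rewrite Rmin_left, Rmax_right in Hy by lra. apply DF; lra.
- intros y Hy. rewrite Rmin_left, Rmax_right in Hy by lra. apply derivable_continuous_pt, ex_derive_Reals_0. eexists; apply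
    DF; lra.
- rewrite Rmin_left, Rmax_right in Hc by lra. assert (A := kk_tail m c ltac:(lra)). fold J in A.
  assert (B : F (PI / 4) - F x <= 0) by (rewrite E; nra).
  unfold F in B. fold (pI m) in B.
  assert (0 < / (J ^ 10 * (PI / 4) ^ 9)) by (apply Rinv_0_lt_compat, Rmult_lt_0_compat; auto; apply pow_lt; lra). lra.
Qed.

(** * The bound for Z *)

Lemma fst_Csum f n : fst (Csum f n) = Rsum (fun k => fst (f k)) n.
Proof. induction n; simpl; auto. rewrite <- IHn. reflexivity. Qed.

Lemma snd_Csum f n : snd (Csum f n) = Rsum (fun k => snd (f k)) n.
Proof. induction n; simpl; auto. rewrite <- IHn. reflexivity. Qed.

Lemma Rsum_ext f g n : (forall k, f k = g k) -> Rsum f n = Rsum g n.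
Proof. intros H; induction n; simpl; auto. rewrite IHn, H; auto. Qed.

Lemma Rsum_plus f g n : Rsum (fun k => f k + g k) n = Rsum f n + Rsum g n.
Proof. induction n; simpl; [ring|]. rewrite IHn. ring. Qed.

Lemma Rsum_avg (f : nat -> Z -> R) l n : Rsum (fun k => avg (f k) l) n = avg (fun j => Rsum (fun k => f k j) n) l.
Proof.
induction n; simpl.
- unfold avg. rewrite zsum_const. unfold Rdiv; ring.
- rewrite IHn. symmetry. apply avg_plus.
Qed.

(* A trigonometric sum close to a real function: its components with negative frequency are recovered from the reality, so the projection on positive frequencies suffices. *)
Lemma one_sided_projection (Z : R -> R) (b : nat -> Complex.C) (lam : nat -> R) N m h0 e0 e1 :
  0 < h0 ->
  Cmod (RtoC (Z 0) - Csum (fun k => b k * cis (0 * lam k)) N)%C <= e0 ->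
  (forall j, In j (kl m) -> Cmod (RtoC (Z (IZR j * h0)%R) - Csum (fun k => b k * cis (IZR j * h0 * lam k)) N)%C <= e1 * Rabs
    (IZR j)) ->
  (forall j, In j (kl m) -> Cmod (RtoC (Z (- (IZR j * h0))%R) - Csum (fun k => b k * cis (- (IZR j * h0) * lam k)) N)%C <=
    e1 * Rabs (IZR j)) ->
  Rabs (Z 0) <= Cmod (Csum (fun k => b k * RtoC (1 + pk m (h0 * lam k) / pI m)) N)%C + e0 + 40 * 2 ^ m * e1.
Proof.
intros Hh0 H0 H1 H2.
assert (HJ : 0 < 2 ^ m) by (apply pow_lt; lra). assert (HI := pI_lower m).
assert (HI0 : 0 < / (40 * 2 ^ m)) by (apply Rinv_0_lt_compat; lra).
set (S := fun x => Csum (fun k => b k * cis (x * lam k))%C N) in *.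
set (W := Rsum (fun k => fst (b k) * pk m (h0 * lam k)) N).
assert (Hsnd : forall x y, Rabs (snd (S x)) <= Cmod (RtoC y - S x)%C).
{ intros x y. assert (A := Im_le_Cmod (RtoC y - S x)%C). change (Rabs (0 + - snd (S x)) <= Cmod (RtoC y - S x)%C) in A.
  rewrite Rplus_0_l, Rabs_Ropp in A. exact A. }
(* As Z is real, the imaginary part of S is pure error. Its odd part in x is the sum of Re(b_k)
   sin(x lam_k), and averaging this at x = j h0 with weights 1/j rebuilds W. The weight 1/j also
   absorbs the growth of the error in j. *)
assert (HW : Rabs W <= e1).
{ assert (E : W = avg (fun j => (snd (S (IZR j * h0)) - snd (S (- (IZR j * h0)))) / (2 * IZR j)) (kl m)).
  { unfold W, pk. rewrite (Rsum_ext _ (fun k => avg (fun j => fst (b k) * (sin (IZR j * (h0 * lam k)) / IZR j)) (kl m))).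
    2:{ intros k. rewrite avg_scal. reflexivity. }
    rewrite Rsum_avg. unfold avg. f_equal. apply zsum_ext. intros j Hj. apply kl_in in Hj.
    assert (Hj0 : IZR j <> 0) by (intros E; rewrite E, Rabs_R0 in Hj; lra).
    unfold S. rewrite !snd_Csum.
    assert (E : forall x, Rsum (fun k => snd (b k * cis (x * lam k))%C) N = Rsum (fun k => fst (b k) * sin (x * lam k)) N +
      Rsum (fun k => snd (b k) * cos (x * lam k)) N).
    { intros x. rewrite <- Rsum_plus. apply Rsum_ext. intros k. unfold Cmult, cis; cbn [fst snd]. ring. }
    rewrite !E.
    rewrite (Rsum_ext (fun k => fst (b k) * sin (- (IZR j * h0) * lam k)) (fun k => -1 * (fst (b k) * sin (IZR j * h0 * lam k)))).
    2:{ intros k. rewrite Ropp_mult_distr_l_reverse, sin_neg. ring. }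
    rewrite (Rsum_ext (fun k => snd (b k) * cos (- (IZR j * h0) * lam k)) (fun k => snd (b k) * cos (IZR j * h0 * lam k))).
    2:{ intros k. rewrite Ropp_mult_distr_l_reverse, cos_neg. ring. }
    rewrite Rsum_scal.
    rewrite (Rsum_ext (fun k => fst (b k) * (sin (IZR j * (h0 * lam k)) / IZR j)) (fun k => / IZR j * (fst (b k) * sin (IZR
      j * h0 * lam k)))).
    2:{ intros k. rewrite Rmult_assoc. unfold Rdiv; ring. }
    rewrite Rsum_scal. field; auto. }
  rewrite E. apply avg_abs_le; [apply kl_spec; exact 0|]. intros j Hj.
  specialize (H1 j Hj). specialize (H2 j Hj). apply kl_in in Hj.
  assert (A1 := Rle_trans _ _ _ (Hsnd _ _) H1). assert (A2 := Rle_trans _ _ _ (Hsnd _ _) H2).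
  unfold Rdiv. rewrite Rabs_mult, Rabs_inv, Rabs_mult, (Rabs_pos_eq 2) by lra.
  assert (Hj0 : 0 < Rabs (IZR j)) by lra.
  apply Rmult_le_reg_r with (2 * Rabs (IZR j)); [lra|]. rewrite Rmult_assoc, Rinv_l, Rmult_1_r by lra.
  unfold Rminus. eapply Rle_trans; [apply Rabs_triang|]. rewrite Rabs_Ropp. lra. }
assert (HR : Rabs (Z 0 - fst (S 0)) <= e0).
{ assert (A := Re_le_Cmod (RtoC (Z 0) - S 0)%C). change (Rabs (Z 0 + - fst (S 0)) <= Cmod (RtoC (Z 0) - S 0)%C) in A.
  eapply Rle_trans; [exact A | exact H0]. }
(* Adding W / [pI m], small by [HW], changes the real part of S(0) into a sum with weights 1 + pk /
   pI, nearly 0 at negative frequencies and nearly 2 at positive ones. *)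
set (Y := Csum (fun k => b k * RtoC (1 + pk m (h0 * lam k) / pI m))%C N).
assert (EY : fst Y = fst (S 0) + / pI m * W).
{ unfold Y, S, W. rewrite !fst_Csum, <- Rsum_scal, <- Rsum_plus. apply Rsum_ext. intros k.
  unfold Cmult, cis, RtoC; cbn [fst snd]. rewrite Rmult_0_l, cos_0, sin_0. unfold Rdiv; ring. }
assert (BY := Re_le_Cmod Y).
replace (Z 0) with (fst Y + (Z 0 - fst (S 0)) - / pI m * W) by (rewrite EY; ring).
unfold Rminus at 1. eapply Rle_trans; [apply Rabs_triang|].
eapply Rle_trans; [apply Rplus_le_compat_r, Rabs_triang|]. rewrite Rabs_Ropp, Rabs_mult.
assert (Rabs (/ pI m) * Rabs W <= 40 * 2 ^ m * e1).
{ apply Rmult_le_compat; auto using Rabs_pos.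
  rewrite Rabs_pos_eq by (left; apply Rinv_0_lt_compat; lra).
  rewrite <- (Rinv_inv (40 * 2 ^ m)). apply Rinv_le_contravar; auto. }
lra.
Qed.

(** * Partial summation, dyadic blocks, and the tail beyond the cutoff *)

Lemma abel_summation (g : nat -> R) (e : nat -> Complex.C) K B :
  (forall k, 0 <= g (S k) <= g k) -> (forall m, (m <= K)%nat -> Cmod (Csum e m) <= B) ->
  Cmod (Csum (fun k => RtoC (g k) * e k)%C K) <= g 0%nat * B.
Proof.
intros Hg HB.
assert (A : forall n, (n <= K)%nat -> Cmod (Csum (fun k => RtoC (g k) * e k)%C n - RtoC (g n) * Csum e n)%C <= (g 0%nat - g
  n) * B).
{ induction n; intros Hn.
  - simpl. replace (0 - RtoC (g 0%nat) * 0)%C with (RtoC 0) by (unfold RtoC, Cminus, Cplus, Copp, Cmult; cbn [fst snd];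
      f_equal; ring).
    rewrite Cmod_0. lra.
  - rewrite !Csum_S.
    replace (Csum (fun k => RtoC (g k) * e k)%C n + RtoC (g n) * e n - RtoC (g (S n)) * (Csum e n + e n))%C
     with ((Csum (fun k => RtoC (g k) * e k)%C n - RtoC (g n) * Csum e n) + RtoC (g n - g (S n)) * Csum e (S n))%C
     by (rewrite Csum_S, RtoC_minus; ring).
    eapply Rle_trans; [apply Cmod_triangle|]. rewrite Cmod_mult, Cmod_R, Rabs_pos_eq by (specialize (Hg n); lra).
    specialize (IHn ltac:(lia)). specialize (HB (S n) Hn). specialize (Hg n).
    assert ((g n - g (S n)) * Cmod (Csum e (S n)) <= (g n - g (S n)) * B) by (apply Rmult_le_compat_l; lra). lra. }
specialize (A K ltac:(lia)).
replace (Csum (fun k => RtoC (g k) * e k)%C K) with ((Csum (fun k => RtoC (g k) * e k)%C K - RtoC (g K) * Csum e K) + RtoC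
  (g K) * Csum e K)%C by ring.
eapply Rle_trans; [apply Cmod_triangle|]. rewrite Cmod_mult, Cmod_R.
assert (GK : 0 <= g K) by (destruct K; [specialize (Hg 0%nat); lra | apply Hg]).
rewrite Rabs_pos_eq by auto. specialize (HB K ltac:(lia)).
assert (g K * Cmod (Csum e K) <= g K * B) by (apply Rmult_le_compat_l; auto). lra.
Qed.

Lemma expsum_nat t a b : (1 <= a <= b)%nat ->
  expsum_re t (INR a) (INR b) = Rsum (fun k => cos (t * ln (INR (a + k)))) (b - a) /\
  expsum_im t (INR a) (INR b) = Rsum (fun k => sin (t * ln (INR (a + k)))) (b - a).
Proof.
intros Hab.
assert (G : forall f : nat -> R, sum_f_R0 (fun n => if Rle_dec (INR a) (INR n) then
     if Rlt_dec (INR n) (INR b) then (if Nat.eq_dec n 0 then 0 else f n) else 0 else 0) (Z.to_nat (up (INR b)))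
   = Rsum (fun k => f (a + k)%nat) (b - a)).
{ intros f. set (F := fun n => _).
  assert (F0 : forall n, (n < a)%nat -> F n = 0).
  { intros n Hn. unfold F. destruct (Rle_dec (INR a) (INR n)) as [H|]; auto. apply INR_le in H. lia. }
  assert (F1 : forall n, (a <= n < b)%nat -> F n = f n).
  { intros n Hn. unfold F. destruct (Rle_dec (INR a) (INR n)) as [H|H]; [|exfalso; apply H, le_INR; lia].
    destruct (Rlt_dec (INR n) (INR b)) as [H2|H2]; [|exfalso; apply H2, lt_INR; lia].
    destruct (Nat.eq_dec n 0); [lia|auto]. }
  assert (F2 : forall n, (b <= n)%nat -> F n = 0).
  { intros n Hn. unfold F. destruct (Rle_dec (INR a) (INR n)) as [H|H]; auto.
    destruct (Rlt_dec (INR n) (INR b)) as [H2|H2]; auto. apply INR_lt in H2. lia. }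
  assert (Hup : (b <= Z.to_nat (up (INR b)))%nat).
  { rewrite INR_IZR_INZ. assert (E : up (IZR (Z.of_nat b)) = (Z.of_nat b + 1)%Z).
    { symmetry. apply tech_up; rewrite plus_IZR; simpl; lra. }
    rewrite E. lia. }
  assert (SF : forall n, sum_f_R0 F n = Rsum F (S n)).
  { induction n; [simpl; ring|]. rewrite tech5, IHn. reflexivity. }
  rewrite SF.
  assert (S1 : forall n, (b <= n)%nat -> Rsum F n = Rsum F b).
  { intros n Hn. induction Hn; auto. simpl. rewrite IHHn, F2 by lia. ring. }
  rewrite S1 by lia.
  assert (S2 : forall n, (n <= a)%nat -> Rsum F n = 0).
  { induction n; intros Hn; auto. simpl. rewrite IHn, F0 by lia. ring. }
  assert (S3 : forall k, (a + k <= b)%nat -> Rsum F (a + k) = Rsum (fun k => f (a + k)%nat) k).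
  { induction k; intros Hk; [rewrite Nat.add_0_r; apply S2; lia|].
    rewrite Nat.add_succ_r. simpl. rewrite IHk, F1 by lia. reflexivity. }
  rewrite <- S3 by lia. f_equal; lia. }
unfold expsum_re, expsum_im. split; apply G.
Qed.

Lemma expsum_Csum t a b : (1 <= a <= b)%nat ->
  Cmod (Csum (fun k => cis (- (t * ln (INR (a + k))))) (b - a)) = sqrt (expsum_re t (INR a) (INR b) ^ 2 + expsum_im t (INR
    a) (INR b) ^ 2).
Proof.
intros Hab. destruct (expsum_nat t a b Hab) as [-> ->].
unfold Cmod. f_equal. rewrite fst_Csum, snd_Csum. unfold cis; cbn [fst snd].
rewrite (Rsum_ext (fun k => cos (- (t * ln (INR (a + k))))) (fun k => cos (t * ln (INR (a + k))))) by (intros; apply cos_neg).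
rewrite (Rsum_ext (fun k => sin (- (t * ln (INR (a + k))))) (fun k => -1 * sin (t * ln (INR (a + k))))) by (intros; rewrite
  sin_neg; ring).
rewrite Rsum_scal. ring.
Qed.

(** At most i dyadic blocks lie below x, the last one truncated, and each costs 2 Bd: Abel summation
    takes out the nonincreasing factor s(n) / sqrt n, at most 2 / sqrt a at the start a of the
    block, against the bound Bd sqrt a. *)
Lemma dyadic_sum T Bd n0 (s : nat -> R) : 0 <= Bd ->
  (forall a b, (1 <= a <= b)%nat -> (b <= 2 * a)%nat -> (b <= n0)%nat ->
     Cmod (Csum (fun k => cis (- (T * ln (INR (a + k))))) (b - a)) <= Bd * sqrt (INR a)) ->
  (forall n, (1 <= n)%nat -> 0 <= s (S n) <= s n /\ s n <= 2) ->
  forall i x, (1 <= x <= n0)%nat -> (x <= 2 ^ i)%nat ->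
  Cmod (Csum (fun k => RtoC (/ sqrt (INR (S k)) * s (S k)) * cis (- (T * ln (INR (S k)))))%C (x - 1)) <= INR i * (2 * Bd).
Proof.
intros HBd HE Hs i. induction i; intros x Hx Hxi.
- simpl in Hxi. replace (x - 1)%nat with 0%nat by lia. simpl. rewrite Cmod_0. lra.
- rewrite S_INR. destruct (le_lt_dec x (2 ^ i)) as [L|L].
  { specialize (IHi x Hx L). lra. }
  set (a := (2 ^ i)%nat) in *.
  assert (Ha : (1 <= a)%nat) by (assert (H := Nat.pow_nonzero 2 i ltac:(lia)); unfold a; lia).
  assert (Hxa : (x <= 2 * a)%nat) by (unfold a; simpl in Hxi; lia).
  replace (x - 1)%nat with ((a - 1) + (x - a))%nat by lia. rewrite Csum_split. cbv beta.
  eapply Rle_trans; [apply Cmod_triangle|].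
  specialize (IHi a ltac:(lia) ltac:(lia)).
  rewrite (Csum_ext (fun k => RtoC (/ sqrt (INR (S (a - 1 + k))) * s (S (a - 1 + k))) * cis (- (T * ln (INR (S (a - 1 +
    k))))))%C (fun k => RtoC (/ sqrt (INR (a + k)) * s (a + k)%nat) * cis (- (T * ln (INR (a + k)))))%C).
  2:{ intros k _. replace (S (a - 1 + k)) with (a + k)%nat by lia. reflexivity. }
  assert (HaR : 0 < sqrt (INR a)) by (apply sqrt_lt_R0, lt_0_INR; lia).
  assert (A : Cmod (Csum (fun k => RtoC (/ sqrt (INR (a + k)) * s (a + k)%nat) * cis (- (T * ln (INR (a + k)))))%C (x - a))
     <= (/ sqrt (INR (a + 0)) * s (a + 0)%nat) * (Bd * sqrt (INR a))).
  { apply (abel_summation (fun k => / sqrt (INR (a + k)) * s (a + k)%nat)).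
    - intros k. rewrite Nat.add_succ_r. destruct (Hs (a + k)%nat ltac:(lia)) as [[B1 B2] B3].
      assert (P1 : 0 < INR (a + k)) by (apply lt_0_INR; lia).
      assert (P2 : 0 < sqrt (INR (a + k))) by (apply sqrt_lt_R0; auto).
      assert (P3 : / sqrt (INR (S (a + k))) <= / sqrt (INR (a + k))).
      { apply Rinv_le_contravar; auto. apply sqrt_le_1_alt. rewrite S_INR; lra. }
      assert (P4 : 0 < / sqrt (INR (S (a + k)))) by (apply Rinv_0_lt_compat, sqrt_lt_R0, lt_0_INR; lia).
      split; [apply Rmult_le_pos; lra | apply Rmult_le_compat; lra].
    - intros m Hm. specialize (HE a (a + m)%nat ltac:(lia) ltac:(lia) ltac:(lia)).
      replace (a + m - a)%nat with m in HE by lia. auto. }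
  rewrite Nat.add_0_r in A. destruct (Hs a Ha) as [_ S2].
  replace (/ sqrt (INR a) * s a * (Bd * sqrt (INR a))) with (s a * Bd) in A by (field; lra).
  assert (s a * Bd <= 2 * Bd) by (apply Rmult_le_compat_r; auto). lra.
Qed.

Lemma Rsum_S f n : Rsum f (S n) = Rsum f n + f n.
Proof. reflexivity. Qed.

Lemma Rsum_inv_sqrt n0 K : Rsum (fun k => / sqrt (INR (S (n0 + k)))) K <= 2 * sqrt (INR (n0 + K)).
Proof.
induction K; [simpl; generalize (sqrt_pos (INR (n0 + 0))); lra|].
rewrite Rsum_S, Nat.add_succ_r.
assert (M : / sqrt (INR (S (n0 + K))) <= 2 * sqrt (INR (S (n0 + K))) - 2 * sqrt (INR (n0 + K))).
{ rewrite S_INR. assert (HN := pos_INR (n0 + K)). set (a := sqrt (INR (n0 + K))). set (b := sqrt (INR (n0 + K) + 1)).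
  assert (Ha : 0 <= a) by apply sqrt_pos. assert (Hb : 0 < b) by (apply sqrt_lt_R0; lra).
  assert (Ea : a * a = INR (n0 + K)) by (apply sqrt_sqrt; lra). assert (Eb : b * b = INR (n0 + K) + 1) by (apply sqrt_sqrt; lra).
  apply Rmult_le_reg_r with b; auto. rewrite Rinv_l by lra.
  assert (0 <= (b - a) * (b - a)) by nra. nra. }
lra.
Qed.

(** Past P the weights are at most 2 on a transition zone of length B and then fall off like (B / (n
    - P))^2, which sums to O(B); these terms carry a factor at most 1 / sqrt n0. The floor D meets
    the full sum of n^(-1/2). *)
Lemma tail_sum P B D n0 (s : nat -> R) K : 1 <= INR n0 -> P - 1 <= INR n0 -> 0 < B -> 0 <= D ->
  (forall n, (n0 <= n < n0 + K)%nat -> 0 <= s n <= 2) ->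
  (forall n, (n0 <= n < n0 + K)%nat -> P + B <= INR n -> s n <= 5 * (B / (INR n - P)) ^ 2 + D) ->
  Rsum (fun k => / sqrt (INR (n0 + k)) * s (n0 + k)%nat) K <= (7 * B + 8) / sqrt (INR n0) + 2 * D * sqrt (INR (n0 + K)).
Proof.
intros Hn0 HP HB HD Hs1 Hs2.
assert (HsN : 0 < sqrt (INR n0)) by (apply sqrt_lt_R0; lra).
assert (Hi : forall k, 0 < / sqrt (INR (n0 + k)) <= / sqrt (INR n0)).
{ intros k. rewrite plus_INR. assert (Hk := pos_INR k). split; [apply Rinv_0_lt_compat, sqrt_lt_R0; lra|].
  apply Rinv_le_contravar; auto. apply sqrt_le_1_alt; lra. }
(* Up to P + B + 1 each term costs 2. Beyond, the quadratic decay is dominated by 5 B^2 times 1 / (X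
   - 1 - P) - 1 / (X - P), which telescopes. The allowance 2 (B + 4) covers the terms before the
   switch, since n0 >= P - 1. *)
assert (G : forall k, (k <= K)%nat -> Rsum (fun k => / sqrt (INR (n0 + k)) * s (n0 + k)%nat) k <=
  / sqrt (INR n0) * (if Rle_dec (INR (n0 + k)) (P + B + 1) then 2 * INR k else 2 * (B + 4) + 5 * B ^ 2 * (/ B - / (INR (n0 +
    k) - 1 - P)))
   + D * Rsum (fun k => / sqrt (INR (n0 + k))) k).
{ induction k; intros Hk.
  - simpl Rsum. assert (P1 : 0 < / sqrt (INR n0)) by (apply Rinv_0_lt_compat; auto).
    destruct (Rle_dec (INR (n0 + 0)) (P + B + 1)) as [H|H]; [change (INR 0) with 0; rewrite !Rmult_0_r; lra|].
    rewrite Nat.add_0_r in *. assert (/ (INR n0 - 1 - P) <= / B) by (apply Rinv_le_contravar; lra).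
    assert (0 <= B ^ 2) by apply pow2_ge_0.
    assert (0 <= 5 * B ^ 2 * (/ B - / (INR n0 - 1 - P))) by (apply Rmult_le_pos; lra).
    rewrite Rmult_0_r, Rplus_0_r. apply Rmult_le_pos; lra.
  - specialize (IHk ltac:(lia)). rewrite !Rsum_S, Nat.add_succ_r, S_INR, S_INR.
    destruct (Hs1 (n0 + k)%nat ltac:(lia)) as [S0 S2]. destruct (Hi k) as [I0 I1].
    set (X := INR (n0 + k)) in *. set (r := Rsum (fun k => / sqrt (INR (n0 + k)) * s (n0 + k)%nat) k) in *.
    set (q := Rsum (fun k => / sqrt (INR (n0 + k))) k) in *.
    assert (Ex : X = INR n0 + INR k) by (unfold X; rewrite plus_INR; auto).
    set (ik := / sqrt X) in *. set (i0 := / sqrt (INR n0)) in *. set (sn := s (n0 + k)%nat) in *.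
    assert (DI : 0 <= D * ik) by nra.
    assert (C1 : ik * sn <= i0 * 2) by (apply Rmult_le_compat; lra).
    destruct (Rle_dec (X + 1) (P + B + 1)) as [H|H].
    + destruct (Rle_dec X (P + B + 1)) as [H2|H2]; [|lra]. lra.
    + destruct (Rle_dec X (P + B + 1)) as [H2|H2].
      * assert (A : INR k <= B + 3) by lra.
        assert (/ (X + 1 - 1 - P) <= / B) by (apply Rinv_le_contravar; lra).
        assert (0 <= B ^ 2) by apply pow2_ge_0.
        assert (i0 * (2 * INR k + 2) <= i0 * (2 * (B + 4) + 5 * B ^ 2 * (/ B - / (X + 1 - 1 - P)))) by (apply
          Rmult_le_compat_l; nra).
        lra.
      * assert (T := Hs2 (n0 + k)%nat ltac:(lia) ltac:(fold X; lra)). fold X sn in T.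
        assert (E : 5 * (B / (X - P)) ^ 2 <= 5 * B ^ 2 * (/ (X - 1 - P) - / (X - P))).
        { replace (/ (X - 1 - P) - / (X - P)) with (/ ((X - 1 - P) * (X - P))) by (field; lra).
          replace (5 * (B / (X - P)) ^ 2) with (5 * B ^ 2 * / ((X - P) * (X - P))) by (field; lra).
          apply Rmult_le_compat_l; [nra|]. apply Rinv_le_contravar; [apply Rmult_lt_0_compat; lra|].
          apply Rmult_le_compat_r; lra. }
        set (d := 5 * B ^ 2 * (/ (X - 1 - P) - / (X - P))) in *.
        assert (Hd : 0 <= d) by (eapply Rle_trans; [|apply E]; generalize (pow2_ge_0 (B / (X - P))); lra).
        replace (X + 1 - 1 - P) with (X - P) by ring.
        replace (i0 * (2 * (B + 4) + 5 * B ^ 2 * (/ B - / (X - P)))) with (i0 * (2 * (B + 4) + 5 * B ^ 2 * (/ B - / (X - 1 -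
          P))) + i0 * d) by (unfold d; ring).
        assert (ik * sn <= ik * (d + D)) by (apply Rmult_le_compat_l; lra).
        assert (ik * d <= i0 * d) by (apply Rmult_le_compat_r; lra). lra. }
specialize (G K ltac:(lia)).
assert (R1 : Rsum (fun k => / sqrt (INR (n0 + k))) K <= 2 * sqrt (INR (n0 + K))).
{ destruct n0 as [|n]; [simpl in Hn0; lra|].
  assert (A := Rsum_inv_sqrt n K). eapply Rle_trans; [apply A|].
  apply Rmult_le_compat_l; [lra|]. apply sqrt_le_1_alt, le_INR; lia. }
assert (D * Rsum (fun k => / sqrt (INR (n0 + k))) K <= D * (2 * sqrt (INR (n0 + K)))) by (apply Rmult_le_compat_l; auto).
assert (P1 : 0 < / sqrt (INR n0)) by (apply Rinv_0_lt_compat; auto).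
assert (i1 : (if Rle_dec (INR (n0 + K)) (P + B + 1) then 2 * INR K else 2 * (B + 4) + 5 * B ^ 2 * (/ B - / (INR (n0 + K) - 1
  - P))) <= 7 * B + 8).
{ destruct (Rle_dec (INR (n0 + K)) (P + B + 1)) as [H1|H1].
  - rewrite plus_INR in H1. lra.
  - assert (0 < / (INR (n0 + K) - 1 - P)) by (apply Rinv_0_lt_compat; lra).
    assert (0 < B ^ 2) by (apply pow_lt; auto).
    replace (5 * B ^ 2 * (/ B - / (INR (n0 + K) - 1 - P))) with (5 * B - 5 * B ^ 2 * / (INR (n0 + K) - 1 - P)) by (field;
      lra). nra. }
assert (/ sqrt (INR n0) * (if Rle_dec (INR (n0 + K)) (P + B + 1) then 2 * INR K else 2 * (B + 4) + 5 * B ^ 2 * (/ B - / (INR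
  (n0 + K) - 1 - P))) <= / sqrt (INR n0) * (7 * B + 8)) by (apply Rmult_le_compat_l; lra).
unfold Rdiv. lra.
Qed.

Lemma pow2_floor x : 1 <= x -> exists m, 2 ^ m <= x < 2 * 2 ^ m.
Proof.
intros Hx. destruct (nat_ceil x ltac:(lra)) as [N HN].
assert (B : x < 2 ^ S N).
{ apply Rle_lt_trans with (INR N); [lra|]. clear. induction N; [simpl; lra|].
  rewrite S_INR. assert (1 <= 2 ^ N) by (apply pow_R1_Rle; lra). simpl in *. lra. }
revert B. generalize (S N). induction n; intros B.
- simpl in B. lra.
- destruct (Rlt_dec x (2 ^ n)) as [L|L]; [auto|]. exists n. simpl in B. lra.
Qed.

Lemma exp_Lam T : 0 < T -> exp (Lam T) = sqrt (T / (2 * PI)).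
Proof.
intros HT. assert (HP := PI_gt_3). assert (H : 0 < T / (2 * PI)) by (apply Rdiv_lt_0_compat; lra).
rewrite <- (sqrt_pow2 (exp (Lam T))) by (left; apply exp_pos). f_equal.
simpl. rewrite Rmult_1_r, <- exp_plus. unfold Lam. replace (ln (T / (2 * PI)) / 2 + ln (T / (2 * PI)) / 2) with (ln (T / (2
  * PI))) by field.
apply exp_ln; auto.
Qed.

Lemma Lam_bounds T : 30 <= ln T -> 0 < T -> ln T / 4 <= Lam T <= ln T / 2.
Proof.
intros Hl HT. assert (HP := PI_gt_3). assert (HP4 := PI_4). unfold Lam. rewrite ln_div by lra.
assert (0 <= ln (2 * PI)) by (rewrite <- ln_1; apply ln_le; lra).
assert (ln (2 * PI) <= 3).
{ apply Rle_trans with (ln 8); [apply ln_le; lra|]. rewrite <- (ln_exp 3). apply ln_le; [lra|].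
  replace 3 with (1 + 1 + 1) by ring. rewrite !exp_plus. assert (A := exp_ineq1 1 ltac:(lra)). nra. }
lra.
Qed.

Lemma Lam_cutoff T N : 30 <= ln T -> 0 < T -> 1 <= INR N <= T ^ 3 + 1 -> ln (INR N) <= 7 * Lam T.
Proof.
intros Hl HT HN. assert (HP := PI_gt_3). assert (HP4 := PI_4).
assert (H1 : 1 <= T). { apply Rnot_lt_le. intros H. assert (ln T < ln 1) by (apply ln_increasing; auto). rewrite ln_1 in *. lra. }
assert (H3 : 1 <= T ^ 3) by (apply pow_R1_Rle; auto).
apply Rle_trans with (ln (2 * T ^ 3)); [apply ln_le; lra|].
rewrite ln_mult, ln_pow by lra. simpl (INR 3).
assert (ln (2 * PI) <= 3).
{ apply Rle_trans with (ln 8); [apply ln_le; lra|]. rewrite <- (ln_exp 3). apply ln_le; [lra|].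
  replace 3 with (1 + 1 + 1) by ring. rewrite !exp_plus. assert (A := exp_ineq1 1 ltac:(lra)). nra. }
assert (ln 2 <= 3) by (apply Rle_trans with (ln (2 * PI)); [apply ln_le; lra|auto]).
unfold Lam. rewrite ln_div by lra. lra.
Qed.

(** * The smooth cutoff at sqrt(T / (2 pi)) *)

Section SmoothWeight.

Variables (T : R) (N m : nat).
Hypothesis HT : 0 < T.
Hypothesis Hl : 30 <= ln T.
Hypothesis HN : 1 <= INR N <= T ^ 3 + 1.

Let L := Lam T.
Let h0 := / (8 * L).
Let P := sqrt (T / (2 * PI)).
Let J := 2 ^ m.

(* A smooth cutoff replacing twice the indicator of ln x <= Lam T, i.e. of x <= sqrt (T / (2 pi)). *)
Definition weight (x : R) : R := 1 + pk m (/ (8 * Lam T) * (Lam T - ln x)) / pI m.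

(** The step h0 = 1 / (8 L) is made for this: 0 <= ln x <= 7 L puts the angle in [-3/4, 1/8], inside
    the range where [pk] acts as a sign function. *)
Lemma weight_angle x : 1 <= x <= INR N -> - (PI / 4) <= h0 * (L - ln x) <= PI / 4.
Proof.
intros Hx. assert (HP := PI_gt_3). destruct (Lam_bounds T Hl HT) as [L1 L2]. fold L in L1, L2.
assert (Lc := Lam_cutoff T N Hl HT HN). fold L in Lc.
assert (0 <= ln x) by (rewrite <- ln_1; apply ln_le; lra).
assert (ln x <= 7 * L) by (apply Rle_trans with (2 := Lc), ln_le; lra).
assert (Hh : 0 < h0) by (apply Rinv_0_lt_compat; lra).
assert (E : h0 * (8 * L) = 1) by (unfold h0; field; lra). nra.
Qed.

Lemma pI_pos : 0 < pI m.
Proof. eapply Rlt_le_trans; [|apply pI_lower]. apply Rinv_0_lt_compat. assert (0 < 2 ^ m) by (apply pow_lt; lra). lra. Qed.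

Lemma weight_mono x y : 1 <= x <= y -> y <= INR N -> 0 <= weight y <= weight x /\ weight x <= 2.
Proof.
intros Hx Hy. assert (HP := PI_gt_3). assert (HI := pI_pos).
assert (A := weight_angle x ltac:(lra)). assert (B := weight_angle y ltac:(lra)).
destruct (Lam_bounds T Hl HT) as [L1 L2].
assert (Hh : 0 < h0) by (apply Rinv_0_lt_compat; fold L in L1; lra).
assert (ln x <= ln y) by (apply ln_le; lra).
assert (M1 : pk m (h0 * (L - ln y)) <= pk m (h0 * (L - ln x))) by (apply pk_mono; nra).
assert (M2 : - pI m <= pk m (h0 * (L - ln y))).
{ unfold pI. rewrite <- pk_odd. apply pk_mono; lra. }
assert (M3 : pk m (h0 * (L - ln x)) <= pI m) by (apply pk_mono; lra).
unfold weight. fold L h0.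
set (u := pk m (h0 * (L - ln y))) in *. set (v := pk m (h0 * (L - ln x))) in *.
assert (G : forall z, - pI m <= z -> - 1 <= z / pI m).
{ intros z Hz. apply Rmult_le_reg_r with (pI m); auto. unfold Rdiv. rewrite Rmult_assoc, Rinv_l; lra. }
assert (G2 : v / pI m <= 1). { apply Rmult_le_reg_r with (pI m); auto. unfold Rdiv. rewrite Rmult_assoc, Rinv_l; lra. }
assert (G3 : u / pI m <= v / pI m) by (apply Rmult_le_compat_r; auto; left; apply Rinv_0_lt_compat; auto).
specialize (G u M2). lra.
Qed.

(** Here the weight is (pI - pk(th)) / pI; the tail (1/9) J^(-10) th^(-9) over pI >= 1 / (40 J)
    leaves (40/9) (J th)^(-9). *)
Lemma weight_decay x w : P < x -> x <= INR N -> 0 < w <= J * (h0 * ln (x / P)) -> weight x <= 5 * / w ^ 9.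
Proof.
intros Hx HxN Hw. assert (HP := PI_gt_3). assert (HI := pI_pos).
destruct (Lam_bounds T Hl HT) as [L1 L2]. fold L in L1, L2.
assert (EP : exp L = P) by (apply exp_Lam; auto).
assert (P1 : 1 <= P) by (rewrite <- EP; generalize (exp_ineq1_le L); lra).
assert (A := weight_angle x ltac:(lra)).
assert (Hh : 0 < h0) by (apply Rinv_0_lt_compat; lra).
assert (EL : ln P = L) by (rewrite <- EP; apply ln_exp).
set (th := h0 * ln (x / P)) in *.
assert (Eth : h0 * (L - ln x) = - th) by (unfold th; rewrite ln_div, EL by lra; ring).
assert (HJ : 0 < J) by (apply pow_lt; lra).
assert (Hth : 0 < th) by nra.
assert (B := pk_tail m th ltac:(lra)). fold J in B.
assert (HIl := pI_lower m). fold J in HIl.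
unfold weight. fold L h0. rewrite Eth, pk_odd.
assert (J10 : 0 < J ^ 10 * th ^ 9) by (apply Rmult_lt_0_compat; apply pow_lt; auto).
assert (Hinv : / pI m <= 40 * J).
{ rewrite <- (Rinv_inv (40 * J)). apply Rinv_le_contravar; auto. apply Rinv_0_lt_compat; lra. }
replace (1 + - pk m th / pI m) with ((pI m - pk m th) * / pI m) by (field; lra).
apply Rle_trans with (/ 9 * / (J ^ 10 * th ^ 9) * (40 * J)).
- assert (M : pk m th <= pI m) by (apply pk_mono; lra).
  apply Rmult_le_compat; auto; [lra | left; apply Rinv_0_lt_compat; auto].
- replace (/ 9 * / (J ^ 10 * th ^ 9) * (40 * J)) with (40 / 9 * / (J * th) ^ 9) by (field; lra).
  assert (W9 : 0 < w ^ 9) by (apply pow_lt; lra).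
  assert (/ (J * th) ^ 9 <= / w ^ 9) by (apply Rinv_le_contravar; auto; apply pow_incr; lra).
  assert (0 < / w ^ 9) by (apply Rinv_0_lt_compat; auto). lra.
Qed.

Let B := 16 * P * L / J.
Let D := 5 * (16 * L / J) ^ 9.

Lemma weight_far x : 2 * P <= x -> x <= INR N -> weight x <= D.
Proof.
intros Hx HxN. destruct (Lam_bounds T Hl HT) as [L1 L2]. fold L in L1, L2.
assert (EP : exp L = P) by (apply exp_Lam; auto).
assert (P1 : 1 <= P) by (rewrite <- EP; generalize (exp_ineq1_le L); lra).
assert (HJ : 0 < J) by (apply pow_lt; lra).
assert (Hh : 0 < h0) by (apply Rinv_0_lt_compat; lra).
replace D with (5 * / (J * (h0 * / 2)) ^ 9) by (unfold D, h0; field; lra).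
apply weight_decay; try lra. split.
- apply Rmult_lt_0_compat; [auto|]. apply Rmult_lt_0_compat; lra.
- apply Rmult_le_compat_l; [lra|]. apply Rmult_le_compat_l; [lra|].
  apply Rle_trans with (ln 2); [generalize ln_lt_2; lra|]. apply ln_le; [lra|].
  apply Rmult_le_reg_r with P; [lra|]. unfold Rdiv. rewrite Rmult_assoc, Rinv_l; lra.
Qed.

(** For x < 2 P, ln(x / P) >= (x - P) / (2 P) makes J h0 ln(x / P) at least (x - P) / B, which is
    where the value of B comes from; of the ninth power only the square is kept, as much as
    [tail_sum] asks. From 2 P on the floor D takes over. *)
Lemma weight_near x : P + B <= x -> x <= INR N -> weight x <= 5 * (B / (x - P)) ^ 2 + D.
Proof.
intros Hx HxN. destruct (Lam_bounds T Hl HT) as [L1 L2]. fold L in L1, L2.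
assert (EP : exp L = P) by (apply exp_Lam; auto).
assert (P1 : 1 <= P) by (rewrite <- EP; generalize (exp_ineq1_le L); lra).
assert (HJ : 0 < J) by (apply pow_lt; lra).
assert (Hh : 0 < h0) by (apply Rinv_0_lt_compat; lra).
assert (HB : 0 < B).
{ unfold B. apply Rdiv_lt_0_compat; auto. apply Rmult_lt_0_compat; lra. }
assert (HD : 0 <= D).
{ unfold D. apply Rmult_le_pos; [lra|]. apply pow_le, Rdiv_le_0_compat; lra. }
destruct (Rle_dec (2 * P) x) as [H2|H2].
{ eapply Rle_trans; [apply weight_far; auto|]. generalize (pow2_ge_0 (B / (x - P))); lra. }
assert (Hw : 0 < (x - P) / B <= J * (h0 * ln (x / P))).
{ split; [apply Rdiv_lt_0_compat; lra|].
  replace ((x - P) / B) with (J * (h0 * ((x - P) / (2 * P)))) by (unfold B, h0; field; lra).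
  apply Rmult_le_compat_l; [lra|]. apply Rmult_le_compat_l; [lra|].
  destruct (ln_bounds (x / P) ltac:(apply Rdiv_lt_0_compat; lra)) as [A _].
  eapply Rle_trans; [|apply A]. replace (1 - / (x / P)) with ((x - P) / x) by (field; lra).
  apply Rmult_le_compat_l; [lra|]. apply Rinv_le_contravar; lra. }
assert (W := weight_decay x _ ltac:(lra) HxN Hw).
assert (Q : 1 <= (x - P) / B). { apply Rmult_le_reg_r with B; auto. unfold Rdiv. rewrite Rmult_assoc, Rinv_l; lra. }
assert (/ ((x - P) / B) ^ 9 <= (B / (x - P)) ^ 2).
{ replace (B / (x - P)) with (/ ((x - P) / B)) by (field; lra). rewrite pow_inv.
  apply Rinv_le_contravar; [apply pow_lt; lra|]. apply Rle_pow; auto; lia. }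
lra.
Qed.

End SmoothWeight.

(** The range is cut at the integer part n0 of sqrt(T / (2 pi)). Below it the hypothesis is applied
    on O(ln T) dyadic blocks; above it absolute values suffice, since the decaying weights leave
    only O(ln T). *)
Lemma Z_bound Delta A t0 : 0 < Delta -> 0 < A ->
  (forall t a b, t0 <= t -> 0 < a -> a <= b -> b <= 2 * a -> b <= sqrt (t / (2 * PI)) ->
     sqrt (expsum_re t a b ^ 2 + expsum_im t a b ^ 2) < A * sqrt a * Rpower t Delta) ->
  exists C T1, 0 < C /\ forall T, T1 <= T -> Rabs (Zfun T) <= C * (Rpower T Delta * ln T).
Proof.
intros HD HA Hyp.
(* The constant in (ln T)^9 <= K9 T^(3/4), from [pow_exp_bound] at b = 3/4. *)
set (K9 := INR (fact 9) / (3 / 4) ^ 9).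
assert (HK9 : 0 < K9) by (apply Rdiv_lt_0_compat; [apply INR_fact_lt_0 | apply pow_lt; lra]).
set (K := 15360 * 16 ^ 9 * K9).
assert (H16 : 0 < 16 ^ 9) by (apply pow_lt; lra).
assert (HK : 0 < K) by (unfold K; apply Rmult_lt_0_compat; lra).
exists (4 * A + 336700 + K), (Rmax t0 (exp 30)). split; [lra|].
intros T HTT.
assert (Ht0 : t0 <= T) by (eapply Rle_trans; [apply Rmax_l | eauto]).
assert (HTe : exp 30 <= T) by (eapply Rle_trans; [apply Rmax_r | eauto]).
assert (HT31 : 31 <= T) by (generalize (exp_ineq1_le 30); lra).
assert (HT : 0 < T) by lra.
assert (Hl : 30 <= ln T) by (rewrite <- (ln_exp 30); apply ln_le; [apply exp_pos | auto]).
set (ell := ln T) in *.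
(* This is T^(1/4), and J = 2^m will lie within a factor 2 of it. That order of J keeps the
   projection error J^2 / sqrt T bounded and makes the transition zone B / sqrt P = 16 L sqrt P / J
   of order ln T. *)
set (x := exp (ell / 4)).
assert (Hx4 : x ^ 4 = T).
{ unfold x. simpl. rewrite Rmult_1_r, <- !exp_plus.
  replace (ell / 4 + (ell / 4 + (ell / 4 + ell / 4))) with ell by field. apply exp_ln; auto. }
assert (Hx1 : 8 <= x) by (unfold x; generalize (exp_ineq1_le (ell / 4)); lra).
assert (Hx2 : sqrt T = x ^ 2) by (rewrite <- Hx4; replace (x ^ 4) with ((x ^ 2) ^ 2) by ring; apply sqrt_pow2, pow2_ge_0).
destruct (pow2_floor x ltac:(lra)) as [m [Hm1 Hm2]].
assert (HmL : INR m <= ell / 2).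
{ assert (Hln := ln_lt_2). assert (Hln2 := ln_le _ _ (pow_lt 2 m ltac:(lra)) Hm1). rewrite ln_pow in Hln2 by lra.
  unfold x in Hln2. rewrite ln_exp in Hln2. assert (P := pos_INR m). nra. }
assert (HJ1 : 4 < 2 ^ m) by lra.
destruct (Z_approx T ltac:(lra)) as [N [b [HN [Hb [HbN HZ]]]]].
assert (HT3 : T <= T ^ 3 /\ 1 <= T ^ 3) by (split; nra).
assert (HN1 : 1 <= INR N <= T ^ 3 + 1) by lra.
destruct (Lam_bounds T Hl HT) as [L1 L2]. fold ell in L1, L2.
assert (EP := exp_Lam T HT).
assert (HP3 := PI_gt_3).
assert (WM := weight_mono T N m HT Hl HN1).
assert (WN := weight_near T N m HT Hl HN1). assert (WF := weight_far T N m HT Hl HN1).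
set (P := sqrt (T / (2 * PI))) in *. set (L := Lam T) in *. set (J := 2 ^ m) in *.
set (B := 16 * P * L / J) in *. set (D := 5 * (16 * L / J) ^ 9) in *.
assert (HP1 : 8 <= P) by (rewrite <- EP; generalize (exp_ineq1_le L); lra).
assert (HPT : P <= x ^ 2).
{ rewrite <- Hx2. apply sqrt_le_1_alt. apply Rmult_le_reg_r with (2 * PI); [lra|]. unfold Rdiv. rewrite Rmult_assoc, Rinv_l,
    Rmult_1_r by lra. nra. }
assert (HPN : 2 * P <= INR N).
{ apply Rle_trans with (T ^ 3); [|lra]. apply Rle_trans with (2 * T); [|nra]. rewrite <- Hx4. nra. }
assert (HB : 0 < B) by (unfold B; apply Rdiv_lt_0_compat; [apply Rmult_lt_0_compat; lra | lra]).
assert (HD0 : 0 <= D) by (unfold D; apply Rmult_le_pos; [lra|]; apply pow_le, Rdiv_le_0_compat; lra).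
destruct (nfloor_ex P ltac:(lra)) as [n0 [Hn0 Hn0']].
assert (Hn01 : (1 <= n0)%nat) by (apply INR_le; simpl; lra).
assert (Hn0N : (n0 < N)%nat) by (apply INR_lt; lra).
set (Tp := Rpower T Delta) in *.
assert (HTp : 1 <= Tp).
{ unfold Tp, Rpower. fold ell. rewrite <- exp_0. apply exp_le. apply Rmult_le_pos; lra. }
set (h0 := / (8 * L)). assert (Hh0 : 0 < h0 <= 1).
{ unfold h0. split; [apply Rinv_0_lt_compat; lra|]. rewrite <- Rinv_1. apply Rinv_le_contravar; lra. }
set (lam := fun k => L - ln (INR (S k))).
set (F := fun k => (b (S k) * RtoC (weight T m (INR (S k))))%C).
assert (Main : Rabs (Zfun T) <= Cmod (Csum F N) + 400 / sqrt T + 40 * J * (400 * (1 + 20 * J) / sqrt T)).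
{ assert (Hs : 0 < sqrt T) by (apply sqrt_lt_R0; auto).
  assert (A1 := one_sided_projection (fun h => Zfun (T + h)) (fun k => b (S k)) lam N m h0 (400 / sqrt T) (400 * (1 + 20 *
    J) / sqrt T) (proj1 Hh0)).
  cbv beta in A1. rewrite Rplus_0_r in A1.
  assert (Herr : forall j, In j (kl m) -> Rabs (IZR j * h0) <= T / 2 /\ 400 * (1 + (IZR j * h0) ^ 2) / sqrt T <= 400 * (1 +
    20 * J) / sqrt T * Rabs (IZR j)).
  { intros j Hj. apply kl_in in Hj. fold J in Hj.
    assert (R1 : Rabs (IZR j * h0) <= Rabs (IZR j)).
    { rewrite Rabs_mult, (Rabs_pos_eq h0) by lra. generalize (Rabs_pos (IZR j)); nra. }
    split.
    - apply (Rle_trans _ _ _ R1). apply Rle_trans with (20 * x); [lra|]. rewrite <- Hx4.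
      assert (64 <= x * x) by nra. assert (512 <= x * (x * x)) by nra. simpl. nra.
    - replace (400 * (1 + 20 * J) / sqrt T * Rabs (IZR j)) with (400 * ((1 + 20 * J) * Rabs (IZR j)) / sqrt T) by (field; lra).
      apply Rmult_le_compat_r; [left; apply Rinv_0_lt_compat; auto|]. apply Rmult_le_compat_l; [lra|].
      rewrite <- pow2_abs. assert (0 <= Rabs (IZR j * h0)) by apply Rabs_pos. nra. }
  apply A1.
  - assert (A2 := HZ 0 ltac:(rewrite Rabs_R0; lra)). rewrite Rplus_0_r in A2.
    replace (400 * (1 + 0 ^ 2) / sqrt T) with (400 / sqrt T) in A2 by (field; lra). exact A2.
  - intros j Hj. destruct (Herr j Hj) as [E1 E2]. eapply Rle_trans; [|apply E2]. apply HZ; auto.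
  - intros j Hj. destruct (Herr j Hj) as [E1 E2]. eapply Rle_trans; [|apply E2].
    replace ((IZR j * h0) ^ 2) with ((- (IZR j * h0)) ^ 2) by ring. apply HZ. rewrite Rabs_Ropp; auto. }
assert (B1 : Cmod (Csum F (n0 - 1)) <= INR (2 * m + 2) * (2 * (A * Tp))).
{ set (s := fun n => weight T m (Rmin (INR n) (INR N))).
  rewrite (Csum_ext F (fun k => cis (vartheta T) * (RtoC (/ sqrt (INR (S k)) * s (S k)) * cis (- (T * ln (INR (S k))))))%C).
  2:{ intros k Hk. unfold F, s. rewrite Hb by lia. rewrite Rmin_left by (apply le_INR; lia).
      unfold Rminus. rewrite cis_plus, RtoC_mult. ring. }
  rewrite Csum_scal, Cmod_mult, Cmod_cis, Rmult_1_l.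
  apply dyadic_sum with (n0 := n0).
  - apply Rmult_le_pos; lra.
  - intros a b' Hab H2 H3. rewrite expsum_Csum by auto. left.
    assert (Hb' : INR b' <= P) by (apply le_INR in H3; lra).
    replace (A * Tp * sqrt (INR a)) with (A * sqrt (INR a) * Tp) by ring.
    apply Hyp; auto; [apply lt_0_INR; lia | apply le_INR; lia |].
    apply le_INR in H2. rewrite mult_INR in H2. exact H2.
  - intros n Hn. unfold s. apply le_INR in Hn. simpl in Hn. apply WM; [|apply Rmin_r].
    split; [apply Rmin_glb; lra|]. rewrite S_INR. unfold Rmin. destruct (Rle_dec (INR n) (INR N)); destruct (Rle_dec (INR n
      + 1) (INR N)); lra.
  - lia.
  (* P <= x^2 <= (2 J)^2 = 2^(2m + 2), so 2m + 2 blocks reach n0. *)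
  - apply INR_le. rewrite pow_INR. simpl (INR 2). replace (1 + 1) with 2 by ring.
    apply Rle_trans with P; auto. apply (Rle_trans _ _ _ HPT).
    replace (2 ^ (2 * m + 2)) with ((2 * J) ^ 2) by (unfold J; replace (2 * m + 2)%nat with (S m + S m)%nat by lia; rewrite
      pow_add; simpl; ring).
    apply pow_incr; lra. }
assert (EN : N = ((n0 - 1) + ((N - n0) + 1))%nat) by lia.
assert (B2 : Cmod (Csum (fun k => F (n0 - 1 + k)%nat) (N - n0)) <= (7 * B + 8) / sqrt (INR n0) + 2 * D * sqrt (INR N)).
{ eapply Rle_trans; [apply Cmod_Csum|].
  apply Rle_trans with (Rsum (fun k => / sqrt (INR (n0 + k)) * weight T m (INR (n0 + k))) (N - n0)).
  - apply Rsum_le. intros k Hk. unfold F. replace (S (n0 - 1 + k)) with (n0 + k)%nat by lia.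
    rewrite Hb by lia. assert (Hnk : 1 <= INR (n0 + k) <= INR N) by (split; [apply (le_INR 1); lia | apply le_INR; lia]).
    destruct (WM (INR (n0 + k)) (INR (n0 + k)) ltac:(lra) ltac:(lra)) as [[W0 _] _].
    rewrite !Cmod_mult, Cmod_cis, !Cmod_R, Rmult_1_r, (Rabs_pos_eq (weight _ _ _)), Rabs_pos_eq; auto; try lra.
    left; apply Rinv_0_lt_compat, sqrt_lt_R0; lra.
  - replace (sqrt (INR N)) with (sqrt (INR (n0 + (N - n0)))) by (do 2 f_equal; lia).
    apply (tail_sum P B D n0 (fun n => weight T m (INR n))); auto; try lra.
    + intros n Hn. assert (Hnk : 1 <= INR n <= INR N) by (split; [apply (le_INR 1); lia | apply le_INR; lia]).
      destruct (WM (INR n) (INR n) ltac:(lra) ltac:(lra)) as [[W0 _] W2]. lra.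
    + intros n Hn Hn2. apply WN; auto. apply le_INR; lia. }
assert (B3 : Cmod (F (N - 1)%nat) <= 2 * sqrt T * D).
{ unfold F. replace (S (N - 1)) with N by lia. rewrite Cmod_mult, Cmod_R.
  destruct (WM (INR N) (INR N) ltac:(lra) ltac:(lra)) as [[W0 _] _]. rewrite Rabs_pos_eq by auto.
  apply Rmult_le_compat; auto using Cmod_ge_0. apply WF; lra. }
assert (BF : Cmod (Csum F N) <= INR (2 * m + 2) * (2 * (A * Tp)) + ((7 * B + 8) / sqrt (INR n0) + 2 * D * sqrt (INR N)) + 2
  * sqrt T * D).
{ rewrite EN at 1. rewrite Csum_split, Csum_split.
  eapply Rle_trans; [apply Cmod_triangle|].
  assert (X : Cmod (Csum (fun k => F (n0 - 1 + k)%nat) (N - n0) + Csum (fun k => F (n0 - 1 + (N - n0 + k))%nat) 1)%C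
    <= ((7 * B + 8) / sqrt (INR n0) + 2 * D * sqrt (INR N)) + 2 * sqrt T * D).
  { eapply Rle_trans; [apply Cmod_triangle|]. apply Rplus_le_compat; auto.
    simpl. rewrite Cplus_0_l. replace (n0 - 1 + (N - n0 + 0))%nat with (N - 1)%nat by lia. auto. }
  lra. }
assert (N1 : (7 * B + 8) / sqrt (INR n0) <= 448 * L + 8).
{ assert (Hs0 : 1 <= sqrt (INR n0)) by (rewrite <- sqrt_1; apply sqrt_le_1_alt; lra).
  assert (Es0 : sqrt (INR n0) * sqrt (INR n0) = INR n0) by (apply sqrt_sqrt; lra).
  set (r := sqrt (INR n0)) in *.
  assert (Hr : r <= 2 * J).
  { apply Rle_trans with x; [|lra]. unfold r. rewrite <- (sqrt_pow2 x) by lra. apply sqrt_le_1_alt. lra. }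
  assert (HPr : P <= 2 * (r * r)) by lra.
  assert (BB : B / r <= 64 * L).
  { apply Rmult_le_reg_r with (r * J); [apply Rmult_lt_0_compat; lra|].
    replace (B / r * (r * J)) with (16 * P * L) by (unfold B; field; lra).
    apply Rle_trans with (16 * (2 * (r * r)) * L); [apply Rmult_le_compat_r; lra|].
    replace (64 * L * (r * J)) with (32 * r * L * (2 * J)) by ring.
    replace (16 * (2 * (r * r)) * L) with (32 * r * L * r) by ring.
    apply Rmult_le_compat_l; auto. apply Rmult_le_pos; lra. }
  assert (/ r <= 1) by (rewrite <- Rinv_1; apply Rinv_le_contravar; lra).
  replace ((7 * B + 8) / r) with (7 * (B / r) + 8 * / r) by (field; lra). lra. }
(* x^6 = T^(3/2) is the order of sqrt N. The ninth power in D beats it: x^6 (L / J)^9 is of order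
   L^9 / x^3, bounded because L is logarithmic. This is what the exponent 10 of the kernel pays
   for. *)
assert (HxJ : x ^ 6 * D <= 2560 * 16 ^ 9 * K9).
{ assert (HJx : x / 2 < J) by lra.
  assert (L9 : L ^ 9 <= K9 * x ^ 3).
  { apply Rle_trans with (ell ^ 9); [apply pow_incr; lra|].
    eapply Rle_trans; [apply (pow_exp_bound 9 ell (3 / 4)); lra|]. fold K9. right. f_equal.
    unfold x. simpl. rewrite Rmult_1_r, <- !exp_plus. f_equal. field. }
  assert (J9 : x ^ 9 <= 512 * J ^ 9).
  { replace 512 with (2 ^ 9) by ring. rewrite <- Rpow_mult_distr. apply pow_incr; lra. }
  assert (PJ9 : 0 < J ^ 9) by (apply pow_lt; lra).
  unfold D. apply Rmult_le_reg_r with (J ^ 9); auto.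
  replace (x ^ 6 * (5 * (16 * L / J) ^ 9) * J ^ 9) with (5 * 16 ^ 9 * (x ^ 6 * L ^ 9)).
  2:{ unfold Rdiv. rewrite !Rpow_mult_distr, pow_inv. field. lra. }
  assert (x ^ 6 * L ^ 9 <= K9 * x ^ 9).
  { replace (K9 * x ^ 9) with (x ^ 6 * (K9 * x ^ 3)) by ring. apply Rmult_le_compat_l; auto. apply pow_le; lra. }
  assert (K9 * x ^ 9 <= K9 * (512 * J ^ 9)) by (apply Rmult_le_compat_l; lra).
  apply Rle_trans with (5 * 16 ^ 9 * (K9 * (512 * J ^ 9))); [|right; ring].
  apply Rmult_le_compat_l; lra. }
assert (N2 : 2 * D * sqrt (INR N) + 2 * sqrt T * D <= K).
{ assert (sqrt (INR N) <= 2 * x ^ 6).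
  { rewrite <- (sqrt_pow2 (2 * x ^ 6)) by (apply Rmult_le_pos; [lra|apply pow_le; lra]). apply sqrt_le_1_alt.
    apply (Rle_trans _ _ _ (proj2 HN)). rewrite <- Hx4. replace ((2 * x ^ 6) ^ 2) with (4 * (x ^ 4) ^ 3) by ring. rewrite
      Hx4. lra. }
  assert (sqrt T <= x ^ 6).
  { rewrite Hx2. apply Rle_pow; [lra|lia]. }
  assert (2 * D * sqrt (INR N) <= 2 * D * (2 * x ^ 6)) by (apply Rmult_le_compat_l; lra).
  assert (2 * sqrt T * D <= 2 * x ^ 6 * D) by (apply Rmult_le_compat_r; lra).
  unfold K. lra. }
assert (N3 : 400 / sqrt T + 40 * J * (400 * (1 + 20 * J) / sqrt T) <= 336400).
{ rewrite Hx2. assert (Q : 1 <= x ^ 2) by (apply pow_R1_Rle; lra).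
  apply Rmult_le_reg_r with (x ^ 2); [lra|].
  replace ((400 / x ^ 2 + 40 * J * (400 * (1 + 20 * J) / x ^ 2)) * x ^ 2) with (400 + 16000 * (J * (1 + 20 * J))) by (field; lra).
  assert (J * J <= x ^ 2) by (replace (x ^ 2) with (x * x) by ring; apply Rmult_le_compat; lra).
  assert (J <= x ^ 2) by (apply Rle_trans with (J * J); [rewrite <- (Rmult_1_r J) at 1; apply Rmult_le_compat_l; lra | auto]).
  lra. }
assert (N4 : INR (2 * m + 2) <= 2 * ell).
{ rewrite plus_INR, mult_INR. simpl (INR 2). lra. }
assert (HAT : 0 < A * Tp) by (apply Rmult_lt_0_compat; lra).
assert (N5 : INR (2 * m + 2) * (2 * (A * Tp)) <= 2 * ell * (2 * (A * Tp))) by (apply Rmult_le_compat_r; lra).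
assert (N6 : ell <= Tp * ell) by (rewrite <- (Rmult_1_l ell) at 1; apply Rmult_le_compat_r; lra).
assert (N7 : K <= K * (Tp * ell)) by (rewrite <- (Rmult_1_r K) at 1; apply Rmult_le_compat_l; lra).
lra.
Qed.

(** * Averaged increments of Z *)

Definition mavg (J : nat) (x : nat -> Complex.C) (i : nat) : Complex.C :=
  (RtoC (/ INR J) * Csum (fun l => x (i + l)%nat) J)%C.

Fixpoint mit (J k : nat) (x : nat -> Complex.C) : nat -> Complex.C :=
  match k with O => x | S k' => mit J k' (mavg J x) end.

Lemma mavg_bound J x i B : (1 <= J)%nat -> (forall l, (l < J)%nat -> Cmod (x (i + l)%nat) <= B) -> Cmod (mavg J x i) <= B.
Proof.
intros HJ H. assert (HJ' : 0 < INR J) by (apply lt_0_INR; lia).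
unfold mavg. rewrite Cmod_mult, Cmod_R, Rabs_pos_eq by (left; apply Rinv_0_lt_compat; auto).
apply Rmult_le_reg_l with (INR J); auto. rewrite <- Rmult_assoc, Rinv_r, Rmult_1_l by lra.
rewrite <- Rsum_const. eapply Rle_trans; [apply Cmod_Csum | apply Rsum_le; auto].
Qed.

Lemma mit_bound J k x i B : (1 <= J)%nat -> (forall j, (i <= j <= i + k * J)%nat -> Cmod (x j) <= B) -> Cmod (mit J k x i) <= B.
Proof.
intros HJ. revert x. induction k; intros x H; simpl.
- apply H; lia.
- apply IHk. intros j Hj. apply mavg_bound; auto. intros l Hl. apply H. simpl. lia.
Qed.

Lemma mavg_plus J x y i : mavg J (fun j => x j + y j)%C i = (mavg J x i + mavg J y i)%C.
Proof. unfold mavg. rewrite Csum_plus. ring. Qed.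

Lemma mavg_ext J x y : (forall i, x i = y i) -> forall i, mavg J x i = mavg J y i.
Proof. intros H i. unfold mavg. f_equal. apply Csum_ext; auto. Qed.

Lemma mit_ext J k x y : (forall i, x i = y i) -> forall i, mit J k x i = mit J k y i.
Proof. revert x y; induction k; intros x y H i; simpl; auto. apply IHk. apply mavg_ext; auto. Qed.

Lemma mit_plus J k x y i : mit J k (fun j => x j + y j)%C i = (mit J k x i + mit J k y i)%C.
Proof.
revert x y; induction k; intros x y; simpl; auto.
rewrite <- IHk. apply mit_ext. intros j. apply mavg_plus.
Qed.

(** The normalised geometric sum, by which one average multiplies the exponential e^(i j p). *)
Definition dker (J : nat) (p : R) : Complex.C := (RtoC (/ INR J) * Csum (fun l => cis (INR l * p)) J)%C.

Lemma mavg_cis J N (c : nat -> Complex.C) (p : nat -> R) i :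
  mavg J (fun j => Csum (fun n => c n * cis (INR j * p n))%C N) i =
  Csum (fun n => (c n * dker J (p n)) * cis (INR i * p n))%C N.
Proof.
unfold mavg. rewrite Csum_swap, <- Csum_scal. apply Csum_ext. intros n _.
rewrite (Csum_ext _ (fun l => (c n * cis (INR i * p n)) * cis (INR l * p n))%C).
- rewrite Csum_scal. unfold dker. ring.
- intros l _. rewrite plus_INR, Rmult_plus_distr_r, cis_plus. ring.
Qed.

Fixpoint Cpw (z : Complex.C) (n : nat) : Complex.C := match n with O => 1%C | S m => (z * Cpw z m)%C end.

Lemma Cmod_Cpw z n : Cmod (Cpw z n) = Cmod z ^ n.
Proof. induction n; simpl; [apply Cmod_1 | rewrite Cmod_mult, IHn; auto]. Qed.

Lemma mit_cis J k N (c : nat -> Complex.C) (p : nat -> R) i :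
  mit J k (fun j => Csum (fun n => c n * cis (INR j * p n))%C N) i =
  Csum (fun n => (c n * Cpw (dker J (p n)) k) * cis (INR i * p n))%C N.
Proof.
revert c. induction k; intros c; simpl.
- apply Csum_ext; intros; ring.
- rewrite (mit_ext J k _ (fun j => Csum (fun n => (c n * dker J (p n)) * cis (INR j * p n))%C N)) by (intros; apply mavg_cis).
  rewrite IHk. apply Csum_ext; intros; ring.
Qed.

Lemma dker_0 J : (1 <= J)%nat -> dker J 0 = 1%C.
Proof.
intros HJ. unfold dker. rewrite (Csum_ext _ (fun _ => 1%C)) by (intros; rewrite Rmult_0_r; apply cis_0).
assert (E : forall n, Csum (fun _ => 1%C) n = RtoC (INR n)).
{ induction n; [reflexivity|]. rewrite Csum_S, IHn, S_INR, RtoC_plus. reflexivity. }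
rewrite E, <- RtoC_mult, Rinv_l; auto. apply not_0_INR; lia.
Qed.

(** The geometric sum has numerator at most 2 and denominator |1 - e^(ip)| >= |sin p|. *)
Lemma dker_bound J p : (1 <= J)%nat -> 0 < Rabs (sin p) -> Cmod (dker J p) <= 2 / (INR J * Rabs (sin p)).
Proof.
intros HJ Hp. assert (HJ' : 0 < INR J) by (apply lt_0_INR; lia).
assert (E : forall n, ((1 - cis p) * Csum (fun l => cis (INR l * p)) n = 1 - cis (INR n * p))%C).
{ induction n; [simpl; rewrite Rmult_0_l, cis_0; ring|].
  rewrite Csum_S, S_INR, Rmult_plus_distr_r, Rmult_1_l, cis_plus.
  replace ((1 - cis p) * (Csum (fun l => cis (INR l * p)) n + cis (INR n * p)))%C
    with ((1 - cis p) * Csum (fun l => cis (INR l * p)) n + (1 - cis p) * cis (INR n * p))%C by ring.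
  rewrite IHn. ring. }
assert (A : Rabs (sin p) <= Cmod (1 - cis p)%C).
{ assert (A := Im_le_Cmod (1 - cis p)%C). change (Rabs (0 + - sin p) <= Cmod (1 - cis p)%C) in A.
  rewrite Rplus_0_l, Rabs_Ropp in A. exact A. }
assert (Bd : Cmod (1 - cis (INR J * p))%C <= 2).
{ eapply Rle_trans; [apply Cmod_triangle|]. rewrite Cmod_opp, Cmod_cis, Cmod_1. lra. }
rewrite <- E, Cmod_mult in Bd.
unfold dker. rewrite Cmod_mult, Cmod_R, Rabs_pos_eq by (left; apply Rinv_0_lt_compat; auto).
set (S := Cmod (Csum (fun l => cis (INR l * p)) J)) in *.
assert (HS : 0 <= S) by apply Cmod_ge_0.
apply Rmult_le_reg_r with (INR J * Rabs (sin p)); [apply Rmult_lt_0_compat; auto|].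
replace (/ INR J * S * (INR J * Rabs (sin p))) with (Rabs (sin p) * S) by (field; lra).
replace (2 / (INR J * Rabs (sin p)) * (INR J * Rabs (sin p))) with 2 by (field; lra).
apply Rle_trans with (2 := Bd). apply Rmult_le_compat_r; auto.
Qed.

Lemma constant_sign_sum (d : nat -> R) J : (forall l, (l < J)%nat -> 0 <= d l) \/ (forall l, (l < J)%nat -> d l <= 0) ->
  Rsum (fun l => Rabs (d l)) J = Rabs (Rsum d J).
Proof.
intros [H|H].
- assert (A : forall n, (n <= J)%nat -> Rsum (fun l => Rabs (d l)) n = Rsum d n /\ 0 <= Rsum d n).
  { induction n; intros Hn; [simpl; lra|]. rewrite !Rsum_S. destruct (IHn ltac:(lia)) as [-> P].
    specialize (H n ltac:(lia)). rewrite Rabs_pos_eq by auto. lra. }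
  destruct (A J (Nat.le_refl _)) as [-> P]. rewrite Rabs_pos_eq; auto.
- assert (A : forall n, (n <= J)%nat -> Rsum (fun l => Rabs (d l)) n = - Rsum d n /\ Rsum d n <= 0).
  { induction n; intros Hn; [simpl; lra|]. rewrite !Rsum_S. destruct (IHn ltac:(lia)) as [-> P].
    specialize (H n ltac:(lia)). rewrite Rabs_left1 by auto. lra. }
  destruct (A J (Nat.le_refl _)) as [-> P]. rewrite Rabs_left1; auto.
Qed.

(* Averaging the increments against cis (- j L h0) isolates the term n = 1 of the Dirichlet polynomial. *)
Lemma increments_lower_bound T (h0 := / (8 * Lam T)) J k H :
  30 <= ln T -> 0 < T -> (1 <= J)%nat -> INR (k + 3) * INR J * h0 <= H -> 1 <= H <= T / 2 ->
  800 * (1 + H ^ 2) / sqrt T <= 1 / 64 ->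
  12 * T ^ 2 * (8 / (INR J * h0)) ^ (S k) <= 1 / 64 ->
  1 / 32 <= Cmod (mit J (S k) (fun j => cis (- (INR j * (Lam T * h0))) * RtoC (Zfun (T + (INR j + 2) * h0) - Zfun (T + (INR
    j + 1) * h0)))%C 0).
Proof.
intros Hl HT HJ HH HHT HE1 HE2.
assert (HT31 : 31 <= T).
{ assert (E : exp (ln T) = T) by (apply exp_ln; auto). generalize (exp_ineq1_le (ln T)). lra. }
destruct (Z_approx T ltac:(lra)) as [N [b [HN [Hb [HbN HZ]]]]].
assert (HT3 : T <= T ^ 3) by nra.
assert (HN1 : 1 <= INR N <= T ^ 3 + 1) by lra.
destruct (Lam_bounds T Hl HT) as [L1 L2].
assert (Lc := Lam_cutoff T N Hl HT HN1).
set (L := Lam T) in *.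
assert (Hh0 : 0 < h0 <= 1).
{ unfold h0. split; [apply Rinv_0_lt_compat; lra|]. rewrite <- Rinv_1. apply Rinv_le_contravar; lra. }
assert (ELh : L * h0 = 1 / 8) by (unfold h0; field; lra).
assert (HJ' : 1 <= INR J) by (apply (le_INR 1); auto).
set (lam := fun n => L - ln (INR (S n))).
set (c := fun n => (b (S n) * (cis (2 * h0 * lam n) - cis (h0 * lam n)))%C).
(* The factor e^(- i j L h0) turns the frequency L - ln(n + 1) into - ln(n + 1), so the entry n = 0
   no longer depends on j. *)
set (p := fun n => - (h0 * ln (INR (S n)))).
set (Sx := fun h => Csum (fun n => b (S n) * cis (h * lam n))%C N).
set (er := fun j : nat => (cis (- (INR j * (L * h0))) * ((RtoC (Zfun (T + (INR j + 2) * h0)) - Sx ((INR j + 2) * h0)%R) -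
  (RtoC (Zfun (T + (INR j + 1) * h0)) - Sx ((INR j + 1) * h0)%R)))%C).
assert (Ex : forall j, (cis (- (INR j * (L * h0))) * RtoC (Zfun (T + (INR j + 2) * h0) - Zfun (T + (INR j + 1) * h0)))%C
   = (Csum (fun n => c n * cis (INR j * p n)) N + er j)%C).
{ intros j.
  assert (E : Csum (fun n => c n * cis (INR j * p n))%C N = (cis (- (INR j * (L * h0))) * (Sx ((INR j + 2) * h0)%R - Sx
    ((INR j + 1) * h0)%R))%C).
  { unfold Sx. rewrite <- Csum_minus, <- Csum_scal. apply Csum_ext. intros n _. unfold c, p.
    replace (INR j * - (h0 * ln (INR (S n)))) with (- (INR j * (L * h0)) + INR j * h0 * lam n) by (unfold lam; ring).
    replace ((INR j + 2) * h0 * lam n) with (2 * h0 * lam n + INR j * h0 * lam n) by ring.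
    replace ((INR j + 1) * h0 * lam n) with (h0 * lam n + INR j * h0 * lam n) by ring.
    rewrite !cis_plus. ring. }
  rewrite E. unfold er. rewrite RtoC_minus. ring. }
rewrite (mit_ext J (S k) _ _ Ex). rewrite mit_plus, mit_cis.
assert (Ber : Cmod (mit J (S k) er 0) <= 1 / 64).
{ apply mit_bound; auto. intros j Hj.
  (* (k + 1) J + 2 <= (k + 3) J, so all points used stay within H of T. *)
  assert (Hjh : (INR j + 2) * h0 <= H).
  { apply Rle_trans with (2 := HH). apply Rmult_le_compat_r; [lra|].
    destruct Hj as [_ Hj]. apply le_INR in Hj. rewrite plus_INR, mult_INR in Hj. rewrite plus_INR. simpl (INR 3).
    rewrite S_INR in Hj. simpl (INR 0) in Hj. nra. }
  assert (Pj := pos_INR j).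
  assert (Z1 := HZ ((INR j + 2) * h0) ltac:(rewrite Rabs_pos_eq; nra)).
  assert (Z2 := HZ ((INR j + 1) * h0) ltac:(rewrite Rabs_pos_eq; nra)).
  fold L lam in Z1, Z2.
  unfold er. rewrite Cmod_mult, Cmod_cis, Rmult_1_l.
  eapply Rle_trans; [apply Cmod_triangle|]. rewrite Cmod_opp.
  assert (Hsq : 0 < / sqrt T) by (apply Rinv_0_lt_compat, sqrt_lt_R0; auto).
  assert (Q : forall h, 0 <= h <= H -> 400 * (1 + h ^ 2) / sqrt T <= 400 * (1 + H ^ 2) / sqrt T).
  { intros h Hh. apply Rmult_le_compat_r; [lra|]. assert (h ^ 2 <= H ^ 2) by (apply pow_incr; auto). lra. }
  assert (Q1 := Q ((INR j + 2) * h0) ltac:(nra)). assert (Q2 := Q ((INR j + 1) * h0) ltac:(nra)).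
  change (Csum (fun k => b (S k) * cis ((INR j + 2) * h0 * (L - ln (INR (S k)))))%C N) with (Sx ((INR j + 2) * h0)) in Z1.
  change (Csum (fun k => b (S k) * cis ((INR j + 1) * h0 * (L - ln (INR (S k)))))%C N) with (Sx ((INR j + 1) * h0)) in Z2.
  unfold Rdiv in *. lra. }
assert (HNn : (1 < N)%nat) by (apply INR_lt; simpl; lra).
destruct N as [|K]; [lia|].
rewrite (Csum_split _ 1 K : Csum _ (S K) = _).
(* The leading term passes all averages unchanged. Since L h0 = 1/8, its coefficient has modulus
   |e^(i/8) - 1| >= sin(1/8) >= 1 / (4 pi) >= 1/16. *)
assert (Main : 1 / 16 <= Cmod (Csum (fun n => c n * Cpw (dker J (p n)) (S k) * cis (INR 0 * p n))%C 1)).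
{ simpl Csum. rewrite Cplus_0_l, Rmult_0_l, cis_0.
  assert (p0 : p 0%nat = 0) by (unfold p; simpl; rewrite ln_1; ring).
  assert (l0 : lam 0%nat = L) by (unfold lam; simpl; rewrite ln_1; ring).
  rewrite p0, dker_0 by auto.
  assert (Cp1 : forall n, Cpw 1%C n = 1%C) by (induction n; simpl; [auto | rewrite IHn; ring]).
  change (1 * Cpw 1%C k)%C with (Cpw 1%C (S k)). rewrite Cp1, !Cmult_1_r. unfold c. rewrite l0, Hb by lia.
  replace (2 * h0 * L) with (h0 * L + h0 * L) by ring. rewrite cis_plus.
  replace (cis (h0 * L) * cis (h0 * L) - cis (h0 * L))%C with (cis (h0 * L) * (cis (h0 * L) - 1))%C by ring.
  rewrite !Cmod_mult, !Cmod_cis, Cmod_R. simpl INR. rewrite sqrt_1, Rinv_1, Rabs_R1, !Rmult_1_l.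
  replace (h0 * L) with (1 / 8) by lra.
  assert (A := Im_le_Cmod (cis (1 / 8) - 1)%C). change (Rabs (sin (1 / 8) + - 0) <= Cmod (cis (1 / 8) - 1)%C) in A.
  rewrite Ropp_0, Rplus_0_r in A. eapply Rle_trans; [|apply A].
  assert (HP := PI_gt_3). assert (HP4 := PI_4). assert (SC := sin_ge_chord (1 / 8) ltac:(lra)).
  apply Rle_trans with (2 := Rle_abs _). apply Rle_trans with (2 := SC).
  apply Rmult_le_reg_r with PI; [lra|]. replace (2 / PI * (1 / 8) * PI) with (1 / 4) by (field; lra). lra. }
(* For an integer X >= 2 the angle h0 ln X lies between h0 / 2 and 7/8, so its sine is at least h0 /
   4 and each average gains 8 / (J h0). The coefficients, in absolute value, sum to at most 12
   T^2. *)
assert (Rest : Cmod (Csum (fun n => c (1 + n)%nat * Cpw (dker J (p (1 + n)%nat)) (S k) * cis (INR 0 * p (1 + n)%nat))%C K)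
  <= 1 / 64).
{ apply Rle_trans with (2 := HE2). set (rho := 8 / (INR J * h0)).
  assert (Hrho : 0 < rho) by (unfold rho; apply Rdiv_lt_0_compat; [lra | apply Rmult_lt_0_compat; lra]).
  assert (Hrk : 0 < rho ^ S k) by (apply pow_lt; auto).
  assert (Td : forall n, (n < K)%nat -> Cmod (c (1 + n)%nat * Cpw (dker J (p (1 + n)%nat)) (S k) * cis (INR 0 * p (1 + n)%nat))%C
     <= rho ^ S k * (2 * Cmod (b (S (S n))))).
  { intros n Hn. rewrite !Cmod_mult, Cmod_cis, Rmult_1_r, Cmod_Cpw, Rmult_comm.
    apply Rmult_le_compat; try apply pow_le; try apply Cmod_ge_0.
    - apply pow_incr. split; [apply Cmod_ge_0|].
      assert (HP := PI_gt_3). assert (HP4 := PI_4). change (1 + n)%nat with (S n).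
      set (X := INR (S (S n))). assert (HX : 2 <= X <= INR (S K)).
      { unfold X. split; [apply (le_INR 2); lia | apply le_INR; lia]. }
      assert (l1 : / 2 < ln X) by (apply Rlt_le_trans with (1 := ln_lt_2), ln_le; lra).
      assert (l2 : ln X <= 7 * L) by (apply Rle_trans with (2 := Lc), ln_le; lra).
      assert (Hphi : 0 < h0 * ln X <= 7 / 8) by (split; [apply Rmult_lt_0_compat; lra | nra]).
      assert (SC := sin_ge_chord (h0 * ln X) ltac:(lra)).
      assert (S1 : h0 / 4 <= sin (h0 * ln X)).
      { apply Rle_trans with (2 := SC). apply Rmult_le_reg_r with PI; [lra|].
        replace (2 / PI * (h0 * ln X) * PI) with (2 * (h0 * ln X)) by (field; lra). nra. }
      assert (Es : Rabs (sin (p (S n))) = sin (h0 * ln X)).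
      { unfold p. fold X. rewrite sin_neg, Rabs_Ropp, Rabs_pos_eq; lra. }
      eapply Rle_trans; [apply dker_bound; auto; rewrite Es; lra|]. rewrite Es. unfold rho.
      replace (8 / (INR J * h0)) with (2 / (INR J * (h0 / 4))) by (field; lra).
      apply Rmult_le_compat_l; [lra|]. apply Rinv_le_contravar; [apply Rmult_lt_0_compat; lra|].
      apply Rmult_le_compat_l; lra.
    - unfold c. rewrite Cmod_mult, Rmult_comm. apply Rmult_le_compat_r; [apply Cmod_ge_0|].
      eapply Rle_trans; [apply Cmod_triangle|]. rewrite Cmod_opp, !Cmod_cis. lra. }
  eapply Rle_trans; [apply Cmod_Csum|].
  eapply Rle_trans; [apply (Rsum_le _ _ K Td)|]. rewrite !Rsum_scal.
  rewrite (Rmult_comm (12 * T ^ 2)). apply Rmult_le_compat_l; [lra|].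
  assert (Sb : Rsum (fun n => Cmod (b (S (S n)))) K <= 2 * sqrt (INR (S K)) + 2 * sqrt T).
  { destruct K as [|K']; [lia|]. rewrite Rsum_S. apply Rplus_le_compat; auto.
    apply Rle_trans with (Rsum (fun n => / sqrt (INR (S (1 + n)))) K').
    - apply Rsum_le. intros n Hn. rewrite Hb by lia. rewrite Cmod_mult, Cmod_cis, Cmod_R, Rmult_1_r, Rabs_pos_eq.
      + apply Rle_refl.
      + left; apply Rinv_0_lt_compat, sqrt_lt_R0, lt_0_INR; lia.
    - eapply Rle_trans; [apply Rsum_inv_sqrt|]. apply Rmult_le_compat_l; [lra|]. apply sqrt_le_1_alt, le_INR; lia. }
  assert (sqrt (INR (S K)) <= 2 * T ^ 2).
  { rewrite <- (sqrt_pow2 (2 * T ^ 2)) by nra. apply sqrt_le_1_alt. apply (Rle_trans _ _ _ (proj2 HN)).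
    replace ((2 * T ^ 2) ^ 2) with (4 * T * T ^ 3) by ring. assert (1 <= T ^ 3) by lra. nra. }
  assert (sqrt T <= T ^ 2).
  { rewrite <- (sqrt_pow2 (T ^ 2)) by nra. apply sqrt_le_1_alt. replace ((T ^ 2) ^ 2) with (T * T ^ 3) by ring. nra. }
  lra. }
set (U := Csum _ 1) in *. set (V := Csum _ K) in *. set (W := mit J (S k) er 0) in *.
assert (Tri : Cmod U <= Cmod (U + V + W)%C + Cmod V + Cmod W).
{ replace U with ((U + V + W) + - V + - W)%C at 1 by ring.
  eapply Rle_trans; [apply Cmod_triangle|]. rewrite Cmod_opp. apply Rplus_le_compat_r.
  eapply Rle_trans; [apply Cmod_triangle|]. rewrite Cmod_opp. lra. }
assert (Hfin : 1 / 32 <= Cmod (U + V + W)%C) by lra. exact Hfin.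
Qed.

(** Without a root of odd order Z' cannot take values of both signs on (a, b), so Z is monotone
    there by the mean value theorem. *)
Lemma Zfun_increments_sign a b : a < b ->
  ~ (exists t, a < t < b /\ odd_order_root_of_deriv Zfun t) ->
  (forall x y, a < x -> x <= y -> y < b -> Zfun x <= Zfun y) \/
  (forall x y, a < x -> x <= y -> y < b -> Zfun y <= Zfun x).
Proof.
intros Hab Hno. destruct (smooth_deriv_seq _ Zfun_smooth) as [D HD].
assert (Hs : forall x y, a < x < b -> a < y < b -> ~ D 1%nat x * D 1%nat y < 0).
{ intros x y Hx Hy H. apply Hno. destruct (odd_order_root_of_sign_change x y D HD H) as [c [Hc Ho]].
  exists c. split; auto. revert Hc. unfold Rmin, Rmax. destruct (Rle_dec x y); lra. }
assert (MV : forall x y, x < y -> exists c, Zfun y - Zfun x = D 1%nat c * (y - x) /\ x < c < y).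
{ intros x y Hxy. apply MVT_cor2; auto. intros c _. destruct HD as [<- HD]. apply HD. }
destruct (classic (exists x, a < x < b /\ 0 < D 1%nat x)) as [[x0 [Hx0 P]]|N].
- left. intros x y Hx Hxy Hy. destruct Hxy as [Hxy| ->]; [|lra].
  destruct (MV x y Hxy) as [c [E Hc]]. assert (A := Hs x0 c Hx0 ltac:(lra)).
  assert (0 <= D 1%nat c) by (apply Rnot_lt_le; intros H; apply A; nra). nra.
- right. intros x y Hx Hxy Hy. destruct Hxy as [Hxy| ->]; [|lra].
  destruct (MV x y Hxy) as [c [E Hc]].
  assert (D 1%nat c <= 0) by (apply Rnot_lt_le; intros H; apply N; exists c; split; auto; lra). nra.
Qed.

Lemma Rsum_telescope (f : nat -> R) n : Rsum (fun l => f (S l) - f l) n = f n - f 0%nat.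
Proof. induction n; [simpl; ring|]. rewrite Rsum_S, IHn. ring. Qed.

Theorem mainTheorem1 :
  forall Delta : R, 0 < Delta < 1 / 6 ->
  (exists A : R, 0 < A /\
     exists t0 : R, forall t a b : R,
       t0 <= t -> 0 < a -> a <= b -> b <= 2 * a -> b <= sqrt (t / (2 * PI)) ->
       sqrt (expsum_re t a b ^ 2 + expsum_im t a b ^ 2)
         < A * sqrt a * Rpower t Delta) ->
  forall psi : R -> R,
    (forall T : R, 0 < psi T) ->
    (forall M : R, exists T0 : R, forall T : R, T0 <= T -> M <= psi T) ->
    exists T1 : R, forall T : R, T1 <= T ->
      exists t : R, T < t < T + Rpower T Delta * psi T /\
        odd_order_root_of_deriv Zfun t.
Proof.
intros Delta HD [A [HA [t0 Hyp]]] psi Hpsi0 Hpsi.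
destruct (Z_bound Delta A t0 (proj1 HD) HA Hyp) as [C [T1 [HC HZb]]].
(* With (k + 1) Delta >= 4 the k + 1 averages gain a factor of order T^(-4), ample against the T^2
   of the terms n >= 2. *)
destruct (nat_ceil (4 / Delta)) as [k Hk]; [apply Rdiv_le_0_compat; lra|].
assert (HkD : 4 <= INR (S k) * Delta).
{ rewrite S_INR. apply Rle_trans with (4 / Delta * Delta); [right; field; lra | apply Rmult_le_compat_r; lra]. }
set (k3 := INR (k + 3)). assert (Hk3 : 3 <= k3) by (unfold k3; rewrite plus_INR; simpl; generalize (pos_INR k); lra).
(* The final contradiction asks for M > 256 C k3; the summand 2 k3 ensures X >= 2 below, hence J >=
   1 and J >= X / 2. *)
set (M := 1024 * C * k3 + 2 * k3 + 1).
assert (HM : 1 <= M) by (unfold M; assert (0 < C * k3) by (apply Rmult_lt_0_compat; lra); lra).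
destruct (Hpsi M) as [T0 HT0].
(* 51200 = 64 * 800: once T^(1/6) >= Q, the error 800 (1 + H^2) / sqrt T is at most 1/64. *)
set (Q := 51200 * (1 + M ^ 2)). assert (HQ : 51200 <= Q /\ 2 * M <= Q) by (unfold Q; split; nra).
set (Kk := (16 * k3) ^ S k). assert (HKk : 0 < Kk) by (apply pow_lt; lra).
exists (Rmax (Rmax T0 T1) (Rmax (exp 30) (Rmax (Q ^ 6) (768 * Kk)))). intros T HT.
assert (HTT0 : T0 <= T) by (eapply Rle_trans; [eapply Rle_trans; [apply Rmax_l | apply Rmax_l] | eauto]).
assert (HTT1 : T1 <= T) by (eapply Rle_trans; [eapply Rle_trans; [apply Rmax_r | apply Rmax_l] | eauto]).
assert (HR := Rle_trans _ _ _ (Rmax_r _ _) HT).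
assert (HTe : exp 30 <= T) by (eapply Rle_trans; [apply Rmax_l | eauto]).
assert (HR2 := Rle_trans _ _ _ (Rmax_r _ _) HR).
assert (HTQ : Q ^ 6 <= T) by (eapply Rle_trans; [apply Rmax_l | eauto]).
assert (HTK : 768 * Kk <= T) by (eapply Rle_trans; [apply Rmax_r | eauto]).
clear HT HR HR2.
assert (HT31 : 31 <= T) by (generalize (exp_ineq1_le 30); lra).
assert (HT : 0 < T) by lra.
assert (Hl : 30 <= ln T) by (rewrite <- (ln_exp 30); apply ln_le; [apply exp_pos | auto]).
set (Td := Rpower T Delta).
assert (HTd1 : 1 <= Td).
{ unfold Td, Rpower. rewrite <- exp_0. apply exp_le. apply Rmult_le_pos; lra. }
(* Delta < 1/6 enters here: T^Delta <= u, so H^2 / sqrt T <= M^2 u^2 / u^3 = M^2 / u. *)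
set (u := Rpower T (1 / 6)).
assert (Hu6 : u ^ 6 = T).
{ unfold u. rewrite <- Rpower_pow by apply exp_pos. rewrite Rpower_mult. replace (1 / 6 * INR 6) with 1 by (simpl; field).
    apply Rpower_1; auto. }
assert (Hu0 : 0 < u) by apply exp_pos.
assert (HuQ : Q <= u).
{ replace Q with (Rpower (Q ^ 6) (1 / 6)).
  - apply Rle_Rpower_l; [lra|]. split; auto. apply pow_lt; lra.
  - rewrite <- Rpower_pow, Rpower_mult by lra. replace (INR 6 * (1 / 6)) with 1 by (simpl; field). apply Rpower_1; lra. }
assert (HTdu : Td <= u) by (unfold Td, u; apply Rle_Rpower; lra).
assert (HsT : sqrt T = u ^ 3).
{ rewrite <- Hu6. replace (u ^ 6) with ((u ^ 3) ^ 2) by ring. apply sqrt_pow2, pow_le; lra. }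
set (H := M * Td).
assert (HH1 : M <= H) by (unfold H; rewrite <- (Rmult_1_r M) at 1; apply Rmult_le_compat_l; lra).
assert (HHu : H <= M * u) by (apply Rmult_le_compat_l; lra).
destruct (Lam_bounds T Hl HT) as [L1 L2].
assert (E1 : 1 <= H <= T / 2).
{ split; [lra|]. apply (Rle_trans _ _ _ HHu). apply Rle_trans with (u * u / 2).
  - assert (M * u <= u / 2 * u) by (apply Rmult_le_compat_r; lra). lra.
  - rewrite <- Hu6. assert (u ^ 2 <= u ^ 6) by (apply Rle_pow; [lra|lia]). simpl in *. lra. }
assert (E2 : 800 * (1 + H ^ 2) / sqrt T <= 1 / 64).
{ rewrite HsT. assert (P3 : 0 < u ^ 3) by (apply pow_lt; auto).
  apply Rmult_le_reg_r with (u ^ 3); auto. unfold Rdiv. rewrite Rmult_assoc, Rinv_l, Rmult_1_r by lra.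
  assert (H2 : H ^ 2 <= M ^ 2 * u ^ 2) by (rewrite <- Rpow_mult_distr; apply pow_incr; lra).
  assert (U2 : 1 <= u ^ 2) by (apply pow_R1_Rle; lra).
  assert (Qu : Q * u ^ 2 <= u ^ 3).
  { replace (u ^ 3) with (u * u ^ 2) by ring. apply Rmult_le_compat_r; lra. }
  assert (Q * u ^ 2 = 51200 * (u ^ 2 + M ^ 2 * u ^ 2)) by (unfold Q; ring). lra. }
set (h0 := / (8 * Lam T)).
assert (Hh0 : 0 < h0 <= 1).
{ unfold h0. split; [apply Rinv_0_lt_compat; lra|]. rewrite <- Rinv_1. apply Rinv_le_contravar; lra. }
(* J, the integer part of X, is the largest number of steps per average for which k + 3 blocks of J
   steps fit into H. *)
set (X := H / (k3 * h0)).
assert (Hkh : 0 < k3 * h0 <= k3) by (split; [apply Rmult_lt_0_compat; lra | nra]).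
assert (HX2 : 2 <= X).
{ unfold X. apply Rmult_le_reg_r with (k3 * h0); [lra|]. unfold Rdiv. rewrite Rmult_assoc, Rinv_l, Rmult_1_r by lra.
  assert (0 < C * k3) by (apply Rmult_lt_0_compat; lra). unfold M in HH1. lra. }
destruct (nfloor_ex X ltac:(lra)) as [J [HJ1 HJ2]].
assert (HJ : (1 <= J)%nat) by (apply INR_le; simpl; lra).
assert (HJX : X / 2 <= INR J) by lra.
assert (HJ0 : 0 < INR J) by lra.
assert (E3 : k3 * INR J * h0 <= H).
{ replace H with (k3 * X * h0) by (unfold X; field; lra). apply Rmult_le_compat_r; [lra|]. apply Rmult_le_compat_l; lra. }
assert (HJh : Td / (2 * k3) <= INR J * h0).
{ apply Rle_trans with (X / 2 * h0); [|apply Rmult_le_compat_r; lra].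
  replace (X / 2 * h0) with (H / (2 * k3)) by (unfold X; field; lra).
  apply Rmult_le_compat_r; [left; apply Rinv_0_lt_compat; lra|]. unfold H. rewrite <- (Rmult_1_l Td) at 1. apply
    Rmult_le_compat_r; lra. }
assert (E4 : 12 * T ^ 2 * (8 / (INR J * h0)) ^ S k <= 1 / 64).
{ assert (Hq : 0 < Td / (2 * k3)) by (apply Rdiv_lt_0_compat; lra).
  assert (R1 : 8 / (INR J * h0) <= 16 * k3 / Td).
  { replace (16 * k3 / Td) with (8 / (Td / (2 * k3))) by (field; lra). apply Rmult_le_compat_l; [lra|]. apply
      Rinv_le_contravar; auto. }
  assert (R2 : (8 / (INR J * h0)) ^ S k <= Kk * / Td ^ S k).
  { unfold Kk. rewrite <- pow_inv, <- Rpow_mult_distr. apply pow_incr. split; [|exact R1]. apply Rdiv_le_0_compat; lra. }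
  assert (R3 : T ^ 4 <= Td ^ S k).
  { rewrite <- (Rpower_pow (S k)) by (unfold Td; apply exp_pos). unfold Td. rewrite Rpower_mult.
    rewrite <- (Rpower_pow 4) by auto. apply Rle_Rpower; [lra|]. simpl (INR 4). lra. }
  assert (P4 : 0 < T ^ 4) by (apply pow_lt; auto).
  assert (R4 : / Td ^ S k <= / T ^ 4) by (apply Rinv_le_contravar; auto).
  apply Rle_trans with (12 * T ^ 2 * (Kk * / T ^ 4)).
  - apply Rmult_le_compat_l; [nra|]. apply (Rle_trans _ _ _ R2). apply Rmult_le_compat_l; lra.
  - replace (12 * T ^ 2 * (Kk * / T ^ 4)) with (12 * Kk / T ^ 2) by (field; lra).
    apply Rmult_le_reg_r with (T ^ 2); [nra|]. unfold Rdiv. rewrite Rmult_assoc, Rinv_l, Rmult_1_r by nra. nra. }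
assert (LB := increments_lower_bound T J k H Hl HT HJ E3 E1 E2 E4). fold h0 in LB.
(* As t <= 2 T, the factors T^Delta and ln T each at most double. *)
assert (HZm : forall t, T <= t <= T + H -> Rabs (Zfun t) <= 4 * C * Td * ln T).
{ intros t Ht. eapply Rle_trans; [apply HZb; lra|].
  assert (B1 : Rpower t Delta <= 2 * Td).
  { apply Rle_trans with (Rpower (2 * T) Delta); [apply Rle_Rpower_l; lra|].
    rewrite <- Rpower_mult_distr by lra. apply Rmult_le_compat_r; [lra|].
    rewrite <- (Rpower_1 2) at 2 by lra. apply Rle_Rpower; lra. }
  assert (B2 : ln t <= 2 * ln T).
  { replace (2 * ln T) with (ln T + ln T) by ring. rewrite <- ln_mult by lra. apply ln_le; [lra|]. nra. }
  replace (4 * C * Td * ln T) with (C * (2 * Td * (2 * ln T))) by ring.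
  apply Rmult_le_compat_l; [lra|]. apply Rmult_le_compat; auto.
  - left; apply exp_pos.
  - rewrite <- ln_1. apply ln_le; lra. }
destruct (classic (exists t, T < t < T + H /\ odd_order_root_of_deriv Zfun t)) as [[t [Ht Ho]]|N].
{ exists t. split; auto. split; [lra|]. apply Rlt_le_trans with (1 := proj2 Ht). apply Rplus_le_compat_l.
  unfold H. rewrite Rmult_comm. apply Rmult_le_compat_l; [lra|]. apply HT0; auto. }
exfalso.
assert (Sg := Zfun_increments_sign T (T + H) ltac:(lra) N).
set (f := fun j => Zfun (T + (INR j + 1) * h0)).
assert (Inside : forall j, (j <= k * J + J)%nat -> T < T + (INR j + 1) * h0 < T + H).
{ intros j Hj. assert (Pj := pos_INR j). split; [nra|]. apply Rplus_lt_compat_l.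
  apply Rlt_le_trans with (k3 * INR J * h0); auto. apply Rmult_lt_compat_r; [lra|].
  apply le_INR in Hj. rewrite plus_INR, mult_INR in Hj. unfold k3. rewrite plus_INR. simpl (INR 3).
  assert (1 <= INR J) by (apply (le_INR 1); auto). nra. }
(* The average taken first is enough: once the phases are dropped, its increments have one sign and
   telescope to a difference of two values of Z, at most 8 C T^Delta ln T. The other k averages do
   not increase the supremum. *)
assert (UB : Cmod (mit J (S k) (fun j => cis (- (INR j * (Lam T * h0))) * RtoC (Zfun (T + (INR j + 2) * h0) - Zfun (T + (INR
  j + 1) * h0)))%C 0) <= 8 * C * Td * ln T / INR J).
{ simpl mit. apply mit_bound; auto. intros j Hj.
  unfold mavg. rewrite Cmod_mult, Cmod_R, Rabs_pos_eq by (left; apply Rinv_0_lt_compat; auto).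
  unfold Rdiv. rewrite (Rmult_comm _ (/ INR J)). apply Rmult_le_compat_l; [left; apply Rinv_0_lt_compat; auto|].
  eapply Rle_trans; [apply Cmod_Csum|].
  set (g := fun l => f (j + l)%nat).
  apply Rle_trans with (Rsum (fun l => Rabs (g (S l) - g l)) J).
  - apply Rsum_le. intros l Hl'. rewrite Cmod_mult, Cmod_cis, Rmult_1_l, Cmod_R. unfold g, f.
    replace (INR (j + S l) + 1) with (INR (j + l) + 2) by (rewrite Nat.add_succ_r, S_INR; ring). apply Rle_refl.
  - rewrite constant_sign_sum.
    + rewrite Rsum_telescope. unfold Rminus. eapply Rle_trans; [apply Rabs_triang|]. rewrite Rabs_Ropp.
      assert (I1 := Inside (j + J)%nat ltac:(lia)). assert (I2 := Inside (j + 0)%nat ltac:(lia)).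
      assert (Z1 := HZm _ (conj (Rlt_le _ _ (proj1 I1)) (Rlt_le _ _ (proj2 I1)))).
      assert (Z2 := HZm _ (conj (Rlt_le _ _ (proj1 I2)) (Rlt_le _ _ (proj2 I2)))).
      unfold g, f. lra.
    + destruct Sg as [Sg|Sg]; [left|right]; intros l Hl'; unfold g, f;
       assert (I1 := Inside (j + l)%nat ltac:(lia)); assert (I2 := Inside (j + S l)%nat ltac:(lia));
       assert (T + (INR (j + l) + 1) * h0 <= T + (INR (j + S l) + 1) * h0) by (rewrite Nat.add_succ_r, S_INR; lra);
       specialize (Sg _ _ (proj1 I1) H0 (proj2 I2)); lra. }
(* A unit length holds 8 [Lam T] >= 2 ln T steps; the ln T gained in J cancels the ln T in the bound
   for Z. *)
assert (HJM : M * Td * ln T / k3 <= INR J).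
{ apply Rle_trans with (2 := HJX).
  replace (X / 2) with (M * Td * (4 * Lam T) / k3) by (unfold X, H, h0; field; split; lra).
  apply Rmult_le_compat_r; [left; apply Rinv_0_lt_compat; lra|]. apply Rmult_le_compat_l; [|lra].
  apply Rmult_le_pos; lra. }
assert (Hpos : 0 < Td * ln T) by (apply Rmult_lt_0_compat; lra).
assert (Fin : 8 * C * Td * ln T / INR J < 1 / 32).
{ apply Rmult_lt_reg_r with (INR J); auto. unfold Rdiv. rewrite Rmult_assoc, Rinv_l, Rmult_1_r by lra.
  apply Rlt_le_trans with (1 / 32 * (M * Td * ln T / k3)); [|apply Rmult_le_compat_l; lra].
  apply Rmult_lt_reg_r with k3; [lra|].
  replace (1 / 32 * (M * Td * ln T / k3) * k3) with (M / 32 * (Td * ln T)) by (field; lra).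
  replace (8 * C * Td * ln T * k3) with (8 * C * k3 * (Td * ln T)) by ring.
  apply Rmult_lt_compat_r; auto. assert (0 < C * k3) by (apply Rmult_lt_0_compat; lra). unfold M. lra. }
lra.
Qed.
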